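(* Let $K\ge 1$ and let $f=h+\overline{g}\in\mathcal{S}_H(K)$. Set $$\alpha_K:=\sup_{f=h+\overline{g}\,\in\,\mathcal{S}_H(K)}\left|\frac{h''(0)}{2}\right|.$$ Then $f\in\mathbf{h}^p$ for every $p$ with $0<p<1/\alpha_K$.
   Context: $\mathbb{D}=\{z\in\mathbb{C}:|z|<1\}$. $\mathcal{H}$ denotes the class of complex-valued harmonic functions $f=h+\overline{g}$ on $\mathbb{D}$, with $h,g$ analytic in $\mathbb{D}$, normalized by $h(0)=g(0)=0$ and $h'(0)=1$. Such an $f$ is sense-preserving if its Jacobian $J_f=|h'|^2-|g'|^2$ is positive on $\mathbb{D}$; then its analytic dilatation $\omega=g'/h'$ is an analytic map $\mathbb{D}\to\mathbb{D}$. $\mathcal{S}_H$ is the class of all sense-preserving univalent (injective) $f\in\mathcal{H}$. For $K\ge 1$ put $k=(K-1)/(K+1)\in[0,1)$, i.e. $K=(1+k)/(1-k)$. $\mathcal{S}_H(K)$ is the class of $f\in\mathcal{S}_H$ that are $K$-quasiconformal, i.e. satisfy $|\omega(z)|\le k$ for all $z\in\mathbb{D}$. For $0<p<\infty$, $\mathbf{h}^p$ is the set of complex-valued harmonic functions $\Phi$ on $\mathbb{D}$ with $\sup_{0<r<1}M_p(r,\Phi)<\infty$, where $M_p(r,\Phi)=\left(\frac{1}{2\pi}\int_0^{2\pi}|\Phi(re^{i\theta})|^p\,d\theta\right)^{1/p}$. *)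

(* Defs.v *)
From mathcomp Require Import all_boot all_order all_algebra.
From mathcomp Require Import complex.
From mathcomp Require Import all_classical all_reals all_analysis.

Set Implicit Arguments.
Unset Strict Implicit.
Unset Printing Implicit Defensive.

Import Order.TTheory GRing.Theory Num.Theory numFieldNormedType.Exports.

Local Open Scope classical_set_scope.
Local Open Scope complex_scope.
Local Open Scope ring_scope.

Section HarmonicMappings.
Variable R : realType.

(* As a topological and normed space, C is the regular module R[i]^o, so that
   derivable and derive1 below are complex differentiation.  Functions on the
   unit disc are total functions C -> C whose values outside the disc are
   never constrained or used.  The modulus is real-valued, unlike the norm
   `|z| of R[i], which lies in R[i]. *)
Local Notation C := (R[i]^o).

Definition modulus (z : C) : R := Normc.normc z.

Definition disc : set C := [set z | modulus z < 1].

Definition analytic_on_disc (h : C -> C) : Prop :=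
  forall z, disc z -> derivable h z 1.

(* f = h + conj g, with h and g normalized as in the class H; the class
   predicates take the triple (f, h, g) since the coefficients, the Jacobian
   and the dilatation of f are expressed through h and g. *)
Definition class_H (f h g : C -> C) : Prop :=
  [/\ analytic_on_disc h /\ analytic_on_disc g,
      forall z, disc z -> f z = h z + (g z)^*%C,
      h 0 = 0 /\ g 0 = 0
    & derive1 h 0 = 1].

Definition harm_jacobian (h g : C -> C) (z : C) : R :=
  modulus (derive1 h z) ^+ 2 - modulus (derive1 g z) ^+ 2.

Definition sense_preserving (h g : C -> C) : Prop :=
  forall z, disc z -> 0 < harm_jacobian h g z.

Definition dilatation (h g : C -> C) (z : C) : C := derive1 g z / derive1 h z.

Definition univalent (f : C -> C) : Prop := {in disc &, injective f}.

Definition class_SH (f h g : C -> C) : Prop :=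
  [/\ class_H f h g, sense_preserving h g & univalent f].

Definition class_SHK (K : R) (f h g : C -> C) : Prop :=
  class_SH f h g /\
  forall z, disc z -> modulus (dilatation h g z) <= (K - 1) / (K + 1).

(* The supremum is taken in the extended reals: no finiteness is presupposed. *)
Definition alpha (K : R) : \bar R :=
  ereal_sup [set x | exists f h g : C -> C,
    class_SHK K f h g /\ x = (modulus (derive1 (derive1 h) 0 / 2))%:E].

Definition shift_re (z : C) (t : R) : C := z + (t +i* 0).
Definition shift_im (z : C) (t : R) : C := z + (0 +i* t).

Definition partial_x (u : C -> R) (z : C) : R := derive1 (u \o shift_re z) 0.
Definition partial_y (u : C -> R) (z : C) : R := derive1 (u \o shift_im z) 0.

Definition C1_on_disc (u : C -> R) : Prop :=
  forall z, disc z ->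
    [/\ derivable (u \o shift_re z) 0 1, derivable (u \o shift_im z) 0 1,
        {for z, continuous (partial_x u)}
      & {for z, continuous (partial_y u)}].

Definition real_harmonic (u : C -> R) : Prop :=
  [/\ C1_on_disc u, C1_on_disc (partial_x u), C1_on_disc (partial_y u)
    & forall z, disc z ->
        partial_x (partial_x u) z + partial_y (partial_y u) z = 0].

Definition harmonic_on_disc (Phi : C -> C) : Prop :=
  real_harmonic (fun z => complex.Re (Phi z)) /\
  real_harmonic (fun z => complex.Im (Phi z)).

Definition circle_point (r theta : R) : C :=
  (r * cos theta) +i* (r * sin theta).

Definition integral_mean (p r : R) (Phi : C -> C) : \bar R :=
  (((2 * pi)^-1%:E *
    \int[@lebesgue_measure R]_(theta in `[0%R, (2 * pi)%R])
       (modulus (Phi (circle_point r theta)) `^ p)%:E) `^ p^-1)%E.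

Definition hardy_h (p : R) (Phi : C -> C) : Prop :=
  harmonic_on_disc Phi /\
  (ereal_sup [set integral_mean p r Phi | r in `]0%R, 1%R[] < +oo)%E.

End HarmonicMappings.

(* Main.v *)
Require Import Defs.
From mathcomp Require Import all_boot all_order all_algebra.
From mathcomp Require Import complex.
From mathcomp Require Import all_classical all_reals all_analysis.
From mathcomp Require Import measurable_realfun.
From mathcomp Require Import ring lra.
Import Order.TTheory GRing.Theory Num.Theory numFieldNormedType.Exports.
Local Open Scope ring_scope.

Set Implicit Arguments.
Unset Strict Implicit.
Unset Printing Implicit Defensive.
Local Open Scope classical_set_scope.

(** Let [f = h + conj g] be K-quasiconformal in the class, with dilatation
bounded by [k < 1], and let [A] be a number with [alpha K < A] and [p * A < 1].

Growth.  For every point [a] of the disc the normalized composition of [f] with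
a disc automorphism sending 0 to [a] is again in the class
([koebe_transform]), and its second coefficient is half of
[(1 - |a|^2) h''(a) / h'(a) - 2 conj a].  So the extremal problem that defines
[alpha K] bounds the pre-Schwarzian derivative [h'' / h'] at every point, and
integrating this bound along radii gives [|h'(z)| = O((1 - |z|)^-(A+1))] and
[|f(z)| = O((1 - |z|)^-A)] ([h'_growth], [f_growth]).

Length and area.  The growth bound says how large [f] is near the circle, not
how often; large values are rare because [f] is univalent.  Suppose [|f| <= t]
on [|z| <= 1 - tau].  Along a radius on which [|f|] exceeds [2 t] at distance
[r] from 0, the function has to cross the values between [t] and [2 t] within a
length [tau], so by the Cauchy-Schwarz inequality the integral of [|h'|^2] over
the part where [|f| <= 3 t] is at least [t^2 / tau], up to a constant.  But
[|h'|^2] is at most [1 / (1 - k^2)] times the Jacobian of the injective map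
[f], so its integral over all these parts is of the order of the area of the
disc of radius [3 t].  Hence the directions in which [|f| > 2 t] at distance
[r] have measure [O(tau)], uniformly in [r].  With [tau = 2^-n / 4] the growth
bound allows [t] of the order of [2^(A n)], and summing over the layers gives
the [p]-th mean because [2^(A p) < 2].

The length-area step is carried out on a polar grid of mesh [1/N]
([count_large]): a change of variables is replaced by the facts that [f] maps
the disc of radius about [1/N] around a grid point [z] onto a set that contains
a square of side about [|h'(z)| / N] around [f z] ([f_covering]), and that
disjoint squares in a large square have total area at most the area of the
latter ([square_packing]).  The resulting bound for Riemann sums passes to the
integrals ([integral_le_riemann]).

Harmonicity and the pre-Schwarzian derivative require that the derivative of a
complex differentiable function be differentiable.  This is obtained from
Goursat's lemma ([goursat]) and Cauchy's formula on a square
([derive1_derivable]). *)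

(** * Modulus of complex numbers *)

Section Modulus.
Variable R : realType.
Local Notation C := (R[i]^o).
Implicit Types z w : C.

Definition ofR (x : R) : C := real_complex R x.

Lemma cnormE z : `|z| = ofR (modulus z).
Proof. by []. Qed.

Lemma modulus_ge0 z : 0 <= modulus z.
Proof. by case: z => a b; rewrite /modulus /= sqrtr_ge0. Qed.

Lemma modulus0 : modulus (0 : C) = 0.
Proof. exact: Normc.normc0. Qed.

Lemma modulus1 : modulus (1 : C) = 1.
Proof. exact: Normc.normc1. Qed.

Lemma modulusM z w : modulus (z * w) = modulus z * modulus w.
Proof. exact: Normc.normcM. Qed.

Lemma modulusV z : modulus z^-1 = (modulus z)^-1.
Proof. exact: Normc.normcV. Qed.

Lemma modulusN z : modulus (- z) = modulus z.
Proof. exact: normcN. Qed.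

Lemma modulusD z w : modulus (z + w) <= modulus z + modulus w.
Proof. exact: le_normcD. Qed.

Lemma modulus_distC z w : modulus (z - w) = modulus (w - z).
Proof. by rewrite -modulusN opprB. Qed.

Lemma modulusB z w : modulus (z - w) <= modulus z + modulus w.
Proof. by rewrite -(modulusN w); exact: modulusD. Qed.

Lemma modulus_lB z w : modulus z - modulus w <= modulus (z - w).
Proof. by rewrite lerBlDr; apply: le_trans (modulusD _ _); rewrite subrK. Qed.

Lemma modulus_eq0 z : (modulus z == 0) = (z == 0).
Proof.
by apply/eqP/eqP => [/Normc.eq0_normc //|->]; rewrite modulus0.
Qed.

Lemma modulus_gt0 z : (0 < modulus z) = (z != 0).
Proof. by rewrite lt_def modulus_ge0 andbT modulus_eq0. Qed.

Lemma modulus_div z w : modulus (z / w) = modulus z / modulus w.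
Proof. by rewrite modulusM modulusV. Qed.

Lemma modulusX z n : modulus (z ^+ n) = modulus z ^+ n.
Proof. by elim: n => [|n IH]; rewrite ?expr0 ?modulus1 // !exprS modulusM IH. Qed.

Lemma modulusJ z : modulus (z^*%C : C) = modulus z.
Proof. by case: z => a b; rewrite /modulus /= sqrrN. Qed.

Lemma modulus_ofR x : modulus (ofR x) = `|x|.
Proof. by rewrite /modulus /ofR /= expr0n addr0 sqrtr_sqr. Qed.

Lemma modulus_i : modulus ('i%C : C) = 1.
Proof. by rewrite /modulus /= expr0n add0r expr1n sqrtr1. Qed.

Lemma sqr_modulus z : modulus z ^+ 2 = complex.Re z ^+ 2 + complex.Im z ^+ 2.
Proof.
by case: z => a b; rewrite /modulus /= sqr_sqrtr // addr_ge0 // sqr_ge0.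
Qed.

Lemma Re_le_modulus z : `|complex.Re z| <= modulus z.
Proof.
rewrite -(ler_pXn2r (n:=2)) ?nnegrE ?modulus_ge0 // sqr_modulus real_normK ?num_real //.
by rewrite lerDl sqr_ge0.
Qed.

Lemma Im_le_modulus z : `|complex.Im z| <= modulus z.
Proof.
rewrite -(ler_pXn2r (n:=2)) ?nnegrE ?modulus_ge0 // sqr_modulus real_normK ?num_real //.
by rewrite lerDr sqr_ge0.
Qed.

Lemma modulus_le_ReIm z : modulus z <= `|complex.Re z| + `|complex.Im z|.
Proof.
rewrite -(ler_pXn2r (n:=2)) ?nnegrE ?modulus_ge0 ?addr_ge0 // sqr_modulus.
rewrite sqrrD !real_normK ?num_real // -addrA [X in _ <= _ + X]addrC addrA lerDl.
by rewrite mulrn_wge0 // mulr_ge0.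
Qed.

Lemma complexP z w : complex.Re z = complex.Re w -> complex.Im z = complex.Im w -> z = w.
Proof. by case: z w => a b [c d] /= -> ->. Qed.

Lemma cReD z w : complex.Re (z + w) = complex.Re z + complex.Re w.
Proof. by case: z w => a b [c d]. Qed.
Lemma cImD z w : complex.Im (z + w) = complex.Im z + complex.Im w.
Proof. by case: z w => a b [c d]. Qed.
Lemma cReN z : complex.Re (- z) = - complex.Re z.
Proof. by case: z. Qed.
Lemma cImN z : complex.Im (- z) = - complex.Im z.
Proof. by case: z. Qed.
Lemma cReM z w : complex.Re (z * w) =
  complex.Re z * complex.Re w - complex.Im z * complex.Im w.
Proof. by case: z w => a b [c d]. Qed.
Lemma cImM z w : complex.Im (z * w) =
  complex.Re z * complex.Im w + complex.Im z * complex.Re w.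
Proof. by case: z w => a b [c d]. Qed.

(** Every modulus is attained as the real part of a rotation of the number;
this reduces vector-valued mean value estimates to scalar ones. *)
Lemma modulus_rot z :
  exists2 c : C, modulus c = 1 & complex.Re (c * z) = modulus z.
Proof.
have [->|z0] := eqVneq z 0.
  by exists 1; rewrite ?modulus1 // mulr0 modulus0.
have m0 : modulus z != 0 by rewrite modulus_eq0.
exists (z^*%C / ofR (modulus z)).
  by rewrite modulus_div modulusJ modulus_ofR ger0_norm ?modulus_ge0 // divff.
rewrite mulrAC (_ : z^*%C * z = ofR (modulus z ^+ 2)); last first.
  rewrite sqr_modulus; clear; case: z => a b; apply: complexP;
  rewrite /ofR ?cReM ?cImM /=; ring.
rewrite /ofR -rmorphV ?unitfE // -rmorphM /= expr2 mulfK //.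
Qed.

End Modulus.

(** * Complex derivatives and velocities of curves *)

Section Calculus.

(** In this form estimates of the remainder can be read off and proved by
hand; the field is generic to serve real and complex functions alike. *)
Lemma is_derive_eps (K : numFieldType) (h : K^o -> K^o) (z l : K) :
  is_derive (z : K^o) (1 : K^o) h l <->
  forall e : K, 0 < e -> exists2 d : K, 0 < d &
    forall w, `|w - z| < d -> `|h w - h z - l * (w - z)| <= e * `|w - z|.
Proof.
have quot (D A u e : K) : u != 0 ->
    (`|D - u^-1 * A| <= e) = (`|A - D * u| <= e * `|u|).
  move=> u0; rewrite -[in RHS]ler_pdivrMr ?normr_gt0 // -normfV -normrM.
  by rewrite mulrBl mulfK // distrC [A * _]mulrC.
split.
- move=> [dh <-] e e0.
  have /cvgrPdist_le /(_ _ e0) := dh.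
  move=> [d /= d0 H]; exists d => // w wz.
  have [->|wz0] := eqVneq w z; first by rewrite !subrr mulr0 subr0 normr0 mulr0.
  have wz0' : w - z != 0 by rewrite subr_eq0.
  have := H (w - z); rewrite /ball /= sub0r normrN => /(_ wz wz0').
  by rewrite /GRing.scale /= mulr1 subrK quot.
- move=> H.
  have cv : (fun t : K^o => t^-1 *: ((h \o shift (z : K^o)) (t *: (1 : K^o)) - h z))
       @ 0^' --> (l : K^o).
    apply/cvgrPdist_le => e e0; have [d d0 Hd] := H e e0.
    exists d => //= t; rewrite /ball /= sub0r normrN => td t0.
    have := Hd (t + z); rewrite addrK => /(_ td).
    by rewrite /GRing.scale /= mulr1 quot.
  split; first exact: cvgP cv.
  exact: cvg_lim cv.
Qed.

Variable R : realType.
Local Notation C := (R[i]^o).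
Implicit Types (z w l : C) (e d : R).

Lemma ofR_gt0 e : (0 < ofR e) = (0 < e).
Proof. by rewrite /ofR ltcR. Qed.

(** In the field of complex numbers a positive number is a positive real, so
the tolerances may be taken real. *)
Lemma cderiveP (h : C -> C) z l :
  is_derive z (1 : C) h l <->
  forall e, 0 < e -> exists2 d, 0 < d & forall w, modulus (w - z) < d ->
     modulus (h w - h z - l * (w - z)) <= e * modulus (w - z).
Proof.
split.
- move=> /is_derive_eps H e e0.
  have [|d d0 Hd] := H (ofR e); first by rewrite ofR_gt0.
  have dE : d = ofR (complex.Re d).
    by move: d0; rewrite ltcE /= => /andP[/eqP E _]; apply: complexP.
  exists (complex.Re d); first by rewrite -ofR_gt0 -dE.
  move=> w wz; have := Hd w; rewrite dE !cnormE /ofR ltcR => /(_ wz).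
  by rewrite -rmorphM /= lecR.
- move=> H; apply/is_derive_eps => e e0.
  have eE : e = ofR (complex.Re e).
    by move: e0; rewrite ltcE /= => /andP[/eqP E _]; apply: complexP.
  have [|d d0 Hd] := H (complex.Re e); first by rewrite -ofR_gt0 -eE.
  exists (ofR d); first by rewrite ofR_gt0.
  move=> w; rewrite !cnormE /ofR ltcR => /Hd.
  by rewrite eE /ofR -rmorphM /= lecR.
Qed.

Lemma derivable1_is_derive (K : numFieldType) (h : K^o -> K^o) (z : K^o) : derivable h z 1 ->
  is_derive z (1 : K^o) h (derive1 h z).
Proof. by move=> dh; split=> //; rewrite derive1E. Qed.

Lemma is_derive_derive1 (K : numFieldType) (h : K^o -> K^o) (z l : K^o) :
  is_derive z (1 : K^o) h l -> derive1 h z = l.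
Proof. by move=> [_ <-]; rewrite derive1E. Qed.

Definition ccont (h : C -> C) z := forall e, 0 < e -> exists2 d, 0 < d &
  forall w, modulus (w - z) < d -> modulus (h w - h z) < e.

Lemma is_derive_ccont (h : C -> C) z l : is_derive z (1 : C) h l -> ccont h z.
Proof.
move=> /cderiveP /(_ 1 ltr01) [d d0 H] e e0.
set M := modulus l + 1; have M0 : 0 < M.
  by rewrite ltr_wpDl ?modulus_ge0.
exists (Num.min d (e / M)); first by rewrite lt_min d0 divr_gt0.
move=> w; rewrite lt_min => /andP[wd we].
have -> : h w - h z = (h w - h z - l * (w - z)) + l * (w - z) by rewrite subrK.
apply: le_lt_trans (modulusD _ _) _; rewrite modulusM.
apply: (@le_lt_trans _ _ (M * modulus (w - z))).
  by rewrite mulrDl mul1r addrC lerD2l -[leRHS]mul1r H.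
by rewrite mulrC -ltr_pdivlMr.
Qed.

(** A plane curve is differentiated by components, so that the rules for real
functions apply to it. *)
Definition is_velocity (U : R -> C) (x : R) l :=
  is_derive (x : R^o) (1 : R^o) (fun t => complex.Re (U t) : R^o) (complex.Re l) /\
  is_derive (x : R^o) (1 : R^o) (fun t => complex.Im (U t) : R^o) (complex.Im l).

Lemma is_velocityP (U : R -> C) (x : R) l : is_velocity U x l <->
  forall e, 0 < e -> exists2 d, 0 < d & forall y, `|y - x| < d ->
     modulus (U y - U x - l * ofR (y - x)) <= e * `|y - x|.
Proof.
have reE y : complex.Re (U y - U x - l * ofR (y - x)) =
    complex.Re (U y) - complex.Re (U x) - complex.Re l * (y - x).
  by rewrite !(cReD, cReN, cReM) /= mulr0 subr0.
have imE y : complex.Im (U y - U x - l * ofR (y - x)) =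
    complex.Im (U y) - complex.Im (U x) - complex.Im l * (y - x).
  by rewrite !(cImD, cImN, cImM) /= mulr0 add0r.
split.
- move=> [/is_derive_eps H1 /is_derive_eps H2] e e0.
  have e2 : 0 < e / 2 by rewrite divr_gt0.
  have [d1 d10 K1] := H1 _ e2; have [d2 d20 K2] := H2 _ e2.
  exists (Num.min d1 d2); first by rewrite lt_min d10.
  move=> y; rewrite lt_min => /andP[y1 y2].
  apply: le_trans (modulus_le_ReIm _) _; rewrite reE imE.
  by rewrite [e]splitr mulrDl lerD ?K1 ?K2.
- move=> H; split; apply/is_derive_eps => e e0; have [d d0 Hd] := H e e0;
  exists d => // y yx; apply: le_trans (Hd y yx).
  + by rewrite -reE Re_le_modulus.
  + by rewrite -imE Im_le_modulus.
Qed.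

Lemma is_velocity_comp (h : C -> C) (U : R -> C) (x : R) l m :
  is_velocity U x l -> is_derive (U x) (1 : C) h m ->
  is_velocity (h \o U) x (m * l).
Proof.
move=> /is_velocityP HU /cderiveP Hh; apply/is_velocityP => e e0.
set M := modulus l + 1; have M0 : 0 < M by rewrite ltr_wpDl ?modulus_ge0.
set N := modulus m + 1; have N0 : 0 < N by rewrite ltr_wpDl ?modulus_ge0.
have eM : 0 < e / 2 / M by rewrite !divr_gt0.
have eN : 0 < e / 2 / N by rewrite !divr_gt0.
have [d1 d10 H1] := Hh _ eM; have [d2 d20 H2] := HU _ eN.
have [d3 d30 H3] := HU _ ltr01.
exists (Num.min d2 (Num.min d3 (d1 / M))); first by rewrite !lt_min d20 d30 divr_gt0.
move=> y; rewrite !lt_min => /and3P[y2 y3 y1].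
have UL : modulus (U y - U x) <= M * `|y - x|.
  rewrite -(subrK (l * ofR (y - x)) (U y - U x)).
  apply: le_trans (modulusD _ _) _; rewrite modulusM modulus_ofR mulrDl addrC.
  by rewrite lerD2l H3.
have -> : (h \o U) y - (h \o U) x - m * l * ofR (y - x) =
   (h (U y) - h (U x) - m * (U y - U x)) + m * (U y - U x - l * ofR (y - x)).
  by rewrite /=; ring.
apply: le_trans (modulusD _ _) _; rewrite modulusM [e]splitr mulrDl lerD //.
- apply: le_trans (H1 _ _) _.
    by apply: le_lt_trans UL _; rewrite mulrC -ltr_pdivlMr.
  apply: le_trans (ler_wpM2l (ltW eM) UL) _.
  by rewrite mulrA divfK // gt_eqF.
- apply: le_trans (ler_wpM2l (modulus_ge0 _) (H2 _ y2)) _.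
  rewrite mulrA ler_wpM2r //.
  rewrite mulrCA -[leRHS]mulr1 ler_wpM2l ?divr_ge0 ?ltW //.
  by rewrite ltr_pdivrMr // mul1r /N ltrDl.
Qed.

Lemma is_derive_comp (f g : C -> C) z l m :
  is_derive z (1 : C) f l -> is_derive (f z) (1 : C) g m ->
  is_derive z (1 : C) (g \o f) (m * l).
Proof.
move=> /cderiveP HU /cderiveP Hh; apply/cderiveP => e e0.
set M := modulus l + 1; have M0 : 0 < M by rewrite ltr_wpDl ?modulus_ge0.
set N := modulus m + 1; have N0 : 0 < N by rewrite ltr_wpDl ?modulus_ge0.
have eM : 0 < e / 2 / M by rewrite !divr_gt0.
have eN : 0 < e / 2 / N by rewrite !divr_gt0.
have [d1 d10 H1] := Hh _ eM; have [d2 d20 H2] := HU _ eN.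
have [d3 d30 H3] := HU _ ltr01.
exists (Num.min d2 (Num.min d3 (d1 / M))); first by rewrite !lt_min d20 d30 divr_gt0.
move=> y; rewrite !lt_min => /and3P[y2 y3 y1].
have UL : modulus (f y - f z) <= M * modulus (y - z).
  rewrite -(subrK (l * (y - z)) (f y - f z)).
  apply: le_trans (modulusD _ _) _; rewrite modulusM mulrDl addrC.
  by rewrite lerD2l H3.
have -> : (g \o f) y - (g \o f) z - m * l * (y - z) =
   (g (f y) - g (f z) - m * (f y - f z)) + m * (f y - f z - l * (y - z)).
  by rewrite /=; ring.
apply: le_trans (modulusD _ _) _; rewrite modulusM [e]splitr mulrDl lerD //.
- apply: le_trans (H1 _ _) _.
    by apply: le_lt_trans UL _; rewrite mulrC -ltr_pdivlMr.
  apply: le_trans (ler_wpM2l (ltW eM) UL) _.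
  by rewrite mulrA divfK // gt_eqF.
- apply: le_trans (ler_wpM2l (modulus_ge0 _) (H2 _ y2)) _.
  rewrite mulrA ler_wpM2r ?modulus_ge0 //.
  rewrite mulrCA -[leRHS]mulr1 ler_wpM2l ?divr_ge0 ?ltW //.
  by rewrite ltr_pdivrMr // mul1r /N ltrDl.
Qed.

Lemma is_velocityD (U V : R -> C) x l m : is_velocity U x l -> is_velocity V x m ->
  is_velocity (fun t => U t + V t) x (l + m).
Proof.
move=> [U1 U2] [V1 V2]; split.
- rewrite (_ : (fun t => _) = (fun t => complex.Re (U t) : R^o) + (fun t => complex.Re (V t) : R^o)).
    by rewrite cReD; exact: is_deriveD.
  by apply/funext => t; rewrite /= cReD.
- rewrite (_ : (fun t => _) = (fun t => complex.Im (U t) : R^o) + (fun t => complex.Im (V t) : R^o)).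
    by rewrite cImD; exact: is_deriveD.
  by apply/funext => t; rewrite /= cImD.
Qed.

Lemma is_velocity_cst w x : is_velocity (fun=> w) x 0.
Proof. by split; exact: is_derive_cst. Qed.

Lemma is_derive_ofR x : is_velocity (@ofR R) x 1.
Proof. by split; [exact: is_derive_id|exact: is_derive_cst]. Qed.

Lemma is_deriveZc w z : is_derive z (1 : C) ( *%R w) w.
Proof.
apply/cderiveP => e e0; exists 1 => // y _.
by rewrite mulrBr subrr modulus0 mulr_ge0 ?modulus_ge0 // ltW.
Qed.

Lemma is_velocityZ (U : R -> C) w x l : is_velocity U x l ->
  is_velocity (fun t => w * U t) x (w * l).
Proof. by move=> H; apply: (is_velocity_comp H (is_deriveZc w (U x))). Qed.

Lemma is_velocity_line z w x : is_velocity (fun t => z + w * ofR t) x w.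
Proof.
have := is_velocityD (is_velocity_cst z x) (is_velocityZ w (is_derive_ofR x)).
by rewrite add0r mulr1.
Qed.

Lemma is_velocityJ (U : R -> C) x l : is_velocity U x l ->
  is_velocity (fun t => (U t)^*%C : C) x (l^*%C).
Proof.
move=> [H1 H2]; split.
- rewrite (_ : (fun t => _) = (fun t => complex.Re (U t) : R^o)).
    by rewrite (_ : complex.Re l^*%C = complex.Re l) //; case: (l).
  by apply/funext => t /=; case: (U t).
- rewrite (_ : (fun t => _) = - (fun t => complex.Im (U t) : R^o)).
    by rewrite (_ : complex.Im l^*%C = - complex.Im l); [exact: is_deriveN|case: (l)].
  apply/funext => t; have -> : complex.Im ((U t)^*%C) = - complex.Im (U t) by case: (U t).
  by [].
Qed.

(** Rotating the increment of the curve onto the positive real axis turns the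
estimate into the monotonicity of a real function. *)
Lemma mean_value_ineq (U V : R -> C) (phi phi' : R -> R) (a b : R) : a <= b ->
  (forall x, a <= x <= b -> is_velocity U x (V x)) ->
  (forall x, a <= x <= b -> is_derive (x : R^o) (1 : R^o) (phi : R^o -> R^o) (phi' x)) ->
  (forall x, a <= x <= b -> modulus (V x) <= phi' x) ->
  modulus (U b - U a) <= phi b - phi a.
Proof.
move=> ab HU Hphi HV.
have [c c1 cE] := modulus_rot (U b - U a).
pose u : R^o -> R^o := fun t => complex.Re (c * U t).
have du x : a <= x <= b -> is_derive (x : R^o) (1 : R^o) (u - phi) (complex.Re (c * V x) - phi' x).
  move=> xab; apply: is_deriveB; last exact: Hphi.
  by have [] := is_velocityZ c (HU x xab).
have neg x : a <= x <= b -> complex.Re (c * V x) - phi' x <= 0.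
  move=> xab; rewrite subr_le0; apply: le_trans (HV x xab).
  apply: le_trans (ler_norm _) _; apply: le_trans (Re_le_modulus _) _.
  by rewrite modulusM c1 mul1r.
have [||x xab E] := @MVT_segment R (u - phi) (fun x => complex.Re (c * V x) - phi' x) a b ab.
- by move=> x; rewrite in_itv /= => /andP[/ltW x1 /ltW x2]; apply: du; rewrite x1.
- apply: derivable_within_continuous => x; rewrite in_itv /= => xab.
  by have [] := du x xab.
have : (u - phi) b - (u - phi) a <= 0.
  rewrite E mulr_le0_ge0 ?subr_ge0 //; apply: neg.
  by move: xab; rewrite in_itv.
have -> : (u - phi) b - (u - phi) a = (u b - phi b) - (u a - phi a) by [].
by rewrite -cE mulrBr cReD cReN -/(u b) -/(u a) => H; clear -H; lra.
Qed.

End Calculus.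

(** * Integrals of curves *)

Section CurveIntegral.
Variable R : realType.
Local Notation C := (R[i]^o).
Implicit Types (F U V : R -> C) (a b x y e d : R) (w : C).

Definition cont_on F a b := forall x, a <= x <= b -> forall e, 0 < e ->
  exists2 d, 0 < d &
    forall y, a <= y <= b -> `|y - x| < d -> modulus (F y - F x) < e.

Definition primitive F a b U := forall x, a <= x <= b -> is_velocity U x (F x).

Lemma real_primitive (g : R -> R) a b :
  continuous (g : R^o -> R^o) -> exists G : R -> R,
  forall x, a <= x <= b -> is_derive (x : R^o) (1 : R^o) (G : R^o -> R^o) (g x).
Proof.
move=> cg; exists (fun x => \int[@lebesgue_measure R]_(t in `[a - 1, x]) g t)%R => x /andP[ax xb].
have xb1 : x < b + 1 by apply: le_lt_trans xb _; rewrite ltrDl.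
have ig : (@lebesgue_measure R).-integrable `[a - 1, b + 1] (EFin \o g).
  apply: continuous_compact_integrable; first exact: segment_compact.
  exact: continuous_subspaceT.
have ax1 : a - 1 < x by apply: lt_le_trans ax; rewrite gtrBl.
have [D E] := @continuous_FTC1_closed R g (a - 1) x (b + 1) xb1 ig ax1 (cg x).
split; first exact: D.
by rewrite -E derive1E.
Qed.

(** Extending [F] by constants beyond the interval keeps it continuous.  The
second clause gives the continuity of the real and imaginary parts and of the
modulus. *)
Lemma cont_on_extend F a b : a <= b -> cont_on F a b ->
  exists2 G : R -> C, forall x, a <= x <= b -> G x = F x &
    forall p : C -> R, (forall z w, `|p z - p w| <= modulus (z - w)) ->
      continuous ((p \o G) : R^o -> R^o).
Proof.
move=> ab cF; pose cl x := Num.max a (Num.min b x).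
have clab x : a <= cl x <= b by rewrite /cl le_max lexx /= ge_max ab ge_min lexx.
have clE x : a <= x <= b -> cl x = x.
  by move=> /andP[ax xb]; rewrite /cl min_r // max_r.
have cl_lip x y : `|cl x - cl y| <= `|x - y|.
  have clF t : cl t = if t < a then a else if b < t then b else t.
    rewrite /cl; case: (ltP t a) => ta.
      by rewrite min_r ?max_l ?(ltW ta) // (le_trans (ltW ta)).
    by case: (ltP b t) => tb; rewrite max_r.
  have n1 := ler_norm (x - y); have n2 := ler_norm (y - x).
  rewrite distrC in n2; rewrite ler_norml !clF.
  by do 4 (case: ltP => ?); apply/andP; split; lra.
exists (F \o cl) => [x xab|p pl x]; first by rewrite /= clE.
apply/cvgrPdist_le => e e0; have [d d0 H] := cF _ (clab x) e e0.
exists d => // y /=; rewrite /ball /= => xy.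
apply: le_trans (pl _ _) _; apply/ltW; rewrite modulus_distC H //.
by apply: le_lt_trans (cl_lip _ _) _; rewrite distrC.
Qed.

(** The extension makes a primitive differentiable on both sides at the
endpoints. *)
Lemma primitive_exists F a b : a <= b -> cont_on F a b -> exists U, primitive F a b U.
Proof.
move=> ab cF; have [G GE cont] := cont_on_extend ab cF.
have [|G1 H1] := @real_primitive (fun x => complex.Re (G x)) a b.
  by apply: (cont (@complex.Re R)) => z w; rewrite -cReN -cReD; exact: Re_le_modulus.
have [|G2 H2] := @real_primitive (fun x => complex.Im (G x)) a b.
  by apply: (cont (@complex.Im R)) => z w; rewrite -cImN -cImD; exact: Im_le_modulus.
exists (fun x => Complex (G1 x) (G2 x)) => x xab.
by split=> /=; [have := H1 x xab|have := H2 x xab]; rewrite GE.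
Qed.

Lemma cont_on_bounded F a b : a <= b -> cont_on F a b ->
  exists M, forall x, a <= x <= b -> modulus (F x) <= M.
Proof.
move=> ab cF; have [G GE cont] := cont_on_extend ab cF.
have cG : continuous ((@modulus R \o G) : R^o -> R^o).
  apply: cont => z w; rewrite ler_norml modulus_lB andbT lerNl opprB modulus_distC.
  exact: modulus_lB.
have [c _ Hc] := EVT_max ab (continuous_subspaceT cG).
exists (modulus (G c)) => x xab; rewrite -GE //.
by apply: Hc; rewrite in_itv.
Qed.

(** With the integral taken as the increment of a chosen primitive, linearity
and additivity are algebra, and the length estimate is the mean value
inequality. *)
Definition cint F a b : C :=
  let U := xget (fun=> 0) [set U | primitive F a b U] in U b - U a.

Definition has_prim F a b := exists U, primitive F a b U.

Lemma primitiveD F G a b U V : primitive F a b U -> primitive G a b V ->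
  primitive (fun x => F x + G x) a b (fun x => U x + V x).
Proof. by move=> HU HV x xab; apply: is_velocityD; [exact: HU|exact: HV]. Qed.

Lemma primitiveZ F a b U w : primitive F a b U ->
  primitive (fun x => w * F x) a b (fun x => w * U x).
Proof. by move=> HU x xab; apply: is_velocityZ; exact: HU. Qed.

Lemma primitiveW F a b a' b' U : a <= a' -> b' <= b ->
  primitive F a b U -> primitive F a' b' U.
Proof.
move=> aa bb HU x /andP[ax xb]; apply: HU.
by rewrite (le_trans aa ax) (le_trans xb bb).
Qed.

Lemma primitive_incr_le F a b U M : a <= b -> primitive F a b U ->
  (forall x, a <= x <= b -> modulus (F x) <= M) ->
  modulus (U b - U a) <= M * (b - a).
Proof.
move=> ab HU HM; rewrite mulrBr.
apply: (@mean_value_ineq R U F (fun x => M * x) (fun=> M)) => // x xab.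
have := @is_deriveZ _ _ _ id M (x : R^o) 1 1 (is_derive_id _ _).
by rewrite /GRing.scale /= mulr1.
Qed.

Lemma cintE F a b U : a <= b -> primitive F a b U -> cint F a b = U b - U a.
Proof.
move=> ab HU; rewrite /cint; set V := xget _ _.
have HV : primitive F a b V by apply: (@xgetPex _ _ [set V | primitive F a b V]); exists U.
have H0 : primitive (fun x => F x + -1 * F x) a b (fun x => V x + -1 * U x).
  by apply: primitiveD => //; apply: primitiveZ.
have := @primitive_incr_le _ _ _ _ 0 ab H0; rewrite mul0r.
have Z : forall x, a <= x <= b -> modulus (F x + -1 * F x) <= 0.
  by move=> x _; rewrite mulN1r subrr modulus0.
move=> /(_ Z) le0.
have /eqP : modulus (V b + -1 * U b - (V a + -1 * U a)) == 0.
  by rewrite eq_le le0 modulus_ge0.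
move=> /Normc.eq0_normc E; apply/eqP; rewrite -subr_eq0; apply/eqP; rewrite -[RHS]E.
ring.
Qed.

Lemma has_primP F a b : a <= b -> has_prim F a b ->
  exists2 U, primitive F a b U & cint F a b = U b - U a.
Proof. by move=> ab [U HU]; exists U => //; exact: cintE. Qed.

Lemma cintD F G a b : a <= b -> has_prim F a b -> has_prim G a b ->
  cint (fun x => F x + G x) a b = cint F a b + cint G a b.
Proof.
move=> ab /(has_primP ab)[U HU ->] /(has_primP ab)[V HV ->].
by rewrite (cintE ab (primitiveD HU HV)); ring.
Qed.

Lemma cintZ F a b w : a <= b -> has_prim F a b ->
  cint (fun x => w * F x) a b = w * cint F a b.
Proof.
move=> ab /(has_primP ab)[U HU ->].
by rewrite (cintE ab (primitiveZ w HU)); ring.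
Qed.

Lemma has_primD F G a b : has_prim F a b -> has_prim G a b ->
  has_prim (fun x => F x + G x) a b.
Proof. by move=> [U HU] [V HV]; exists (fun x => U x + V x); exact: primitiveD. Qed.

Lemma has_primZ F a b w : has_prim F a b -> has_prim (fun x => w * F x) a b.
Proof. by move=> [U HU]; exists (fun x => w * U x); exact: primitiveZ. Qed.

Lemma cint_split F a m b : a <= m -> m <= b -> has_prim F a b ->
  cint F a b = cint F a m + cint F m b.
Proof.
move=> am mb /(has_primP (le_trans am mb))[U HU ->].
by rewrite (cintE am (primitiveW (lexx _) mb HU)) (cintE mb (primitiveW am (lexx _) HU)); ring.
Qed.

Lemma cint_le F a b M : a <= b -> has_prim F a b ->
  (forall x, a <= x <= b -> modulus (F x) <= M) ->
  modulus (cint F a b) <= M * (b - a).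
Proof.
by move=> ab /(has_primP ab)[U HU ->] HM; exact: primitive_incr_le HU HM.
Qed.

Lemma eq_cint F G a b : a <= b -> (forall x, a <= x <= b -> F x = G x) ->
  has_prim F a b -> cint F a b = cint G a b.
Proof.
move=> ab E /(has_primP ab)[U HU ->].
by rewrite (@cintE G _ _ U) // => x xab; rewrite -E //; exact: HU.
Qed.

Lemma cint_Im_ge F a b m : a <= b -> has_prim F a b ->
  (forall x, a <= x <= b -> m <= complex.Im (F x)) ->
  m * (b - a) <= complex.Im (cint F a b).
Proof.
move=> ab /(has_primP ab)[U HU ->] Hm.
have dU x : a <= x <= b -> is_derive (x : R^o) (1 : R^o)
    ((fun t => complex.Im (U t)) : R^o -> R^o) (complex.Im (F x)).
  by move=> xab; have [] := HU x xab.
have [||x xab E] := @MVT_segment R (fun t => complex.Im (U t)) (fun x => complex.Im (F x)) a b ab.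
- by move=> x; rewrite in_itv /= => /andP[/ltW x1 /ltW x2]; apply: dU; rewrite x1.
- apply: derivable_within_continuous => x; rewrite in_itv /= => xab.
  by have [] := dU x xab.
rewrite cImD cImN E ler_wpM2r ?subr_ge0 // Hm //.
Qed.

End CurveIntegral.

(** * Bisection and Goursat's lemma *)

Section Bisection.
Variable R : realType.
Implicit Types x y s t : R.

Lemma exp2_lt_eps (A d : R) : 0 < d -> exists k : nat, A / 2 ^+ k < d.
Proof.
move=> d0; exists (Num.bound (`|A| / d)).
have H := archi_boundP (divr_ge0 (normr_ge0 A) (ltW d0)).
rewrite ltr_pdivrMr ?exprn_gt0 // mulrC -ltr_pdivrMr //.
apply: (@le_lt_trans _ _ (`|A| / d)); first by rewrite ler_pM2r ?invr_gt0 // ler_norm.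
apply: lt_trans H _; rewrite -natrX ltr_nat; exact: ltn_expl.
Qed.

(** Repeated quartering of a rectangle on which [P] fails would produce nested
failing rectangles shrinking to a point, where [P] holds locally.  The aspect
ratio is preserved, so that only dyadic copies of the rectangle occur. *)
Lemma rectangle_bisection (P : R -> R -> R -> R -> Prop) x0 y0 a b :
  0 <= a -> 0 <= b ->
  let inside x y s t := [/\ x0 <= x, x + s <= x0 + a, y0 <= y & y + t <= y0 + b] in
  (forall x y s t, 0 <= s -> 0 <= t -> inside x y s t ->
     P x y (s / 2) (t / 2) -> P (x + s / 2) y (s / 2) (t / 2) ->
     P x (y + t / 2) (s / 2) (t / 2) -> P (x + s / 2) (y + t / 2) (s / 2) (t / 2) ->
     P x y s t) ->
  (forall u v, x0 <= u <= x0 + a -> y0 <= v <= y0 + b ->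
     exists2 d, 0 < d & forall x y s t, 0 <= s -> 0 <= t -> inside x y s t ->
       x <= u <= x + s -> y <= v <= y + t -> s + t < d -> P x y s t) ->
  P x0 y0 a b.
Proof.
move=> a0 b0 inside Hq Hl; apply: contrapT => bad0.
pose s k : R := a / 2 ^+ k; pose t k : R := b / 2 ^+ k.
have sS k : s k / 2 = s k.+1 by rewrite /s exprS invfM; ring.
have tS k : t k / 2 = t k.+1 by rewrite /t exprS invfM; ring.
have s0 k : 0 <= s k by rewrite /s divr_ge0 // exprn_ge0.
have t0 k : 0 <= t k by rewrite /t divr_ge0 // exprn_ge0.
pose bad k (q : R * R) := inside q.1 q.2 (s k) (t k) /\ ~ P q.1 q.2 (s k) (t k).
have step (kq : nat * (R * R)) : exists q : R * R, bad kq.1 kq.2 ->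
   [/\ bad kq.1.+1 q, kq.2.1 <= q.1 <= kq.2.1 + s kq.1.+1 &
       kq.2.2 <= q.2 <= kq.2.2 + t kq.1.+1].
  case: kq => k [x y] /=.
  have [[ins nP]|nb] := pselect (bad k (x, y)); last by exists (x, y).
  move: (ins) nP => /= [i1 i2 i3 i4] nP.
  have h1 := s0 k.+1; have h2 := t0 k.+1; have e1 := sS k; have e2 := tS k.
  have [[q [B X Y]]|no] := pselect (exists q : R * R, [/\ bad k.+1 q,
       x <= q.1 <= x + s k.+1 & y <= q.2 <= y + t k.+1]).
    by exists q.
  exfalso; apply: nP; apply: Hq => //; rewrite sS tS; apply: contrapT => nP; apply: no.
  - exists (x, y); split; rewrite /bad /inside /=; do ?split => //; try lra.
  - exists (x + s k.+1, y); split; rewrite /bad /inside /=; do ?split => //; try lra.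
  - exists (x, y + t k.+1); split; rewrite /bad /inside /=; do ?split => //; try lra.
  - exists (x + s k.+1, y + t k.+1); split; rewrite /bad /inside /=; do ?split => //; try lra.
have [f Hf] := choice step.
pose fix c k : R * R := if k is k'.+1 then f (k', c k') else (x0, y0).
have badc k : bad k (c k).
  elim: k => [|k IH]; last by have [] := Hf (k, c k) IH.
  by rewrite /bad /inside /s /t /= expr0 !divr1; do ?split.
have cS k : (c k).1 <= (c k.+1).1 <= (c k).1 + s k.+1 /\
     (c k).2 <= (c k.+1).2 <= (c k).2 + t k.+1.
  by have [] := Hf (k, c k) (badc k).
have s2 k : s k = s k.+1 + s k.+1 by rewrite -sS -splitr.
have t2 k : t k = t k.+1 + t k.+1 by rewrite -tS -splitr.
(* the corners increase, the opposite corners decrease: they have a common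
   point, the supremum of the corners *)
have nest (X S : nat -> R) : (forall k, 0 <= S k) -> (forall k, S k = S k.+1 + S k.+1) ->
    (forall k, X k <= X k.+1 <= X k + S k.+1) ->
    exists u, forall k, X k <= u <= X k + S k.
  move=> S0 S2 XS.
  have up n m : X n <= X (n + m)%N.
    elim: m => [|m IH]; first by rewrite addn0.
    by rewrite addnS; apply: le_trans IH _; have /andP[] := XS (n + m)%N.
  have dn n m : X (n + m)%N + S (n + m)%N <= X n + S n.
    elim: m => [|m IH]; first by rewrite addn0.
    rewrite addnS; apply: le_trans IH; have := XS (n + m)%N; have := S2 (n + m)%N.
    by move: (X _) (X _) (S _) (S _) => p q r w; lra.
  have le n m : X m <= X n + S n.
    apply: le_trans (up m n) _; rewrite addnC; apply: le_trans (dn n m).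
    by rewrite lerDl.
  exists (sup (range X)) => k; apply/andP; split.
    apply: ub_le_sup; last by exists k.
    by exists (X 0 + S 0) => _ [m _ <-]; exact: le.
  by apply: ge_sup => [|_ [m _ <-]]; [exists (X 0), 0%N|exact: le].
have [u Hu] := nest (fun k => (c k).1) s s0 s2 (fun k => proj1 (cS k)).
have [v Hv] := nest (fun k => (c k).2) t t0 t2 (fun k => proj2 (cS k)).
have [||d d0 Hd] := Hl u v.
- by have := Hu 0%N; rewrite /s expr0 divr1.
- by have := Hv 0%N; rewrite /t expr0 divr1.
have [k Hk] := exp2_lt_eps (a + b) d0.
have [ins nP] := badc k; apply: nP; apply: Hd => //.
by rewrite /s /t -mulrDl.
Qed.

End Bisection.

Section RectangleIntegral.
Variable R : realType.
Local Notation C := (R[i]^o).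
Implicit Types (F G H : C -> C) (x y s t u v : R) (z w l : C).
Local Notation pt x y := (Complex x y : C).

(** Integral of [F] along the positively oriented boundary of a rectangle. *)
Definition rint F x1 x2 y1 y2 : C :=
  cint (fun u => F (pt u y1)) x1 x2 - cint (fun u => F (pt u y2)) x1 x2 +
  'i%C * (cint (fun v => F (pt x2 v)) y1 y2 - cint (fun v => F (pt x1 v)) y1 y2).

Definition ccont_rect F x1 x2 y1 y2 := forall u v, x1 <= u <= x2 -> y1 <= v <= y2 ->
  ccont F (pt u v).

Lemma has_prim_h F x1 x2 y1 y2 y : x1 <= x2 -> y1 <= y <= y2 -> ccont_rect F x1 x2 y1 y2 ->
  has_prim (fun u => F (pt u y)) x1 x2.
Proof.
move=> x12 yy cF; apply: primitive_exists => // u ux e e0.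
have [d d0 Hd] := cF _ _ ux yy e e0; exists d => // w _ wu.
apply: Hd; rewrite (_ : _ - _ = ofR (w - u)) ?modulus_ofR //.
by apply: complexP; rewrite ?cReD ?cImD ?cReN ?cImN /= ?subrr.
Qed.

Lemma has_prim_v F x1 x2 y1 y2 x : y1 <= y2 -> x1 <= x <= x2 -> ccont_rect F x1 x2 y1 y2 ->
  has_prim (fun v => F (pt x v)) y1 y2.
Proof.
move=> y12 xx cF; apply: primitive_exists => // v vy e e0.
have [d d0 Hd] := cF _ _ xx vy e e0; exists d => // w _ wu.
apply: Hd; rewrite (_ : _ - _ = 'i%C * ofR (w - v)) ?modulusM ?modulus_i ?modulus_ofR ?mul1r //.
by apply: complexP; rewrite ?cReD ?cImD ?cReN ?cImN ?cReM ?cImM /=; ring.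
Qed.

Lemma ccont_rectW F x1 x2 y1 y2 x1' x2' y1' y2' :
  x1 <= x1' -> x2' <= x2 -> y1 <= y1' -> y2' <= y2 ->
  ccont_rect F x1 x2 y1 y2 -> ccont_rect F x1' x2' y1' y2'.
Proof. by move=> a b c d cF u v /andP[? ?] /andP[? ?]; apply: cF; lra. Qed.

Lemma rint_splitx F x1 m x2 y1 y2 : x1 <= m <= x2 -> y1 <= y2 ->
  ccont_rect F x1 x2 y1 y2 ->
  rint F x1 x2 y1 y2 = rint F x1 m y1 y2 + rint F m x2 y1 y2.
Proof.
move=> /andP[am mb] yy cF; rewrite /rint.
have x12 := le_trans am mb.
rewrite (cint_split am mb (has_prim_h x12 _ cF)) ?lexx ?yy //.
rewrite (cint_split am mb (has_prim_h x12 _ cF)) ?lexx ?yy //.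
ring.
Qed.

Lemma rint_splity F x1 x2 y1 m y2 : y1 <= m <= y2 -> x1 <= x2 ->
  ccont_rect F x1 x2 y1 y2 ->
  rint F x1 x2 y1 y2 = rint F x1 x2 y1 m + rint F x1 x2 m y2.
Proof.
move=> /andP[am mb] xx cF; rewrite /rint.
have y12 := le_trans am mb.
rewrite (cint_split am mb (has_prim_v y12 _ cF)) ?lexx ?xx //.
rewrite (cint_split am mb (has_prim_v y12 _ cF)) ?lexx ?xx //.
ring.
Qed.

Definition rect_prims F x1 x2 y1 y2 :=
  [/\ has_prim (fun u => F (pt u y1)) x1 x2, has_prim (fun u => F (pt u y2)) x1 x2,
      has_prim (fun v => F (pt x2 v)) y1 y2 & has_prim (fun v => F (pt x1 v)) y1 y2].

Lemma ccont_rect_prims F x1 x2 y1 y2 : x1 <= x2 -> y1 <= y2 ->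
  ccont_rect F x1 x2 y1 y2 -> rect_prims F x1 x2 y1 y2.
Proof.
by move=> xx yy cF; split; [apply: has_prim_h cF|apply: has_prim_h cF|
  apply: has_prim_v cF|apply: has_prim_v cF]; rewrite ?lexx ?xx ?yy.
Qed.

Lemma rintD F G x1 x2 y1 y2 : x1 <= x2 -> y1 <= y2 ->
  rect_prims F x1 x2 y1 y2 -> rect_prims G x1 x2 y1 y2 ->
  rint (fun w => F w + G w) x1 x2 y1 y2 = rint F x1 x2 y1 y2 + rint G x1 x2 y1 y2.
Proof.
by move=> xx yy [F1 F2 F3 F4] [G1 G2 G3 G4]; rewrite /rint !cintD //; ring.
Qed.

Lemma rintZ F l x1 x2 y1 y2 : x1 <= x2 -> y1 <= y2 -> rect_prims F x1 x2 y1 y2 ->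
  rint (fun w => l * F w) x1 x2 y1 y2 = l * rint F x1 x2 y1 y2.
Proof. by move=> xx yy [F1 F2 F3 F4]; rewrite /rint !cintZ //; ring. Qed.

Lemma rect_primsD F G x1 x2 y1 y2 : rect_prims F x1 x2 y1 y2 ->
  rect_prims G x1 x2 y1 y2 -> rect_prims (fun w => F w + G w) x1 x2 y1 y2.
Proof. by move=> [F1 F2 F3 F4] [G1 G2 G3 G4]; split; exact: has_primD. Qed.

Lemma rect_primsZ F l x1 x2 y1 y2 : rect_prims F x1 x2 y1 y2 ->
  rect_prims (fun w => l * F w) x1 x2 y1 y2.
Proof. by move=> [F1 F2 F3 F4]; split; exact: has_primZ. Qed.

Definition on_boundary (P : C -> Prop) x1 x2 y1 y2 :=
  (forall u, x1 <= u <= x2 -> P (pt u y1) /\ P (pt u y2)) /\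
  (forall v, y1 <= v <= y2 -> P (pt x1 v) /\ P (pt x2 v)).

Lemma rint_le F M x1 x2 y1 y2 : x1 <= x2 -> y1 <= y2 -> rect_prims F x1 x2 y1 y2 ->
  on_boundary (fun w => modulus (F w) <= M) x1 x2 y1 y2 ->
  modulus (rint F x1 x2 y1 y2) <= 2 * M * (x2 - x1 + (y2 - y1)).
Proof.
move=> xx yy [F1 F2 F3 F4] [B1 B2].
have h1 : modulus (cint (fun u => F (pt u y1)) x1 x2) <= M * (x2 - x1).
  by apply: cint_le => // u /B1[].
have h2 : modulus (cint (fun u => F (pt u y2)) x1 x2) <= M * (x2 - x1).
  by apply: cint_le => // u /B1[].
have h3 : modulus (cint (fun v => F (pt x2 v)) y1 y2) <= M * (y2 - y1).
  by apply: cint_le => // u /B2[].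
have h4 : modulus (cint (fun v => F (pt x1 v)) y1 y2) <= M * (y2 - y1).
  by apply: cint_le => // u /B2[].
rewrite /rint; apply: le_trans (modulusD _ _) _; rewrite modulusM modulus_i mul1r.
have k1 := modulusB (cint (fun u => F (pt u y1)) x1 x2) (cint (fun u => F (pt u y2)) x1 x2).
have k2 := modulusB (cint (fun v => F (pt x2 v)) y1 y2) (cint (fun v => F (pt x1 v)) y1 y2).
by clear -h1 h2 h3 h4 k1 k2; lra.
Qed.

Lemma is_velocity_h u y : is_velocity (fun t => pt t y) u 1.
Proof. by split; [exact: is_derive_id|exact: is_derive_cst]. Qed.

Lemma is_velocity_v x v : is_velocity (fun t => pt x t) v 'i%C.
Proof. by split; [exact: is_derive_cst|exact: is_derive_id]. Qed.

Lemma rint_of_derivative F H x1 x2 y1 y2 : x1 <= x2 -> y1 <= y2 ->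
  (forall w, is_derive w (1 : C) H (F w)) ->
  rect_prims F x1 x2 y1 y2 /\ rint F x1 x2 y1 y2 = 0.
Proof.
move=> xx yy dH.
have ph y : primitive (fun u => F (pt u y)) x1 x2 (fun u => H (pt u y)).
  by move=> u _; rewrite -[F _]mulr1; apply: is_velocity_comp (is_velocity_h u y) _.
have pv x : primitive (fun v => F (pt x v)) y1 y2 (fun v => - 'i%C * H (pt x v)).
  move=> v _; have -> : F (pt x v) = - 'i%C * (F (pt x v) * 'i%C).
    by rewrite mulrCA mulNr -expr2 sqr_i opprK mulr1.
  by apply: is_velocityZ; apply: is_velocity_comp (is_velocity_v x v) _.
split; first by split; eexists; [exact: ph|exact: ph|exact: pv|exact: pv].
rewrite /rint !(cintE xx (ph _)) !(cintE yy (pv _)).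
rewrite -!mulrBr !mulrA mulrN -expr2 sqr_i opprK mul1r.
ring.
Qed.

Lemma affine_derivative (p q z w : C) :
  is_derive w (1 : C) (fun w => p * w + q / 2 * (w - z) ^+ 2 : C) (p + q * (w - z)).
Proof.
apply/cderiveP => e e0; exists (e / (modulus (q / 2) + 1)).
  by rewrite divr_gt0 // ltr_wpDl ?modulus_ge0.
move=> t tw; rewrite (_ : _ - _ = q / 2 * (t - w) * (t - w)); last first.
  by field.
rewrite modulusM ler_wpM2r ?modulus_ge0 // modulusM.
have q0 := modulus_ge0 (q / 2); have t0 := modulus_ge0 (t - w).
move: tw; rewrite ltr_pdivlMr ?ltr_wpDl //; move: (modulus (t - w)) t0 (modulus (q / 2)) q0.
by move=> T T0 Q Q0; nra.
Qed.

(** Near a point where [F] is differentiable its integral over a small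
rectangle is that of the remainder of the affine approximation, hence small
compared with the square of the side; bisection makes this global. *)
Theorem goursat F x1 x2 y1 y2 : x1 <= x2 -> y1 <= y2 ->
  (forall u v, x1 <= u <= x2 -> y1 <= v <= y2 ->
     exists l, is_derive (pt u v) (1 : C) F l) ->
  rint F x1 x2 y1 y2 = 0.
Proof.
move=> xx yy dF.
have cF : ccont_rect F x1 x2 y1 y2.
  by move=> u v ux vy; have [l /is_derive_ccont] := dF u v ux vy.
apply/eqP; rewrite -modulus_eq0 eq_le modulus_ge0 andbT.
apply/ler_addgt0Pr => e e0; rewrite add0r.
set S := x2 - x1 + (y2 - y1).
have S0 : 0 <= S by rewrite addr_ge0 // subr_ge0.
pose eps := e / (2 * (S ^+ 2 + 1)).
have SS0 : 0 < S ^+ 2 + 1 by rewrite ltr_wpDl ?sqr_ge0.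
have eps0 : 0 < eps by rewrite divr_gt0 // mulr_gt0.
suff : modulus (rint F x1 (x1 + (x2 - x1)) y1 (y1 + (y2 - y1))) <= 2 * eps * S ^+ 2.
  rewrite !(addrC _ (_ - _)) !subrK => /le_trans; apply.
  have -> : 2 * eps = e / (S ^+ 2 + 1).
    by rewrite /eps; field; rewrite gt_eqF.
  by rewrite mulrAC ler_pdivrMr // ler_wpM2l ?ltW // ltrDl.
apply: (@rectangle_bisection R (fun x y s t =>
   modulus (rint F x (x + s) y (y + t)) <= 2 * eps * (s + t) ^+ 2)).
- by rewrite subr_ge0.
- by rewrite subr_ge0.
- rewrite !(addrC _ (_ - _)) !subrK.
  move=> x y s t s0 t0 [i1 i2 i3 i4] H1 H2 H3 H4.
  have c : ccont_rect F x (x + s) y (y + t) by apply: ccont_rectW cF.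
  have e1 : x + s / 2 + s / 2 = x + s by lra.
  have e2 : y + t / 2 + t / 2 = y + t by lra.
  rewrite ?e1 ?e2 in H1 H2 H3 H4.
  rewrite (@rint_splitx _ _ (x + s / 2)) //; [|lra|lra].
  rewrite (@rint_splity _ x _ y (y + t / 2)) //; [|lra|lra|]; last first.
    by apply: ccont_rectW c; lra.
  rewrite (@rint_splity _ (x + s / 2) _ y (y + t / 2)) //; [|lra|lra|]; last first.
    by apply: ccont_rectW c; lra.
  apply: le_trans (modulusD _ _) _.
  apply: le_trans (lerD (modulusD _ _) (modulusD _ _)) _.
  apply: le_trans (lerD (lerD H1 H3) (lerD H2 H4)) _.
  by rewrite le_eqVlt; apply/orP; left; apply/eqP; field.
- rewrite !(addrC _ (_ - _)) !subrK.
  move=> u v ux vy; have [l /cderiveP dl] := dF u v ux vy.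
  have [d d0 Hd] := dl eps eps0; exists d => // x y s t s0 t0 [i1 i2 i3 i4] xu yv st.
  set z : C := pt u v in dl Hd *.
  have xs : x <= x + s by rewrite lerDl.
  have yt : y <= y + t by rewrite lerDl.
  have c : ccont_rect F x (x + s) y (y + t) by apply: ccont_rectW cF.
  have pF := ccont_rect_prims xs yt c.
  pose A w : C := F z + l * (w - z).
  have [pA A0] := rint_of_derivative xs yt (affine_derivative (F z) l z).
  have -> : rint F x (x + s) y (y + t) = rint (fun w => F w + -1 * A w) x (x + s) y (y + t).
    by rewrite rintD ?rintZ ?A0 ?mulr0 ?addr0 //; exact: rect_primsZ.
  have near p q : x <= p <= x + s -> y <= q <= y + t ->
      modulus (F (pt p q) + -1 * A (pt p q)) <= eps * (s + t).
    move=> px qy.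
    have wz : modulus (pt p q - z) <= s + t.
      apply: le_trans (modulus_le_ReIm _) _; rewrite cReD cImD cReN cImN /=.
      by apply: lerD; rewrite ler_norml; apply/andP; split; lra.
    have -> : F (pt p q) + -1 * A (pt p q) = F (pt p q) - F z - l * (pt p q - z).
      by rewrite /A; ring.
    apply: le_trans (Hd _ (le_lt_trans wz st)) _.
    by rewrite ler_wpM2l // ltW.
  apply: le_trans (rint_le (M := eps * (s + t)) xs yt _ _) _.
  + by apply: rect_primsD pF _; exact: rect_primsZ.
  + by split=> p pp; split; apply: near => //; lra.
  + by rewrite le_eqVlt; apply/orP; left; apply/eqP; ring.
Qed.

End RectangleIntegral.

(** * Cauchy's formula *)

Section CauchyFormula.
Variable R : realType.
Local Notation C := (R[i]^o).
Implicit Types (F G h k : C -> C) (x y s t u v d e : R) (z w l : C).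
Local Notation pt x y := (Complex x y : C).

Lemma eq_near_is_derive F G z l d : 0 < d -> (forall w, modulus (w - z) < d -> F w = G w) ->
  is_derive z (1 : C) F l -> is_derive z (1 : C) G l.
Proof.
move=> d0 E /cderiveP H; apply/cderiveP => e e0.
have [d' d'0 H'] := H e e0; exists (Num.min d d'); first by rewrite lt_min d0.
by move=> w; rewrite lt_min => /andP[w1 w2]; rewrite -!E ?subrr ?modulus0 // H'.
Qed.

Lemma eq_near_derivable F G z d : 0 < d -> (forall w, modulus (w - z) < d -> F w = G w) ->
  derivable F z 1 -> derivable G z 1.
Proof.
by move=> d0 E /derivable1_is_derive /(eq_near_is_derive d0 E) H; exact: ex_derive.
Qed.

Lemma derivable_ccont F z : derivable F z 1 -> ccont F z.
Proof. by move=> /derivable1_is_derive /is_derive_ccont. Qed.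

Lemma is_derive_subr z w : is_derive w (1 : C) (fun w => w - z) 1.
Proof.
apply/cderiveP => e e0; exists 1 => // t _.
rewrite (_ : _ - _ = 0); last by ring.
by rewrite modulus0 mulr_ge0 ?modulus_ge0 // ltW.
Qed.

Lemma derivable_subr z w : derivable (fun w : C => w - z : C) w 1.
Proof. by have := is_derive_subr z w => H; exact: ex_derive. Qed.

Lemma bcont_rect_prims F x1 x2 y1 y2 : x1 <= x2 -> y1 <= y2 ->
  on_boundary (ccont F) x1 x2 y1 y2 -> rect_prims F x1 x2 y1 y2.
Proof.
move=> xx yy [B1 B2].
have eqP' (p q : R) : p <= q <= p -> q = p by move=> /andP[? ?]; apply/le_anti/andP.
split.
- apply: (@has_prim_h _ _ _ _ y1 y1) => //; rewrite ?lexx // => p q pp /eqP' ->.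
  by have [] := B1 p pp.
- apply: (@has_prim_h _ _ _ _ y2 y2) => //; rewrite ?lexx // => p q pp /eqP' ->.
  by have [] := B1 p pp.
- apply: (@has_prim_v _ _ x2 x2) => //; rewrite ?lexx // => p q /eqP' -> qq.
  by have [] := B2 q qq.
- apply: (@has_prim_v _ _ x1 x1) => //; rewrite ?lexx // => p q /eqP' -> qq.
  by have [] := B2 q qq.
Qed.

Lemma on_boundaryW (P Q : C -> Prop) x1 x2 y1 y2 : (forall w, P w -> Q w) ->
  on_boundary P x1 x2 y1 y2 -> on_boundary Q x1 x2 y1 y2.
Proof.
move=> PQ [B1 B2]; split=> p pp; first by have [/PQ ? /PQ ?] := B1 p pp.
by have [/PQ ? /PQ ?] := B2 p pp.
Qed.

Lemma on_boundaryI (P Q : C -> Prop) x1 x2 y1 y2 : on_boundary P x1 x2 y1 y2 ->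
  on_boundary Q x1 x2 y1 y2 -> on_boundary (fun w => P w /\ Q w) x1 x2 y1 y2.
Proof.
move=> [B1 B2] [D1 D2]; split=> p pp.
  by have [? ?] := B1 p pp; have [? ?] := D1 p pp.
by have [? ?] := B2 p pp; have [? ?] := D2 p pp.
Qed.

Lemma eq_rint F G x1 x2 y1 y2 : x1 <= x2 -> y1 <= y2 -> rect_prims F x1 x2 y1 y2 ->
  on_boundary (fun w => F w = G w) x1 x2 y1 y2 ->
  rint F x1 x2 y1 y2 = rint G x1 x2 y1 y2.
Proof.
move=> xx yy [F1 F2 F3 F4] [B1 B2]; rewrite /rint; congr (_ - _ + _ * (_ - _)).
- by apply: eq_cint => // p pp; have [] := B1 p pp.
- by apply: eq_cint => // p pp; have [] := B1 p pp.
- by apply: eq_cint => // p pp; have [] := B2 p pp.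
- by apply: eq_cint => // p pp; have [] := B2 p pp.
Qed.

Lemma bcont_bounded F x1 x2 y1 y2 : x1 <= x2 -> y1 <= y2 ->
  on_boundary (ccont F) x1 x2 y1 y2 ->
  exists2 M, 0 <= M & on_boundary (fun w => modulus (F w) <= M) x1 x2 y1 y2.
Proof.
move=> xx yy [B1 B2].
have ch y : (forall p, x1 <= p <= x2 -> ccont F (pt p y)) -> cont_on (fun p => F (pt p y)) x1 x2.
  move=> c p pp e e0; have [d d0 Hd] := c p pp e e0; exists d => // q _ qp.
  apply: Hd; rewrite (_ : _ - _ = ofR (q - p)) ?modulus_ofR //.
  by apply: complexP; rewrite ?cReD ?cImD ?cReN ?cImN /= ?subrr.
have cv x : (forall p, y1 <= p <= y2 -> ccont F (pt x p)) -> cont_on (fun p => F (pt x p)) y1 y2.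
  move=> c p pp e e0; have [d d0 Hd] := c p pp e e0; exists d => // q _ qp.
  apply: Hd; rewrite (_ : _ - _ = 'i%C * ofR (q - p)) ?modulusM ?modulus_i ?modulus_ofR ?mul1r //.
  by apply: complexP; rewrite ?cReD ?cImD ?cReN ?cImN ?cReM ?cImM /=; ring.
have [M1 H1] := cont_on_bounded xx (ch y1 (fun p pp => proj1 (B1 p pp))).
have [M2 H2] := cont_on_bounded xx (ch y2 (fun p pp => proj2 (B1 p pp))).
have [M3 H3] := cont_on_bounded yy (cv x1 (fun p pp => proj1 (B2 p pp))).
have [M4 H4] := cont_on_bounded yy (cv x2 (fun p pp => proj2 (B2 p pp))).
exists (Num.max 0 (Num.max (Num.max M1 M2) (Num.max M3 M4))); first by rewrite le_max lexx.
split=> p pp; rewrite !le_max.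
  by rewrite H1 ?H2 ?orbT.
by rewrite H3 ?H4 ?orbT.
Qed.

(** Differentiation under the integral sign: the remainder of the kernel is
quadratic, uniformly on the boundary, hence so is the integral of the
remainder. *)
Lemma rint_param_derive (phi : C -> C -> C) (phi1 : C -> C) z B d x1 x2 y1 y2 :
  x1 <= x2 -> y1 <= y2 -> 0 < d -> 0 <= B ->
  (forall z', modulus (z' - z) < d -> rect_prims (phi z') x1 x2 y1 y2 /\
     on_boundary (fun w => modulus (phi z' w - phi z w - (z' - z) * phi1 w) <=
        B * modulus (z' - z) ^+ 2) x1 x2 y1 y2) ->
  rect_prims phi1 x1 x2 y1 y2 ->
  is_derive z (1 : C) (fun z => rint (phi z) x1 x2 y1 y2) (rint phi1 x1 x2 y1 y2).
Proof.
move=> xx yy d0 B0 H p1; apply/cderiveP => e e0.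
set L := 2 * B * (x2 - x1 + (y2 - y1)).
have L0 : 0 <= L by rewrite /L !mulr_ge0 // addr_ge0 // subr_ge0.
exists (Num.min d (e / (L + 1))).
  by rewrite lt_min d0 divr_gt0 // ltr_wpDl.
move=> z'; rewrite lt_min => /andP[zd].
rewrite ltr_pdivlMr ?ltr_wpDl // => ze.
have [|pz _] := H z; first by rewrite subrr modulus0.
have [pz' Hz'] := H z' zd.
have q1 := rect_primsD pz' (rect_primsZ (-1) pz).
have q2 := rect_primsZ (- (z' - z)) p1.
have -> : rint (phi z') x1 x2 y1 y2 - rint (phi z) x1 x2 y1 y2 -
    rint phi1 x1 x2 y1 y2 * (z' - z) =
    rint (fun w => (phi z' w + -1 * phi z w) + - (z' - z) * phi1 w) x1 x2 y1 y2.
  rewrite (rintD xx yy q1 q2) (rintD xx yy pz' (rect_primsZ _ pz)).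
  by rewrite (rintZ _ xx yy pz) (rintZ _ xx yy p1); ring.
apply: le_trans (rint_le (M := B * modulus (z' - z) ^+ 2) xx yy (rect_primsD q1 q2) _) _.
  by apply: on_boundaryW Hz' => w; rewrite mulN1r mulNr.
rewrite (_ : _ * _ = L * modulus (z' - z) * modulus (z' - z)); last by rewrite /L; ring.
rewrite ler_wpM2r ?modulus_ge0 //.
have := modulus_ge0 (z' - z); move: ze; move: (modulus _) => T ze T0; nra.
Qed.

(** The difference quotient of [F] at [z] is differentiable except at [z],
where it is continuous.  Its integral is therefore that over arbitrarily small
squares around [z], which tends to zero. *)
Lemma rint_diff_quotient F x1 x2 y1 y2 u v : x1 < u < x2 -> y1 < v < y2 ->
  (forall p q, x1 <= p <= x2 -> y1 <= q <= y2 -> derivable F (pt p q) 1) ->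
  rint (fun w => if w == pt u v then derive1 F (pt u v) else (F w - F (pt u v)) / (w - pt u v))
    x1 x2 y1 y2 = 0.
Proof.
move=> /andP[xu ux] /andP[yv vy] dF; set z := pt u v.
set Q := fun w => _.
have x12 : x1 <= x2 by lra. have y12 : y1 <= y2 by lra.
have dz : derivable F z 1 by apply: dF; rewrite !ltW.
have dQ p q : x1 <= p <= x2 -> y1 <= q <= y2 -> pt p q != z -> derivable Q (pt p q) 1.
  move=> pp qq nz.
  apply: (@eq_near_derivable (fun w => (F w - F z) * (w - z)^-1) _ _ (modulus (pt p q - z))).
  - by rewrite modulus_gt0 subr_eq0.
  - move=> w; rewrite /Q; case: eqP => [->|//]; rewrite modulus_distC.
    by rewrite ltxx.
  - apply: derivableM.
      by apply: derivableB; [exact: dF|exact: derivable_cst].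
    apply: derivableV; first by rewrite subr_eq0.
    exact: derivable_subr.
have cz : ccont Q z.
  move=> e e0; have e2 : 0 < e / 2 by rewrite divr_gt0.
  have /cderiveP /(_ _ e2) [d d0 Hd] := derivable1_is_derive dz.
  exists d => // w wd; rewrite /Q eqxx; case: eqP => [_|/eqP nz].
    by rewrite subrr modulus0.
  have wz : w - z != 0 by rewrite subr_eq0.
  have -> : (F w - F z) / (w - z) - derive1 F z = (F w - F z - derive1 F z * (w - z)) / (w - z).
    by field.
  rewrite modulus_div; apply: (@le_lt_trans _ _ (e / 2)).
    by rewrite ler_pdivrMr ?modulus_gt0 // Hd.
  by rewrite ltr_pdivrMr // ltr_pMr // ltrDl.
have cQ : ccont_rect Q x1 x2 y1 y2.
  move=> p q pp qq; have [->//|nz] := eqVneq (pt p q) z.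
  by apply: derivable_ccont; exact: dQ.
have [d d0 Hd] := cz 1 ltr01.
pose M := modulus (derive1 F z) + 1.
have M0 : 0 < M by rewrite ltr_wpDl ?modulus_ge0.
apply/eqP; rewrite -modulus_eq0 eq_le modulus_ge0 andbT.
apply/ler_addgt0Pr => e e0; rewrite add0r.
(* half-side of the small square: it fits into the rectangle, lies where the
   quotient is bounded by M, and 8 M n <= e bounds the integral *)
pose c1 := Num.min (Num.min (u - x1) (x2 - u)) (Num.min (v - y1) (y2 - v)).
pose n := Num.min c1 (Num.min (d / 3) (e / (8 * M))).
have n0 : 0 < n.
  by rewrite /n /c1 !lt_min !subr_gt0 xu ux yv vy !divr_gt0 ?mulr_gt0.
have : n <= n by [].
rewrite {2}/n /c1 !le_min => /andP[/andP[/andP[n1 n2] /andP[n3 n4]] /andP[n5 n6]].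
have away p q : x1 <= p <= x2 -> y1 <= q <= y2 -> p <> u \/ q <> v ->
    derivable Q (pt p q) 1.
  by move=> pp qq nz; apply: dQ => //; apply/eqP => -[? ?]; case: nz.
have gz a1 a2 b1 b2 : x1 <= a1 -> a1 <= a2 -> a2 <= x2 -> y1 <= b1 -> b1 <= b2 -> b2 <= y2 ->
    (a2 < u \/ u < a1) \/ (b2 < v \/ v < b1) -> rint Q a1 a2 b1 b2 = 0.
  move=> h1 h2 h3 h4 h5 h6 out; apply: goursat => // p q /andP[p1 p2] /andP[q1 q2].
  exists (derive1 Q (pt p q)); apply: derivable1_is_derive; apply: away; [lra|lra|].
  by case: out => [[? | ?] | [? | ?]]; [left|left|right|right]; lra.
have -> : rint Q x1 x2 y1 y2 = rint Q (u - n) (u + n) (v - n) (v + n).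
  rewrite (@rint_splitx _ _ _ (u - n)) //; last by lra.
  rewrite (@rint_splitx _ _ (u - n) (u + n)) //; [|lra|apply: ccont_rectW cQ; lra].
  rewrite (@rint_splity _ _ (u - n) (u + n) _ (v - n)) //; [|lra|lra|apply: ccont_rectW cQ; lra].
  rewrite (@rint_splity _ _ (u - n) (u + n) (v - n) (v + n)) //; [|lra|lra|apply: ccont_rectW cQ; lra].
  rewrite [rint Q x1 _ _ _]gz; [|lra|lra|lra|lra|lra|lra|by left; left; lra].
  rewrite [rint Q (u + n) _ _ _]gz; [|lra|lra|lra|lra|lra|lra|by left; right; lra].
  rewrite [rint Q _ _ y1 _]gz; [|lra|lra|lra|lra|lra|lra|by right; left; lra].
  rewrite [rint Q _ _ _ y2]gz; [|lra|lra|lra|lra|lra|lra|by right; right; lra].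
  by rewrite !add0r !addr0.
have bd p q : u - n <= p <= u + n -> v - n <= q <= v + n -> modulus (Q (pt p q)) <= M.
  move=> pp qq.
  have close : modulus (pt p q - z) < d.
    apply: (@le_lt_trans _ _ (n + n)); last by lra.
    apply: le_trans (modulus_le_ReIm _) _; rewrite cReD cImD cReN cImN /=.
    by apply: lerD; rewrite ler_norml; apply/andP; split; lra.
  have := Hd _ close; rewrite [Q z]/Q eqxx => H.
  rewrite /M -(subrK (derive1 F z) (Q _)); apply: le_trans (modulusD _ _) _.
  by rewrite addrC lerD2l ltW.
have cn : ccont_rect Q (u - n) (u + n) (v - n) (v + n) by apply: ccont_rectW cQ; lra.
apply: le_trans (rint_le (M := M) _ _ (ccont_rect_prims _ _ cn) _) _; try lra.
  by split=> p pp; split; apply: bd => //; lra.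
move: n6; rewrite ler_pdivlMr ?mulr_gt0 // => n6.
rewrite (_ : 2 * M * _ = n * (8 * M)) //; ring.
Qed.

End CauchyFormula.

(** * Differentiability of the derivative *)

Section AnalyticDerivative.
Variable R : realType.
Local Notation C := (R[i]^o).
Implicit Types (h k : C -> C) (z w : C).
Local Notation pt x y := (Complex x y : C).

Section CauchyKernel.
Variables (x1 x2 y1 y2 c : R) (z0 : C) (k : C -> C).
Hypotheses (xx : x1 <= x2) (yy : y1 <= y2) (c0 : 0 < c).
Hypothesis far : on_boundary (fun w => 2 * c <= modulus (w - z0)) x1 x2 y1 y2.
Hypothesis ck : on_boundary (ccont k) x1 x2 y1 y2.

Definition cauchy_kernel n z w := k w * ((w - z) ^+ n)^-1.

Lemma far_near z : modulus (z - z0) < c ->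
  on_boundary (fun w => c <= modulus (w - z)) x1 x2 y1 y2.
Proof.
move=> zc; apply: on_boundaryW far => w H.
have := modulusD (w - z) (z - z0); rewrite addrA subrK => H'.
by lra.
Qed.

Lemma ccontM (F G : C -> C) w : ccont F w -> ccont G w -> ccont (fun w => F w * G w) w.
Proof.
move=> cF cG e e0.
pose A := modulus (F w) + 1; pose B := modulus (G w) + 1.
have A0 : 0 < A by rewrite ltr_wpDl ?modulus_ge0.
have B0 : 0 < B by rewrite ltr_wpDl ?modulus_ge0.
have [|d1 d10 H1] := cF (Num.min 1 (e / 2 / B)).
  by rewrite lt_min ltr01 !divr_gt0.
have [|d2 d20 H2] := cG (e / 2 / A); first by rewrite !divr_gt0.
exists (Num.min d1 d2); first by rewrite lt_min d10.
move=> t; rewrite lt_min => /andP[/H1 + /H2 K2]; rewrite lt_min => /andP[K1 K1'].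
have -> : F t * G t - F w * G w = (F t - F w) * G w + F t * (G t - G w) by ring.
apply: le_lt_trans (modulusD _ _) _; rewrite !modulusM [e]splitr.
have Ft : modulus (F t) <= A.
  have := modulusD (F t - F w) (F w); rewrite subrK /A; lra.
apply: ltr_leD.
  apply: (@le_lt_trans _ _ (modulus (F t - F w) * B)).
    by rewrite ler_wpM2l ?modulus_ge0 // /B lerDl.
  by rewrite -ltr_pdivlMr.
apply: le_trans (ler_wpM2r (modulus_ge0 _) Ft) _.
by rewrite mulrC -ler_pdivlMr // ltW.
Qed.

Lemma cauchy_kernel_prims n z : modulus (z - z0) < c ->
  rect_prims (cauchy_kernel n z) x1 x2 y1 y2.
Proof.
move=> zc; apply: bcont_rect_prims => //.
apply: on_boundaryW (on_boundaryI ck (far_near zc)) => w [cw H].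
apply: ccontM => //; apply: derivable_ccont.
have wz : w - z != 0 by rewrite -modulus_gt0; exact: lt_le_trans H.
apply: derivableV; first by rewrite expf_neq0.
elim: n => [|n IH].
  rewrite (_ : (fun _ => _) = fun=> 1); first exact: derivable_cst.
  by apply/funext => t; rewrite expr0.
rewrite (_ : (fun _ => _) = (fun y : C => y - z : C) * (fun y : C => (y - z) ^+ n : C)).
  by apply: derivableM; [exact: derivable_subr|exact: IH].
by apply/funext => t; rewrite exprS.
Qed.

Lemma cauchy_kernel_derive12 z : modulus (z - z0) < c ->
  is_derive z (1 : C) (fun z => rint (cauchy_kernel 1 z) x1 x2 y1 y2)
    (rint (cauchy_kernel 2 z) x1 x2 y1 y2).
Proof.
move=> zc; have [M M0 HM] := bcont_bounded xx yy ck.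
apply: (@rint_param_derive _ _ _ _ (M * c^-1 ^+ 3) (c - modulus (z - z0))) => //.
- by rewrite subr_gt0.
- by rewrite mulr_ge0 // exprn_ge0 // invr_ge0 ltW.
- move=> z'; rewrite ltrBrDr => z'z.
  have zc' : modulus (z' - z0) < c.
    have := modulusD (z' - z) (z - z0); rewrite addrA subrK; lra.
  split; first exact: cauchy_kernel_prims.
  apply: on_boundaryW (on_boundaryI HM (on_boundaryI (far_near zc) (far_near zc'))) => w [wM [wz wz']].
  have n1 : w - z != 0 by rewrite -modulus_gt0; exact: lt_le_trans wz.
  have n2 : w - z' != 0 by rewrite -modulus_gt0; exact: lt_le_trans wz'.
  have -> : cauchy_kernel 1 z' w - cauchy_kernel 1 z w - (z' - z) * cauchy_kernel 2 z w =
      k w * ((w - z)^-1 * (w - z)^-1 * (w - z')^-1) * (z' - z) ^+ 2.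
    by rewrite /cauchy_kernel; field; rewrite n1 n2.
  rewrite !(modulusM, modulusX, modulusV) ler_wpM2r ?sqr_ge0 //.
  have i1 : (modulus (w - z))^-1 <= c^-1 by rewrite lef_pV2 ?posrE // (lt_le_trans c0 wz).
  have i2 : (modulus (w - z'))^-1 <= c^-1 by rewrite lef_pV2 ?posrE // (lt_le_trans c0 wz').
  apply: ler_pM; rewrite ?modulus_ge0 // ?mulr_ge0 ?invr_ge0 ?modulus_ge0 //.
  rewrite exprSr expr2; apply: ler_pM; rewrite ?mulr_ge0 ?invr_ge0 ?modulus_ge0 //.
  by apply: ler_pM; rewrite ?invr_ge0 ?modulus_ge0.
- exact: cauchy_kernel_prims.
Qed.

Lemma cauchy_kernel_derive23 z : modulus (z - z0) < c ->
  derivable (fun z => rint (cauchy_kernel 2 z) x1 x2 y1 y2) z 1.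
Proof.
move=> zc; have [M M0 HM] := bcont_bounded xx yy ck.
suff H : is_derive z (1 : C) (fun z => rint (cauchy_kernel 2 z) x1 x2 y1 y2)
    (rint (fun w => 2 * cauchy_kernel 3 z w) x1 x2 y1 y2) by exact: ex_derive.
apply: (@rint_param_derive _ _ _ _ (3 * M * c^-1 ^+ 4) (c - modulus (z - z0))) => //.
- by rewrite subr_gt0.
- by apply: mulr_ge0; [exact: mulr_ge0|rewrite exprn_ge0 // invr_ge0 ltW].
- move=> z'; rewrite ltrBrDr => z'z.
  have zc' : modulus (z' - z0) < c.
    have := modulusD (z' - z) (z - z0); rewrite addrA subrK; lra.
  split; first exact: cauchy_kernel_prims.
  apply: on_boundaryW (on_boundaryI HM (on_boundaryI (far_near zc) (far_near zc'))) => w [wM [wz wz']].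
  have n1 : w - z != 0 by rewrite -modulus_gt0; exact: lt_le_trans wz.
  have n2 : w - z' != 0 by rewrite -modulus_gt0; exact: lt_le_trans wz'.
  have -> : cauchy_kernel 2 z' w - cauchy_kernel 2 z w - (z' - z) * (2 * cauchy_kernel 3 z w) =
      k w * ((w - z)^-1 * (w - z)^-1 * (w - z')^-1 * (w - z')^-1 +
        (1 + 1) * ((w - z)^-1 * (w - z)^-1 * (w - z)^-1 * (w - z')^-1)) * (z' - z) ^+ 2.
    by rewrite /cauchy_kernel; field; rewrite n1 n2.
  rewrite modulusM modulusX ler_wpM2r ?sqr_ge0 //.
  have i1 : (modulus (w - z))^-1 <= c^-1 by rewrite lef_pV2 ?posrE // (lt_le_trans c0 wz).
  have i2 : (modulus (w - z'))^-1 <= c^-1 by rewrite lef_pV2 ?posrE // (lt_le_trans c0 wz').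
  have j1 : 0 <= (modulus (w - z))^-1 by rewrite invr_ge0 modulus_ge0.
  have j2 : 0 <= (modulus (w - z'))^-1 by rewrite invr_ge0 modulus_ge0.
  have four p q r t : 0 <= p <= c^-1 -> 0 <= q <= c^-1 -> 0 <= r <= c^-1 -> 0 <= t <= c^-1 ->
      p * q * r * t <= c^-1 ^+ 4.
    move=> /andP[? ?] /andP[? ?] /andP[? ?] /andP[? ?]; rewrite !exprSr expr0 mul1r.
    by do 3 (apply: ler_pM; rewrite ?mulr_ge0 //).
  rewrite modulusM (_ : 3 * M * c^-1 ^+ 4 = M * (3 * c^-1 ^+ 4)); last by ring.
  apply: ler_pM; rewrite ?modulus_ge0 //.
  apply: le_trans (modulusD _ _) _.
  have t2 : modulus (1 + 1 : C) <= 2.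
    by apply: le_trans (modulusD _ _) _; rewrite modulus1; lra.
  rewrite !(modulusM, modulusV).
  rewrite (_ : 3 * c^-1 ^+ 4 = c^-1 ^+ 4 + 2 * c^-1 ^+ 4); last by ring.
  apply: lerD; first by apply: four; apply/andP.
  apply: ler_pM; rewrite ?modulus_ge0 ?mulr_ge0 //.
  by apply: four; apply/andP.
- by apply: rect_primsZ; exact: cauchy_kernel_prims.
Qed.

End CauchyKernel.

Lemma cint_ZIm_ge (F : R -> C) (l : C) (a b m : R) : a <= b -> has_prim F a b ->
  (forall x, a <= x <= b -> m <= complex.Im (l * F x)) ->
  m * (b - a) <= complex.Im (l * cint F a b).
Proof.
move=> ab pF H; rewrite -cintZ //; apply: cint_Im_ge => //; exact: has_primZ.
Qed.

(** Each side of the square contributes at least 1 to the imaginary part of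
the winding integral (the exact value is a quarter of the full turn). *)
Lemma winding_neq0 (u v s : R) : 0 < s ->
  rint (cauchy_kernel (fun=> 1) 1 (pt u v)) (u - s) (u + s) (v - s) (v + s) != 0.
Proof.
move=> s0.
have xx : u - s <= u + s by lra.
have yy : v - s <= v + s by lra.
pose c := s / 2.
have c0 : 0 < c by rewrite divr_gt0.
have c2 : 2 * c = s by rewrite /c; field.
have far : on_boundary (fun w => 2 * c <= modulus (w - pt u v)) (u - s) (u + s) (v - s) (v + s).
  rewrite c2; split=> p _; split.
  - apply: le_trans (Im_le_modulus _); rewrite cImD cImN /= ler_normr.
    by apply/orP; right; lra.
  - apply: le_trans (Im_le_modulus _); rewrite cImD cImN /= ler_normr.
    by apply/orP; left; lra.
  - apply: le_trans (Re_le_modulus _); rewrite cReD cReN /= ler_normr.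
    by apply/orP; right; lra.
  - apply: le_trans (Re_le_modulus _); rewrite cReD cReN /= ler_normr.
    by apply/orP; left; lra.
have ck : on_boundary (ccont (fun=> 1 : C)) (u - s) (u + s) (v - s) (v + s).
  by split=> p _; split=> e e0; exists 1 => // w _; rewrite subrr modulus0.
have [|p1 p2 p3 p4] := cauchy_kernel_prims xx yy c0 far ck 1 (z := pt u v).
  by rewrite subrr modulus0.
have len (p : R) : (p + s - (p - s)) = 2 * s by ring.
have key (q : R) : `|q| <= s -> (2 * s)^-1 <= s / (s ^+ 2 + q ^+ 2).
  move=> qs; have q2 : q ^+ 2 <= s ^+ 2.
    by rewrite -(ger0_norm (ltW s0)) -[leLHS]real_normK ?num_real // ler_pXn2r ?nnegrE ?normr_ge0 // (ger0_norm (ltW s0)).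
  have S0 : 0 < s ^+ 2 by rewrite exprn_gt0.
  have Q0 := sqr_ge0 q.
  rewrite ler_pdivlMr ?ltr_wpDr // mulrC ler_pdivrMr ?mulr_gt0 //.
  by rewrite mulrCA -expr2; lra.
have one : (2 * s)^-1 * (2 * s) = 1 by rewrite mulVf // gt_eqF // mulr_gt0.
have h1 := @cint_ZIm_ge _ 1 _ _ (2 * s)^-1 xx p1.
have h2 := @cint_ZIm_ge _ (-1) _ _ (2 * s)^-1 xx p2.
have h3 := @cint_ZIm_ge _ 'i%C _ _ (2 * s)^-1 yy p3.
have h4 := @cint_ZIm_ge _ (- 'i%C) _ _ (2 * s)^-1 yy p4.
rewrite !len !one in h1 h2 h3 h4.
apply/eqP => E; have : complex.Im (rint (cauchy_kernel (fun=> 1) 1 (pt u v)) (u - s) (u + s) (v - s) (v + s)) = 0.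
  by rewrite E.
have split4 (a1 a2 a3 a4 : C) : a1 - a2 + 'i%C * (a3 - a4) = 1 * a1 + -1 * a2 + 'i%C * a3 + - 'i%C * a4.
  by ring.
rewrite /rint split4 !cImD.
have inv (a b : R) : (Complex a b : C)^-1 = Complex (a / (a ^+ 2 + b ^+ 2)) (- (b / (a ^+ 2 + b ^+ 2))).
  by [].
have bnd (p x : R) : p - s <= x <= p + s -> `|x - p| <= s.
  by move=> xp; rewrite ler_norml; apply/andP; split; lra.
have H1 : 1 <= complex.Im (1 * cint (fun x => cauchy_kernel (fun=> 1) 1 (pt u v) (pt x (v - s))) (u - s) (u + s)).
  apply: h1 => x /bnd xu; rewrite mul1r /cauchy_kernel mul1r expr1.
  rewrite (_ : pt x (v - s) - pt u v = pt (x - u) (- s)); last by apply: complexP; rewrite ?cReD ?cImD ?cReN ?cImN /=; ring.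
  by rewrite inv /= sqrrN mulNr opprK addrC; exact: key.
have H2 : 1 <= complex.Im (-1 * cint (fun x => cauchy_kernel (fun=> 1) 1 (pt u v) (pt x (v + s))) (u - s) (u + s)).
  apply: h2 => x /bnd xu; rewrite /cauchy_kernel mul1r expr1 mulN1r.
  rewrite (_ : pt x (v + s) - pt u v = pt (x - u) s); last by apply: complexP; rewrite ?cReD ?cImD ?cReN ?cImN /=; ring.
  by rewrite inv cImN /= opprK addrC; exact: key.
have H3 : 1 <= complex.Im ('i%C * cint (fun x => cauchy_kernel (fun=> 1) 1 (pt u v) (pt (u + s) x)) (v - s) (v + s)).
  apply: h3 => x /bnd xv; rewrite /cauchy_kernel mul1r expr1.
  rewrite (_ : pt (u + s) x - pt u v = pt s (x - v)); last by apply: complexP; rewrite ?cReD ?cImD ?cReN ?cImN /=; ring.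
  by rewrite inv cImM /= mul0r add0r mul1r; exact: key.
have H4 : 1 <= complex.Im (- 'i%C * cint (fun x => cauchy_kernel (fun=> 1) 1 (pt u v) (pt (u - s) x)) (v - s) (v + s)).
  apply: h4 => x /bnd xv; rewrite /cauchy_kernel mul1r expr1.
  rewrite (_ : pt (u - s) x - pt u v = pt (- s) (x - v)); last by apply: complexP; rewrite ?cReD ?cImD ?cReN ?cImN /=; ring.
  by rewrite inv mulNr cImN cImM /= mul0r add0r mul1r mulNr opprK sqrrN; exact: key.
by move: H1 H2 H3 H4; do 4 move: (complex.Im _); move=> *; lra.
Qed.

(** Cauchy's formula writes [h] near [z0] as the quotient of two integrals
depending on a parameter, which can be differentiated twice. *)
Theorem derive1_derivable h z0 (r : R) : 0 < r ->
  (forall w, modulus (w - z0) < r -> derivable h w 1) -> derivable (derive1 h) z0 1.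
Proof.
move=> r0 dh; case: z0 dh => u v dh; set z0 := pt u v in dh *.
(* the square of half-side s around z0 lies in the disc of radius r, and its
   boundary stays at distance c from the points within c of z0 *)
pose s := r / 4; pose c := s / 2.
have s0 : 0 < s by rewrite divr_gt0. have c0 : 0 < c by rewrite divr_gt0.
have sE : r = 4 * s by rewrite /s; field.
have cE : s = 2 * c by rewrite /c; field.
have xx : u - s <= u + s by lra.
have yy : v - s <= v + s by lra.
have far : on_boundary (fun w => 2 * c <= modulus (w - z0)) (u - s) (u + s) (v - s) (v + s).
  rewrite -cE; split=> p _; split.
  - apply: le_trans (Im_le_modulus _); rewrite cImD cImN /= ler_normr.
    by apply/orP; right; lra.
  - apply: le_trans (Im_le_modulus _); rewrite cImD cImN /= ler_normr.
    by apply/orP; left; lra.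
  - apply: le_trans (Re_le_modulus _); rewrite cReD cReN /= ler_normr.
    by apply/orP; right; lra.
  - apply: le_trans (Re_le_modulus _); rewrite cReD cReN /= ler_normr.
    by apply/orP; left; lra.
have dR p q : u - s <= p <= u + s -> v - s <= q <= v + s -> derivable h (pt p q) 1.
  move=> pp qq; apply: dh; apply: (@le_lt_trans _ _ (s + s)); last by lra.
  apply: le_trans (modulus_le_ReIm _) _; rewrite cReD cImD cReN cImN /=.
  by apply: lerD; rewrite ler_norml; apply/andP; split; lra.
have ch : on_boundary (ccont h) (u - s) (u + s) (v - s) (v + s).
  by split=> p pp; split; apply: derivable_ccont; apply: dR => //; lra.
have c1 : on_boundary (ccont (fun=> 1 : C)) (u - s) (u + s) (v - s) (v + s).
  by split=> p _; split=> e e0; exists 1 => // w _; rewrite subrr modulus0.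
pose A n z := rint (cauchy_kernel h n z) (u - s) (u + s) (v - s) (v + s).
pose D n z := rint (cauchy_kernel (fun=> 1) n z) (u - s) (u + s) (v - s) (v + s).
have dA z : modulus (z - z0) < c -> is_derive z (1 : C) (A 1%N) (A 2%N z).
  exact: cauchy_kernel_derive12.
have dD z : modulus (z - z0) < c -> is_derive z (1 : C) (D 1%N) (D 2%N z).
  exact: cauchy_kernel_derive12.
have formula z : modulus (z - z0) < c -> h z * D 1%N z = A 1%N z.
  case: z => p q; set z := pt p q => zc.
  have zR := le_lt_trans (Re_le_modulus _) zc; have zI := le_lt_trans (Im_le_modulus _) zc.
  rewrite cReD cReN /= ltr_norml in zR; rewrite cImD cImN /= ltr_norml in zI.
  have P1 := cauchy_kernel_prims xx yy c0 far ch 1 zc.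
  have P2 := cauchy_kernel_prims xx yy c0 far c1 1 zc.
  have P3 := rect_primsZ (- h z) P2.
  have Q := @rint_diff_quotient R h (u - s) (u + s) (v - s) (v + s) p q.
  have E : rint (fun w => cauchy_kernel h 1 z w + - h z * cauchy_kernel (fun=> 1) 1 z w)
      (u - s) (u + s) (v - s) (v + s) = 0.
    rewrite -[RHS]Q; [|lra|lra|exact: dR].
    apply: eq_rint => //; first exact: rect_primsD.
    apply: on_boundaryW (far_near far zc) => w wz.
    have nz : w != z by rewrite -subr_eq0 -modulus_gt0; exact: lt_le_trans wz.
    by rewrite (negbTE nz) /cauchy_kernel expr1; ring.
  rewrite rintD // rintZ // mulNr in E.
  by apply/eqP; rewrite eq_sym -subr_eq0; apply/eqP; rewrite -[RHS]E.
have D0 : D 1%N z0 != 0 by exact: winding_neq0.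
have zz0 : modulus (z0 - z0) < c by rewrite subrr modulus0.
have [d d0 Hd] := is_derive_ccont (dD z0 zz0) (etrans (modulus_gt0 _) D0).
have Dn z : modulus (z - z0) < d -> D 1%N z != 0.
  move=> /Hd H; apply: contraTneq H => ->.
  by rewrite sub0r modulusN -leNgt.
have E z : modulus (z - z0) < Num.min c d ->
    (A 2%N z - h z * D 2%N z) * (D 1%N z)^-1 = derive1 h z.
  rewrite lt_min => /andP[zc zd].
  have dhz : derivable h z 1 by apply: dh; apply: lt_trans zc _; lra.
  have hD := is_deriveM (derivable1_is_derive dhz) (dD z zc).
  have hD' : is_derive z (1 : C) (A 1%N) (h z *: D 2%N z + D 1%N z *: derive1 h z).
    have cz : 0 < c - modulus (z - z0) by rewrite subr_gt0.
    apply: (eq_near_is_derive cz) hD.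
    move=> w wz; apply: formula.
    by have := modulusD (w - z) (z - z0); rewrite addrA subrK; lra.
  rewrite -(is_derive_derive1 (dA z zc)) (is_derive_derive1 hD').
  by rewrite /GRing.scale /=; field; exact: Dn.
have cd0 : 0 < Num.min c d by rewrite lt_min c0 d0.
apply: (eq_near_derivable cd0 E).
apply: derivableM.
  apply: derivableB; first exact: (cauchy_kernel_derive23 xx yy c0 far ch zz0).
  apply: derivableM; last exact: (cauchy_kernel_derive23 xx yy c0 far c1 zz0).
  by apply: dh; rewrite subrr modulus0.
apply: derivableV; first exact: D0.
by have := dD z0 zz0 => H; exact: ex_derive.
Qed.

End AnalyticDerivative.

(** * Harmonicity *)

Section Harmonic.
Variable R : realType.
Local Notation C := (R[i]^o).
Implicit Types (F G h g f : C -> C) (u : C -> R) (z w : C).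

Lemma disc_ball z w : disc z -> modulus (w - z) < 1 - modulus z -> disc w.
Proof.
rewrite /disc /= => _ H; rewrite -(subrK z w).
by apply: le_lt_trans (modulusD _ _) _; rewrite -ltrBrDr.
Qed.

Lemma analytic_derive1 h : analytic_on_disc h -> analytic_on_disc (derive1 h).
Proof.
move=> ah z dz; apply: (@derive1_derivable _ _ _ (1 - modulus z)).
  by rewrite subr_gt0.
by move=> w wz; apply: ah; exact: disc_ball wz.
Qed.

Lemma continuous_Re_analytic u F z : disc z -> derivable F z 1 ->
  (forall w, disc w -> u w = complex.Re (F w)) -> {for z, continuous u}.
Proof.
move=> dz dF uF.
apply: (proj2 (@cvgrPdist_le R R^o C (nbhs z) (@nbhs_filter C z) u (u z))) => e e0.
have [d d0 Hd] := derivable_ccont dF e0.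
exists (ofR (Num.min d (1 - modulus z))).
  by rewrite /= ofR_gt0 lt_min d0 subr_gt0.
move=> w /=; rewrite /ball /= cnormE /ofR ltcR lt_min => /andP[w1 w2].
rewrite uF // uF; last by apply: disc_ball dz _; rewrite modulus_distC.
rewrite -cReN -cReD; apply: le_trans (Re_le_modulus _) _.
by rewrite modulus_distC ltW // Hd // modulus_distC.
Qed.

Lemma Re_analytic_line u F (c z l : C) : modulus c = 1 -> disc z ->
  is_derive z (1 : C) F l -> (forall w, disc w -> u w = complex.Re (F w)) ->
  is_derive (0 : R^o) (1 : R^o) ((fun t => u (z + c * ofR t)) : R^o -> R^o) (complex.Re (l * c)).
Proof.
move=> c1 dz dF uF.
have z0 : z + c * ofR 0 = z by rewrite /ofR rmorph0 mulr0 addr0.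
have [H _] : is_velocity (F \o (fun t => z + c * ofR t)) 0 (l * c).
  by apply: is_velocity_comp (is_velocity_line z c 0) _; rewrite z0.
apply: near_eq_is_derive H.
exists (1 - modulus z); first by rewrite /= subr_gt0.
move=> t; rewrite /ball /= sub0r normrN => t1; rewrite uF //.
apply: disc_ball dz _; rewrite addrC addKr modulusM c1 mul1r modulus_ofR.
exact: t1.
Qed.

Lemma shift_reE z t : shift_re z t = z + 1 * ofR t.
Proof. by rewrite mul1r. Qed.

Lemma shift_imE z t : shift_im z t = z + 'i%C * ofR t.
Proof.
by apply: complexP; rewrite !(cReD, cImD, cReM, cImM) /=; ring.
Qed.

(** Differentiating along the two axes multiplies [F'] by 1 and by the
imaginary unit.  The partial derivatives are thus again real parts of analytic
functions, and the lemma can be iterated. *)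
Lemma C1_Re_analytic u F : analytic_on_disc F ->
  (forall z, disc z -> u z = complex.Re (F z)) ->
  [/\ C1_on_disc u,
      forall z, disc z -> partial_x u z = complex.Re (derive1 F z)
    & forall z, disc z -> partial_y u z = complex.Re ('i%C * derive1 F z)].
Proof.
move=> aF uF.
have dx z : disc z -> is_derive (0 : R^o) (1 : R^o) ((u \o shift_re z) : R^o -> R^o) (complex.Re (derive1 F z)).
  move=> dz; have := Re_analytic_line (modulus1 R) dz (derivable1_is_derive (aF z dz)) uF.
  rewrite mulr1; congr is_derive; apply/funext => t.
  by rewrite /= shift_reE.
have dy z : disc z -> is_derive (0 : R^o) (1 : R^o) ((u \o shift_im z) : R^o -> R^o) (complex.Re ('i%C * derive1 F z)).
  move=> dz; have := Re_analytic_line (modulus_i R) dz (derivable1_is_derive (aF z dz)) uF.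
  rewrite mulrC; congr is_derive; apply/funext => t.
  by rewrite /= shift_imE.
have px z : disc z -> partial_x u z = complex.Re (derive1 F z).
  by move=> dz; exact: (is_derive_derive1 (dx z dz)).
have py z : disc z -> partial_y u z = complex.Re ('i%C * derive1 F z).
  by move=> dz; exact: (is_derive_derive1 (dy z dz)).
split=> // z dz; split.
- by have := dx z dz => H; exact: ex_derive.
- by have := dy z dz => H; exact: ex_derive.
- by apply: continuous_Re_analytic px => //; exact: analytic_derive1.
- apply: (@continuous_Re_analytic _ (fun z => 'i%C * derive1 F z)) => //.
  by apply: derivableM; [exact: derivable_cst|exact: analytic_derive1].
Qed.

Lemma analytic_i F : analytic_on_disc F -> analytic_on_disc (fun z => 'i%C * F z).
Proof.
by move=> aF z dz; apply: derivableM; [exact: derivable_cst|exact: aF].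
Qed.

Lemma derive1_i F z : derivable F z 1 -> derive1 (fun z => 'i%C * F z : C) z = 'i%C * derive1 F z.
Proof.
move=> /derivable1_is_derive dF.
exact: (is_derive_derive1 (is_derive_comp dF (is_deriveZc 'i%C (F z)))).
Qed.

Lemma real_harmonic_Re u F : analytic_on_disc F ->
  (forall z, disc z -> u z = complex.Re (F z)) -> real_harmonic u.
Proof.
move=> aF uF; have aF1 := analytic_derive1 aF.
have [Cu px py] := C1_Re_analytic aF uF.
have [Cx pxx pxy] := C1_Re_analytic aF1 px.
have [Cy pyx pyy] := C1_Re_analytic (analytic_i aF1) py.
split=> // z dz; rewrite pxx // pyy // derive1_i; last exact: aF1.
by rewrite mulrA -expr2 sqr_i mulN1r cReN addrN.
Qed.

Lemma class_H_harmonic f h g : class_H f h g -> harmonic_on_disc f.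
Proof.
move=> [[ah ag] fE _ _]; split.
(* conjugation of g does not change its real part and changes the sign of its
   imaginary part *)
- apply: (@real_harmonic_Re _ (fun z => h z + g z)).
    by move=> z dz; apply: derivableD; [exact: ah|exact: ag].
  by move=> z dz; rewrite fE // !cReD; case: (g z).
- apply: (@real_harmonic_Re _ (fun z => - 'i%C * (h z - g z))).
    move=> z dz; apply: derivableM; first exact: derivable_cst.
    by apply: derivableB; [exact: ah|exact: ag].
  move=> z dz; rewrite fE // cImD cReM cReD cImD cReN cImN /=.
  by case: (g z) => p q /=; ring.
Qed.

End Harmonic.

(** * Koebe transforms *)

Section Koebe.
Variable R : realType.
Local Notation C := (R[i]^o).
Implicit Types (F G H h g f : C -> C) (z w l m : C).

Lemma cderiveM F G z l m : is_derive z (1 : C) F l -> is_derive z (1 : C) G m ->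
  is_derive z (1 : C) (fun w => F w * G w) (l * G z + F z * m).
Proof.
move=> dF dG; have := is_deriveM dF dG.
by congr is_derive; rewrite /GRing.scale /= addrC mulrC.
Qed.

Lemma cderiveD F G z l m : is_derive z (1 : C) F l -> is_derive z (1 : C) G m ->
  is_derive z (1 : C) (fun w => F w + G w) (l + m).
Proof. by move=> dF dG; exact: is_deriveD. Qed.

Lemma cderiveV F z l : F z != 0 -> is_derive z (1 : C) F l ->
  is_derive z (1 : C) (fun w => (F w)^-1) (- (F z) ^- 2 * l).
Proof.
by move=> Fz [dF <-]; split; [exact: derivableV|rewrite deriveV].
Qed.

Lemma cderive_cst (c z : C) : is_derive z (1 : C) (fun=> c) 0.
Proof. exact: is_derive_cst. Qed.

Lemma disc0 : disc (0 : C).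
Proof. by change (modulus (0 : C) < 1); rewrite modulus0 ltr01. Qed.

Lemma jacobian_neq0 h g z : 0 < harm_jacobian h g z -> derive1 h z != 0.
Proof.
rewrite /harm_jacobian subr_gt0 => /(le_lt_trans (sqr_ge0 _)).
by rewrite -modulus_eq0; case: eqP => // ->; rewrite expr0n ltxx.
Qed.

Lemma class_SHK_dilatation (K : R) f h g : 1 <= K -> class_SHK K f h g ->
  exists2 k, 0 <= k < 1 & forall z, disc z ->
    0 < modulus (derive1 h z) /\ modulus (derive1 g z) <= k * modulus (derive1 h z).
Proof.
move=> K1 [[_ sp _] dil]; exists ((K - 1) / (K + 1)).
  apply/andP; split; first by rewrite divr_ge0 //; lra.
  by rewrite ltr_pdivrMr; lra.
move=> z dz; have h0 : 0 < modulus (derive1 h z) by rewrite modulus_gt0 (jacobian_neq0 (sp z dz)).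
split=> //; have := dil z dz; rewrite /dilatation modulus_div.
by rewrite ler_pdivrMr.
Qed.

Lemma conj_div (x y c : R[i]) :
  ((x - y) / (c^*%C))^*%C = ((x^*%C) - (y^*%C)) / c.
Proof. by rewrite rmorphM rmorphB /= conjc_inv conjcK. Qed.

Lemma scaled_jacobian (x y A B t : R) : x = A * t -> y = B * t ->
  x ^+ 2 - y ^+ 2 = (A ^+ 2 - B ^+ 2) * t ^+ 2.
Proof. by move=> -> ->; ring. Qed.

Lemma scaled_ratio (x y A B t : R) : x = A * t -> y = B * t -> t != 0 -> x / y = A / B.
Proof. by move=> -> -> t0; rewrite -mulf_div divff // mulr1. Qed.

Lemma transform_factor (p q s d : C) : q != 0 -> s != 0 -> d != 0 ->
  p * (s / d ^+ 2) / (s * q) = p * ((d^-1 * d^-1) * q^-1).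
Proof. by move=> q0 s0 d0; field; rewrite q0 s0 d0. Qed.

Lemma transform_second (p q s b : C) : q != 0 ->
  p * (s / 1 ^+ 2) * (1^-1 * 1^-1 / q) +
  q * ((- 1 ^- 2 * b * 1^-1 + 1^-1 * (- 1 ^- 2 * b)) / q + 1^-1 * 1^-1 * 0) =
  s * p / q - (1 + 1) * b.
Proof. by move=> q0; field. Qed.

Section Transform.
Variable a : C.
Hypothesis da : disc a.
Local Notation ca := (a^*%C : C).

Definition mobius z : C := (z + a) / (1 + ca * z).

Lemma conj_sq : a * ca = ofR (modulus a ^+ 2).
Proof.
rewrite sqr_modulus; case: (a) => p q; apply: complexP;
rewrite /ofR ?cReM ?cImM /=; ring.
Qed.

Lemma mobius_den z : disc z -> 1 + ca * z != 0.
Proof.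
move=> dz; rewrite -modulus_gt0.
have : modulus (ca * z) < 1.
  rewrite modulusM modulusJ; have a0 := modulus_ge0 a; have z0 := modulus_ge0 z.
  move: da dz; rewrite /disc /= => a1 z1.
  by apply: le_lt_trans z1; rewrite ler_piMl // ltW.
have := modulusB (1 + ca * z) (ca * z); rewrite addrK modulus1.
by move=> h1 h2; lra.
Qed.

Lemma mobius_disc z : disc z -> disc (mobius z).
Proof.
move=> dz; rewrite /disc /= /mobius modulus_div ltr_pdivrMr ?modulus_gt0 ?mobius_den // mul1r.
rewrite -(ltr_pXn2r (n:=2)) ?nnegrE ?modulus_ge0 //.
rewrite -subr_gt0 (_ : _ - _ = (1 - modulus a ^+ 2) * (1 - modulus z ^+ 2)).
  have a0 := modulus_ge0 a; have z0 := modulus_ge0 z.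
  by move: da dz; rewrite /disc /= => a1 z1; rewrite mulr_gt0 // subr_gt0 expr_lt1.
rewrite !sqr_modulus; case: (a) z {dz} => p q [r s].
rewrite !(cReD, cImD, cReM, cImM) /=; ring.
Qed.

Lemma one_sub_sq_neq0 : 1 - a * ca != 0.
Proof.
rewrite conj_sq subr_eq0; apply/eqP => /(congr1 (@complex.Re R)) /= E.
have a0 := modulus_ge0 a.
have : modulus a ^+ 2 < 1 by rewrite expr_lt1.
by rewrite -E ltxx.
Qed.

Lemma mobius_inj z w : disc z -> disc w -> mobius z = mobius w -> z = w.
Proof.
move=> dz dw /eqP; rewrite /mobius eqr_div ?mobius_den // => /eqP E.
have : (z - w) * (1 - a * ca) = 0.
  by rewrite -[RHS](subrr ((w + a) * (1 + ca * z))) -{1}E; ring.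
move/eqP; rewrite mulf_eq0 (negbTE one_sub_sq_neq0) orbF subr_eq0.
by move/eqP.
Qed.

Lemma mobius0 : mobius 0 = a.
Proof. by rewrite /mobius mulr0 addr0 divr1 add0r. Qed.

Lemma den_derive z : is_derive z (1 : C) (fun z => 1 + ca * z : C) ca.
Proof. by rewrite -[X in is_derive _ _ _ X]add0r; apply: cderiveD (cderive_cst 1 z) (is_deriveZc ca z). Qed.

Lemma mobius_derive z : disc z ->
  is_derive z (1 : C) mobius ((1 - a * ca) / (1 + ca * z) ^+ 2).
Proof.
move=> dz; have n0 := mobius_den dz.
pose D z : C := 1 + ca * z.
have d1 : is_derive z (1 : C) (fun z => z + a : C) 1.
  by have := is_derive_subr (- a) z; rewrite opprK.
have := cderiveM d1 (@cderiveV D z ca n0 (den_derive z)).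
by congr is_derive; rewrite /D; field.
Qed.

Variables (K : R) (f h g : C -> C).
Hypothesis hf : class_SHK K f h g.
Let c : C := (1 - a * ca) * derive1 h a.
Let F z : C := (f (mobius z) - f a) / c.
Let H z : C := (h (mobius z) - h a) / c.
Let G z : C := (g (mobius z) - g a) / (c^*%C : C).

(** Passing to the transform composes the dilatation with the automorphism and
multiplies it by a unimodular constant, so its bound is preserved; the Jacobian
is multiplied by a positive factor. *)
Lemma koebe_transform : class_SHK K F H G.
Proof.
case: hf => [[[[ah ag] fE [h0 g0] h1] sp inj] dil].
have h'0 z : disc z -> derive1 h z != 0.
  by move=> dz; exact: jacobian_neq0 (sp z dz).
have c0 : c != 0 by rewrite mulf_neq0 ?one_sub_sq_neq0 ?h'0.
have cc0 : (c^*%C : C) != 0 by rewrite -modulus_gt0 modulusJ modulus_gt0.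
have comp k d z : analytic_on_disc k -> disc z -> is_derive z (1 : C)
    (fun z => (k (mobius z) - k a) / d)
    (derive1 k (mobius z) * ((1 - a * ca) / (1 + ca * z) ^+ 2) / d).
  move=> ak dz; have dk := derivable1_is_derive (ak _ (mobius_disc dz)).
  have := cderiveM (cderiveD (is_derive_comp (mobius_derive dz) dk) (cderive_cst (- k a) z)) (cderive_cst d^-1 z).
  by congr is_derive; rewrite mulr0 !addr0.
have dH z : disc z -> derive1 H z = derive1 h (mobius z) * ((1 - a * ca) / (1 + ca * z) ^+ 2) / c.
  by move=> dz; apply: is_derive_derive1; exact: comp.
have dG z : disc z -> derive1 G z = derive1 g (mobius z) * ((1 - a * ca) / (1 + ca * z) ^+ 2) / (c^*%C : C).
  by move=> dz; apply: is_derive_derive1; exact: comp.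
pose T z := modulus ((1 - a * ca) / (1 + ca * z) ^+ 2) / modulus c.
have T0 z : disc z -> 0 < T z.
  move=> dz; rewrite divr_gt0 // modulus_gt0 //.
  by rewrite mulf_neq0 ?one_sub_sq_neq0 // invr_neq0 // expf_neq0 // mobius_den.
have mH z : disc z -> modulus (derive1 H z) = modulus (derive1 h (mobius z)) * T z.
  by move=> dz; rewrite (dH z dz) modulus_div modulusM /T mulrA.
have mG z : disc z -> modulus (derive1 G z) = modulus (derive1 g (mobius z)) * T z.
  by move=> dz; rewrite (dG z dz) modulus_div modulusM modulusJ /T mulrA.
have D0 := disc0.
split; [split; [split|..]|].
- split=> z dz.
    by have := comp h c z ah dz => X; exact: ex_derive.
  by have := comp g (c^*%C) z ag dz => X; exact: ex_derive.
- move=> z dz; rewrite /F /H /G !fE //; last exact: mobius_disc.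
  have -> : (((g (mobius z) - g a) / (c^*%C : C))^*%C : C) =
      ((g (mobius z))^*%C - (g a)^*%C) / c :> C.
    exact: conj_div.
  by rewrite -mulrDl; congr (_ / _); ring.
- by rewrite /H /G mobius0 !subrr !mul0r.
- rewrite dH // mobius0 mulr0 addr0 expr1n divr1 /c.
  by rewrite [_ * derive1 h a]mulrC divff // mulrC.
- move=> z dz.
  rewrite /harm_jacobian (scaled_jacobian (mH z dz) (mG z dz)).
  by rewrite mulr_gt0 ?exprn_gt0 ?T0 //; exact: sp (mobius_disc dz).
- move=> z w /set_mem dz /set_mem dw; rewrite /F => /(mulIf (invr_neq0 c0)).
  move=> /addIr /inj E; apply: mobius_inj => //; apply: E; apply: mem_set; exact: mobius_disc.
- move=> z dz; rewrite /dilatation modulus_div.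
  rewrite (scaled_ratio (mG z dz) (mH z dz)) ?gt_eqF ?T0 // -modulus_div.
  exact: dil (mobius_disc dz).
Qed.

(** Through this identity a bound for the second coefficients of the whole
class becomes a bound for [h'' / h'] at an arbitrary point [a]. *)
Lemma koebe_second_coefficient :
  derive1 (derive1 H) 0 = (1 - a * ca) * derive1 (derive1 h) a / derive1 h a - (1 + 1) * ca.
Proof.
case: hf => [[[[ah ag] fE [h0 g0] h1] sp inj] dil].
have h'0 : derive1 h a != 0 := jacobian_neq0 (sp a da).
have D0 := disc0.
have c0 : c != 0 by rewrite mulf_neq0 ?one_sub_sq_neq0.
have dH z : disc z -> derive1 H z = derive1 h (mobius z) * (((1 + ca * z)^-1 * (1 + ca * z)^-1) * (derive1 h a)^-1).
  move=> dz; have dk := derivable1_is_derive (ah _ (mobius_disc dz)).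
  have := cderiveM (cderiveD (is_derive_comp (mobius_derive dz) dk) (cderive_cst (- h a) z)) (cderive_cst c^-1 z).
  move=> /is_derive_derive1 E; rewrite /H [LHS]E /c mulr0 !addr0.
  exact: (transform_factor _ h'0 one_sub_sq_neq0 (mobius_den dz)).
have n0 := mobius_den D0.
have dV := @cderiveV (fun z => 1 + ca * z) 0 ca n0 (den_derive 0).
have ma : derivable (derive1 h) (mobius 0) 1 by apply: analytic_derive1 => //; exact: mobius_disc.
have dh' := is_derive_comp (mobius_derive D0) (derivable1_is_derive ma).
have E := cderiveM dh' (cderiveM (cderiveM dV dV) (cderive_cst (derive1 h a)^-1 0)).
have agree w : modulus (w - 0) < 1 ->
    (derive1 h \o mobius) w * ((1 + ca * w)^-1 * (1 + ca * w)^-1 / derive1 h a) = derive1 H w.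
  by rewrite subr0 => dw; rewrite (dH w dw).
apply: etrans (is_derive_derive1 (eq_near_is_derive ltr01 agree E)) _.
rewrite /comp mobius0 mulr0 addr0.
exact: (transform_second _ _ _ h'0).
Qed.

End Transform.
End Koebe.

(** * The pre-Schwarzian derivative and Gronwall's inequality *)

Section Growth.
Variable R : realType.
Local Notation C := (R[i]^o).
Implicit Types (h g f : C -> C) (U V : R -> C) (z w : C).

(** The inverse of an infinite supremum is 0, so [p < 1 / alpha] with [0 < p]
makes the supremum finite; any [A] strictly between it and [1 / p] will do, and
such an [A] is positive even if the supremum vanishes. *)
Lemma alpha_lt (K p : R) : 0 < p -> (p%:E < (alpha K)^-1)%E ->
  (exists f h g : C -> C, class_SHK K f h g) ->
  exists A, [/\ 0 < A, p * A < 1 & forall f h g : C -> C, class_SHK K f h g ->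
     modulus (derive1 (derive1 h) 0 / 2) <= A].
Proof.
move=> p0; set al := alpha K => hp [f [h [g hf]]].
have le_al (f1 h1 g1 : C -> C) : class_SHK K f1 h1 g1 ->
    ((modulus (derive1 (derive1 h1) 0 / 2))%:E <= al)%E.
  by move=> h1f; apply: ereal_sup_ubound; exists f1, h1, g1.
have al0 : (0%:E <= al)%E.
  by apply: le_trans (le_al _ _ _ hf); rewrite lee_fin modulus_ge0.
have [x [alE x0 px]] : exists x, [/\ al = x%:E, 0 <= x & p * x < 1].
  move: al0 hp; case: (al) => [x||] //=.
  - rewrite lee_fin => x0; rewrite /inve; case: eqP => [->|/eqP xn0] px.
      by exists 0; rewrite mulr0 ltr01.
    exists x; split=> //; move: px; rewrite lte_fin.
    have xp : 0 < x by rewrite lt_def xn0.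
    by rewrite -[x^-1]mul1r ltr_pdivlMr.
  - by rewrite /inve lte_fin => _ /lt_trans /(_ p0); rewrite ltxx.
(* the midpoint of x and 1 / p *)
exists (x + (1 - p * x) / (2 * p)).
have d0 : 0 < (1 - p * x) / (2 * p) by rewrite divr_gt0 ?mulr_gt0 // subr_gt0.
split; first by rewrite ltr_wpDl.
- rewrite mulrDr (_ : p * ((1 - p * x) / (2 * p)) = (1 - p * x) / 2); first by lra.
  by field; rewrite gt_eqF.
- move=> f1 h1 g1 /le_al; rewrite alE lee_fin => /le_trans; apply.
  by rewrite lerDl ltW.
Qed.

Lemma pre_schwarzian (K A : R) f h g : 1 <= K ->
  (forall f h g : C -> C, class_SHK K f h g -> modulus (derive1 (derive1 h) 0 / 2) <= A) ->
  class_SHK K f h g -> forall z, disc z ->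
  (1 - modulus z ^+ 2) * modulus (derive1 (derive1 h) z) <=
  (2 * A + 2 * modulus z) * modulus (derive1 h z).
Proof.
move=> K1 HA hf a da.
have := HA _ _ _ (koebe_transform da hf).
have := congr1 (fun t : C => modulus (t / 2)) (koebe_second_coefficient da hf).
move=> -> ; rewrite modulus_div.
have h'0 : 0 < modulus (derive1 h a).
  by have [k _ /(_ a da) []] := class_SHK_dilatation K1 hf.
have -> : modulus (2 : C) = 2.
  rewrite (_ : 2 = ofR (2 : R)) ?modulus_ofR ?ger0_norm //.
  by rewrite /ofR rmorph_nat.
rewrite (ler_pdivrMr _ _ (ltr0Sn R 1)) => Hd.
have E : modulus ((1 - a * a^*%C) * derive1 (derive1 h) a / derive1 h a) <= 2 * A + 2 * modulus a.
  rewrite -[X in modulus X](subrK ((1 + 1) * (a^*%C : C))).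
  apply: le_trans (modulusD _ _) _; apply: lerD; first by rewrite [2 * A]mulrC; exact: Hd.
  rewrite modulusM modulusJ ler_wpM2r ?modulus_ge0 //.
  by apply: le_trans (modulusD _ _) _; rewrite modulus1.
clear Hd; move: E; rewrite modulus_div (ler_pdivrMr _ _ h'0) modulusM.
rewrite conj_sq (_ : modulus (1 - ofR (modulus a ^+ 2)) = 1 - modulus a ^+ 2) //.
rewrite (_ : 1 - _ = ofR (1 - modulus a ^+ 2)); last by rewrite /ofR rmorphB rmorph1.
rewrite modulus_ofR ger0_norm // subr_ge0 expr_le1 ?modulus_ge0 //.
exact: ltW.
Qed.

(** The function |V|^2 exp(-2 Psi) is nonincreasing. *)
Lemma gronwall V V' (Psi psi : R -> R) a b : a <= b ->
  (forall x, a <= x <= b -> is_velocity V x (V' x)) ->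
  (forall x, a <= x <= b -> is_derive (x : R^o) (1 : R^o) (Psi : R^o -> R^o) (psi x)) ->
  (forall x, a <= x <= b -> modulus (V' x) <= psi x * modulus (V x)) ->
  modulus (V b) <= modulus (V a) * expR (Psi b - Psi a).
Proof.
move=> ab dV dPsi HV.
pose re x : R^o := complex.Re (V x); pose im x : R^o := complex.Im (V x).
pose ex x : R^o := expR (-2 * Psi x).
pose v : R^o -> R^o := (re * re + im * im) * ex.
have vE x : v x = modulus (V x) ^+ 2 * expR (-2 * Psi x).
  by rewrite sqr_modulus !expr2.
have dv x : a <= x <= b -> is_derive (x : R^o) (1 : R^o) v
    ((2 * (complex.Re (V x) * complex.Re (V' x) + complex.Im (V x) * complex.Im (V' x))
      - 2 * psi x * modulus (V x) ^+ 2) * expR (-2 * Psi x)).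
  move=> xab; have [dr di] := dV x xab.
  have dex : is_derive (x : R^o) (1 : R^o) ex (expR (-2 * Psi x) * (-2 * psi x)).
    by apply: (is_derive1_comp (is_derive_expR _)); exact: is_deriveZ (dPsi x xab).
  have := is_deriveM (is_deriveD (is_deriveM dr dr) (is_deriveM di di)) dex.
  congr is_derive; rewrite sqr_modulus /GRing.scale /= /ex.
  rewrite [((_ + _) x)](_ : _ = complex.Re (V x) * complex.Re (V x) + complex.Im (V x) * complex.Im (V x)) //.
  ring.
have neg x : a <= x <= b -> (2 * (complex.Re (V x) * complex.Re (V' x) + complex.Im (V x) * complex.Im (V' x))
      - 2 * psi x * modulus (V x) ^+ 2) * expR (-2 * Psi x) <= 0.
  move=> xab; rewrite mulr_le0_ge0 ?expR_ge0 //.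
  have E : complex.Re (V x) * complex.Re (V' x) + complex.Im (V x) * complex.Im (V' x) =
      complex.Re ((V x)^*%C * V' x : C).
    by rewrite cReM; case: (V x) => p q /=; ring.
  have : complex.Re ((V x)^*%C * V' x : C) <= modulus (V x) * modulus (V' x).
    by apply: le_trans (ler_norm _) _; apply: le_trans (Re_le_modulus _) _; rewrite modulusM modulusJ.
  have := ler_wpM2l (modulus_ge0 (V x)) (HV x xab).
  rewrite -E expr2; move: (complex.Re _ * _ + _) => T; move: (modulus (V x)) (modulus (V' x)) (psi x) => p q r.
  by clear; nra.
have vle : v b <= v a.
  have [||x xab E] := @MVT_segment R v (fun x => (2 * (complex.Re (V x) * complex.Re (V' x) + complex.Im (V x) * complex.Im (V' x))
      - 2 * psi x * modulus (V x) ^+ 2) * expR (-2 * Psi x)) a b ab.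
  - by move=> x; rewrite in_itv /= => /andP[/ltW x1 /ltW x2]; apply: dv; rewrite x1.
  - apply: derivable_within_continuous => x; rewrite in_itv /= => xab.
    by have := dv x xab => H; exact: ex_derive.
  rewrite -subr_le0 E mulr_le0_ge0 ?subr_ge0 //; apply: neg.
  by move: xab; rewrite in_itv.
rewrite -(ler_pXn2r (n:=2)) ?nnegrE ?mulr_ge0 ?modulus_ge0 ?expR_ge0 //.
rewrite exprMn -expRM_natl -(ler_pM2r (expR_gt0 (-2 * Psi b))) -vE.
apply: le_trans vle _; rewrite vE -[leRHS]mulrA -expRD.
by rewrite (_ : _ + _ = -2 * Psi a) //; ring.
Qed.

End Growth.

(** * Growth and distortion *)

Section Distortion.
Variable R : realType.
Local Notation C := (R[i]^o).
Implicit Types (z w : C) (U V : R -> C).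

Lemma polar_unit z : exists2 e : C, modulus e = 1 & z = e * ofR (modulus z).
Proof.
have [->|z0] := eqVneq z 0.
  by exists 1; rewrite ?modulus1 // mul1r modulus0.
have rn0 : ofR (modulus z) != 0 by rewrite -modulus_eq0 modulus_ofR normr_eq0 modulus_eq0.
exists (z / ofR (modulus z)); last by rewrite divfK.
by rewrite modulus_div modulus_ofR ger0_norm ?modulus_ge0 // divff // modulus_eq0.
Qed.

Lemma is_derive_ln1B (t : R) : t < 1 ->
  is_derive (t : R^o) (1 : R^o) ((fun t => ln (1 - t)) : R^o -> R^o) (- (1 - t)^-1).
Proof.
move=> t1; have t0 : 0 < 1 - t by rewrite subr_gt0.
pose m : R^o -> R^o := fun t => 1 - t.
have d1 : is_derive (t : R^o) (1 : R^o) m (-1).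
  have := is_deriveB (is_derive_cst (1 : R^o) (t : R^o) (1 : R^o)) (is_derive_id (t : R^o) (1 : R^o)).
  by rewrite sub0r.
have := @is_derive1_comp R (@ln R) m t _ _ (is_derive1_ln t0) d1.
by rewrite mulrN1.
Qed.

Lemma expR1_le4 : expR 1 <= 4 :> R.
Proof.
have H : 1 + - (1 / 2) <= expR (- (1 / 2)) :> R := expR_ge1Dx _.
have E : expR (- (1 / 2)) * expR (- (1 / 2)) * expR 1 = 1 :> R.
  by rewrite -!expRD (_ : _ + 1 = 0) ?expR0 //; field.
have e0 : 0 < expR 1 :> R := expR_gt0 _.
have H2 : 1 / 4 <= expR (- (1 / 2)) * expR (- (1 / 2)) :> R.
  have -> : 1 / 4 = (1 + - (1 / 2)) * (1 + - (1 / 2)) :> R by field.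
  by apply: ler_pM => //; lra.
by have := ler_wpM2r (ltW e0) H2; rewrite E; lra.
Qed.
(** What the extremal problem leaves of the hypotheses: a harmonic mapping of
bounded dilatation with a bound on the pre-Schwarzian derivative of its
analytic part. *)
Variables (f h g h' g' h'' : C -> C) (k A : R).
Hypothesis dh : forall z, disc z -> is_derive z (1 : C) h (h' z).
Hypothesis dg : forall z, disc z -> is_derive z (1 : C) g (g' z).
Hypothesis dh' : forall z, disc z -> is_derive z (1 : C) h' (h'' z).
Hypothesis fE : forall z, disc z -> f z = h z + (g z)^*%C.
Hypothesis k01 : 0 <= k < 1.
Hypothesis dil : forall z, disc z ->
  0 < modulus (h' z) /\ modulus (g' z) <= k * modulus (h' z).
Hypothesis A0 : 0 < A.
Hypothesis schwarz : forall z, disc z ->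
  (1 - modulus z ^+ 2) * modulus (h'' z) <=
  (2 * A + 2 * modulus z) * modulus (h' z).

Lemma velocity_along (F F' : C -> C) z w t : disc (z + w * ofR t) ->
  (forall z, disc z -> is_derive z (1 : C) F (F' z)) ->
  is_velocity (fun t => F (z + w * ofR t)) t (F' (z + w * ofR t) * w).
Proof.
move=> dz /(_ _ dz) dF; exact: (is_velocity_comp (is_velocity_line z w t) dF).
Qed.

Lemma modulus_conj_sum (p q w : C) :
  modulus (p * w + (q * w)^*%C : C) <= modulus p * modulus w + modulus q * modulus w.
Proof. by apply: le_trans (modulusD _ _) _; rewrite modulusJ !modulusM. Qed.

Definition f_velocity z w t : C :=
  h' (z + w * ofR t) * w + (g' (z + w * ofR t) * w)^*%C.

Lemma velocity_f z w t : disc (z + w * ofR t) ->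
  is_velocity (fun t => h (z + w * ofR t) + (g (z + w * ofR t))^*%C : C) t (f_velocity z w t).
Proof.
move=> dz; apply: is_velocityD; first exact: velocity_along dh.
exact: is_velocityJ (velocity_along dz dg).
Qed.

Lemma f_velocity_le z w t : disc (z + w * ofR t) ->
  modulus (f_velocity z w t) <= 2 * modulus w * modulus (h' (z + w * ofR t)).
Proof.
move=> dz; have [h0 gh] := dil dz; case/andP: k01 => k0 k1.
apply: le_trans (modulus_conj_sum _ _ _) _.
have := ler_wpM2r (modulus_ge0 w) gh.
have := ler_wpM2r (modulus_ge0 w) (ler_wpM2r (modulus_ge0 (h' (z + w * ofR t))) (ltW k1)).
move: (modulus (h' _)) (modulus (g' _)) (modulus w) => p q r; lra.
Qed.

(** Gronwall's inequality along a radius.  The exact logarithmic derivative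
[(2 A + 2 t) / (1 - t^2)] is replaced by the larger [(A + 1) / (1 - t) + A],
whose primitive involves only [ln (1 - t)] and a bounded term. *)
Lemma h'_growth : h' 0 = 1 -> exists2 E, 0 < E & forall z, disc z ->
  modulus (h' z) <= E * expR (- (A + 1) * ln (1 - modulus z)).
Proof.
move=> h1; exists (expR A); first exact: expR_gt0.
move=> z dz; set r := modulus z.
have r0 : 0 <= r := modulus_ge0 z.
have r1 : r < 1 := dz.
have [e e1 ze] := polar_unit z.
have mt t : 0 <= t <= r -> modulus (0 + e * ofR t) = t.
  by move=> /andP[t0 _]; rewrite add0r modulusM e1 mul1r modulus_ofR ger0_norm.
have dt t : 0 <= t <= r -> disc (0 + e * ofR t).
  move=> tr; change (modulus (0 + e * ofR t) < 1); rewrite mt //.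
  by case/andP: tr => _ tr; exact: le_lt_trans r1.
pose Psi t : R := - (A + 1) * ln (1 - t) + A * t.
pose psi t : R := (A + 1) / (1 - t) + A.
have dPsi t : 0 <= t <= r -> is_derive (t : R^o) (1 : R^o) (Psi : R^o -> R^o) (psi t).
  move=> /andP[_ tr]; have t1 := le_lt_trans tr r1.
  have d2 := is_derive_ln1B t1.
  have := is_deriveD (is_deriveZ (- (A + 1)) d2) (is_deriveZ A (is_derive_id (t : R^o) (1 : R^o))).
  by congr is_derive; rewrite /psi /GRing.scale /=; field; rewrite subr_eq0 gt_eqF.
have := @gronwall R (fun t => h' (0 + e * ofR t))
  (fun t => h'' (0 + e * ofR t) * e) Psi psi 0 r r0.
have -> : 0 + e * ofR r = z by rewrite add0r ze.
have -> : 0 + e * ofR 0 = 0 by rewrite /ofR rmorph0 mulr0 addr0.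
rewrite h1 modulus1 mul1r => G.
apply: le_trans (G _ dPsi _) _.
- move=> t tr; exact: velocity_along (dt t tr) dh'.
- move=> t tr; have := schwarz (dt t tr); rewrite modulusM e1 mulr1 mt //.
  case/andP: tr => t0 tr; have t1 : t < 1 := le_lt_trans tr r1.
  have s0 : 0 < 1 - t ^+ 2 by rewrite subr_gt0 expr_lt1.
  rewrite mulrC -ler_pdivlMr // => H; apply: le_trans H _.
  rewrite -mulrA mulrC -mulrA [leRHS]mulrC ler_wpM2l ?modulus_ge0 //.
  rewrite mulrC ler_pdivrMr // /psi.
  have -> : ((A + 1) / (1 - t) + A) * (1 - t ^+ 2) = (A + 1) * (1 + t) + A * (1 - t ^+ 2).
    by field; rewrite subr_eq0 gt_eqF.
  have : 0 <= (1 - t) * (1 + A * t).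
    by rewrite mulr_ge0 ?subr_ge0 ?(ltW t1) // addr_ge0 // mulr_ge0 // ltW.
  by lra.
- rewrite -expRD ler_expR /Psi subr0 ln1 !mulr0 addr0 subr0 addrC lerD2r.
  by rewrite ler_piMr // ltW.
Qed.

Lemma f_growth : h 0 = 0 -> g 0 = 0 -> h' 0 = 1 -> exists2 C0, 0 < C0 &
  forall z, disc z -> modulus (f z) <= C0 * expR (- A * ln (1 - modulus z)).
Proof.
move=> h0 g0 h1; have [E E0 HE] := h'_growth h1.
exists (2 * E / A); first by rewrite !(mulr_gt0, invr_gt0).
move=> z dz; set r := modulus z.
have r0 : 0 <= r := modulus_ge0 z.
have r1 : r < 1 := dz.
have [e e1 ze] := polar_unit z.
have mt t : 0 <= t <= r -> modulus (0 + e * ofR t) = t.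
  by move=> /andP[t0 _]; rewrite add0r modulusM e1 mul1r modulus_ofR ger0_norm.
have dt t : 0 <= t <= r -> disc (0 + e * ofR t).
  move=> tr; change (modulus (0 + e * ofR t) < 1); rewrite mt //.
  by case/andP: tr => _ tr; exact: le_lt_trans r1.
pose phi t : R := 2 * E / A * expR (- A * ln (1 - t)).
pose phi' t : R := 2 * E * expR (- (A + 1) * ln (1 - t)).
have dphi t : 0 <= t <= r -> is_derive (t : R^o) (1 : R^o) (phi : R^o -> R^o) (phi' t).
  move=> /andP[_ tr]; have t1 := le_lt_trans tr r1.
  have t0 : 0 < 1 - t by rewrite subr_gt0.
  have d3 := is_deriveZ (- A) (is_derive_ln1B t1).
  have d4 := is_derive1_comp (is_derive_expR _) d3.
  have := is_deriveZ (2 * E / A) d4.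
  congr is_derive; rewrite /phi' /GRing.scale /=.
  rewrite (_ : - (A + 1) * ln (1 - t) = - A * ln (1 - t) - ln (1 - t)); last by ring.
  rewrite expRD expRN lnK ?posrE //.
  by field; rewrite subr_eq0 !gt_eqF.
have := @mean_value_ineq R (fun t => h (0 + e * ofR t) + (g (0 + e * ofR t))^*%C)
  (f_velocity 0 e) phi phi' 0 r r0.
have -> : 0 + e * ofR r = z by rewrite add0r ze.
have -> : 0 + e * ofR 0 = 0 by rewrite /ofR rmorph0 mulr0 addr0.
rewrite h0 g0 -fE // rmorph0 addr0 subr0 => G.
apply: le_trans (G _ dphi _) _.
- move=> t tr; exact: velocity_f (dt t tr).
- move=> t tr; apply: le_trans (f_velocity_le (dt t tr)) _.
  rewrite e1 mulr1 /phi' -mulrA ler_wpM2l //.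
  by apply: le_trans (HE _ (dt t tr)) _; rewrite mt.
- by rewrite /phi gerBl !mulr_ge0 ?expR_ge0 ?invr_ge0 // ltW.
Qed.

(** On the disc of radius [1 / L] around [z], which stays away from the unit
circle, the logarithmic derivative of [h'] is at most [L].  Along a segment
[h'] therefore grows at most by the factor [exp 1 <= 4], and its increment is
at most the integral of [L * 4 * |h'(z)|]. *)
Lemma distortion r : 0 <= r < 1 -> exists2 L, 0 < L &
  forall z w, modulus z <= r -> L * modulus (w - z) <= 1 ->
    disc w /\ modulus (h' w - h' z) <= 4 * L * modulus (w - z) * modulus (h' z).
Proof.
move=> /andP[r0 r1]; pose L := (4 * A + 4) / (1 - r).
have s0 : 0 < 1 - r by rewrite subr_gt0.
have L0 : 0 < L by rewrite divr_gt0 // ltr_wpDl // mulr_ge0 // ltW.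
exists L => // z w zr; set d := modulus (w - z) => Ld.
have d0 : 0 <= d := modulus_ge0 _.
have dr : d <= (1 - r) / 4.
  have : 4 / (1 - r) * d <= 1.
    apply: le_trans Ld; apply: ler_wpM2r => //.
    apply: ler_wpM2r; first by rewrite invr_ge0 ltW.
    by have A0' := A0; lra.
  by rewrite mulrAC ler_pdivrMr // mul1r ler_pdivlMr // mulrC.
have pt t : 0 <= t <= 1 -> modulus (z + (w - z) * ofR t) <= (1 + r) / 2.
  move=> /andP[t0 t1]; apply: le_trans (modulusD _ _) _.
  rewrite modulusM modulus_ofR ger0_norm //.
  have := ler_wpM2l d0 t1; rewrite -/d mulr1; lra.
have dpt t : 0 <= t <= 1 -> disc (z + (w - z) * ofR t).
  by move=> /pt H; apply: le_lt_trans H _; lra.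
have V1 : z + (w - z) * ofR 1 = w by rewrite /ofR rmorph1 mulr1 addrC subrK.
have V0 : z + (w - z) * ofR 0 = z by rewrite /ofR rmorph0 mulr0 addr0.
have dw : disc w by rewrite -V1; apply: dpt; rewrite ler01 lexx.
split=> //.
have vel t : 0 <= t <= 1 -> is_velocity (fun t => h' (z + (w - z) * ofR t)) t
    (h'' (z + (w - z) * ofR t) * (w - z)).
  by move=> /dpt dz; exact: velocity_along dz dh'.
have vle t : 0 <= t <= 1 -> modulus (h'' (z + (w - z) * ofR t) * (w - z)) <=
    L * d * modulus (h' (z + (w - z) * ofR t)).
  move=> tt; rewrite modulusM -/d mulrAC ler_wpM2r //.
  have := schwarz (dpt t tt); have := pt t tt.
  set m := modulus (z + _) => mr; have m0 : 0 <= m := modulus_ge0 _.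
  move: (modulus (h'' _)) (modulus (h' _)) (modulus_ge0 (h'' (z + (w - z) * ofR t))) (modulus_ge0 (h' (z + (w - z) * ofR t))) => p q p0 q0 H.
  rewrite /L mulrAC ler_pdivlMr //.
  have H1 : (1 - r) / 2 * p <= (1 - m ^+ 2) * p.
    rewrite ler_wpM2r //.
    have : m ^+ 2 <= m by rewrite expr2 ler_piMl //; lra.
    by lra.
  have H2 : (2 * A + 2 * m) * q <= (2 * A + 2) * q.
    by rewrite ler_wpM2r //; lra.
  by lra.
have grow t : 0 <= t <= 1 -> modulus (h' (z + (w - z) * ofR t)) <= modulus (h' z) * 4.
  move=> /andP[t0 t1].
  have := @gronwall R (fun t => h' (z + (w - z) * ofR t)) (fun t => h'' (z + (w - z) * ofR t) * (w - z))
    (fun t => L * d * t) (fun=> L * d) 0 t t0.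
  rewrite V0 => G; apply: le_trans (G _ _ _) _.
  - by move=> x /andP[x0 xt]; apply: vel; rewrite x0 (le_trans xt).
  - move=> x _; have := is_deriveZ (L * d) (is_derive_id (x : R^o) (1 : R^o)).
    by rewrite /GRing.scale /= mulr1.
  - by move=> x /andP[x0 xt]; apply: vle; rewrite x0 (le_trans xt).
  - rewrite ler_wpM2l ?modulus_ge0 //; apply: le_trans expR1_le4.
    rewrite ler_expR mulr0 subr0.
    have LD0 : 0 <= L * d by rewrite mulr_ge0 // ltW.
    by apply: le_trans (ler_wpM2l LD0 t1) _; rewrite mulr1.
have := @mean_value_ineq R (fun t => h' (z + (w - z) * ofR t)) (fun t => h'' (z + (w - z) * ofR t) * (w - z))
  (fun t => 4 * L * d * modulus (h' z) * t) (fun=> 4 * L * d * modulus (h' z)) 0 1 ler01 vel.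
rewrite V1 V0 mulr1 mulr0 subr0; apply.
- move=> x _; have := is_deriveZ (4 * L * d * modulus (h' z)) (is_derive_id (x : R^o) (1 : R^o)).
  by rewrite /GRing.scale /= mulr1.
- move=> t tt; apply: le_trans (vle t tt) _.
  have LD0 : 0 <= L * d by rewrite mulr_ge0 // ltW.
  by apply: le_trans (ler_wpM2l LD0 (grow t tt)) _; rewrite le_eqVlt; apply/orP; left; apply/eqP; ring.
Qed.

End Distortion.

(** * Local behaviour of harmonic quasiregular maps *)

Section Covering.
Variable R : realType.
Local Notation C := (R[i]^o).
Implicit Types (z w : C).
Variables (f h g h' g' : C -> C) (k : R).
Hypothesis dh : forall z, disc z -> is_derive z (1 : C) h (h' z).
Hypothesis dg : forall z, disc z -> is_derive z (1 : C) g (g' z).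
Hypothesis fE : forall z, disc z -> f z = h z + (g z)^*%C.
Hypothesis k01 : 0 <= k < 1.
Hypothesis dil : forall z, disc z ->
  0 < modulus (h' z) /\ modulus (g' z) <= k * modulus (h' z).

Lemma f_ccont z : disc z -> ccont f z.
Proof.
move=> dz e e0; have e2 : 0 < e / 2 by rewrite divr_gt0.
have [d1 d10 H1] := is_derive_ccont (dh dz) e2.
have [d2 d20 H2] := is_derive_ccont (dg dz) e2.
exists (Num.min (1 - modulus z) (Num.min d1 d2)).
  by rewrite !lt_min d10 d20 !andbT subr_gt0; exact: dz.
move=> w; rewrite !lt_min => /and3P[w0 w1 w2].
rewrite !fE //; last exact: disc_ball w0.
rewrite (_ : _ - _ = (h w - h z) + (g w - g z)^*%C); last by rewrite rmorphB /=; ring.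
apply: le_lt_trans (modulusD _ _) _; rewrite modulusJ [e]splitr.
by apply: ltrD; [exact: H1|exact: H2].
Qed.

Lemma f_is_velocity z w t : disc (z + w * ofR t) ->
  is_velocity (fun t => f (z + w * ofR t)) t (f_velocity h' g' z w t).
Proof.
move=> dz; have /is_velocityP V := velocity_f dh dg dz.
apply/is_velocityP => e e0; have [d d0 Hd] := V e e0.
pose M := modulus w + 1; have M0 : 0 < M by rewrite ltr_wpDl ?modulus_ge0.
exists (Num.min d ((1 - modulus (z + w * ofR t)) / M)).
  by rewrite lt_min d0 divr_gt0 // subr_gt0; exact: dz.
move=> y; rewrite lt_min ltr_pdivlMr // => /andP[y1 y2].
have dy : disc (z + w * ofR y).
  apply: (disc_ball dz); rewrite (_ : _ - _ = w * ofR (y - t)); last first.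
    by rewrite /ofR rmorphB; ring.
  rewrite modulusM modulus_ofR mulrC; apply: le_lt_trans y2.
  by rewrite ler_wpM2l // /M lerDl.
by rewrite (fE dy) (fE dz); exact: Hd.
Qed.

Section Local.
Variables (z : C) (sigma eta : R).
Hypothesis eta1 : 0 <= eta <= 1.
Hypothesis Hs : forall w, modulus (w - z) <= sigma ->
  disc w /\ modulus (h' w - h' z) <= eta * modulus (h' z).

Lemma segment_ball w t : 0 <= t <= 1 -> modulus (w - z) <= sigma ->
  modulus (z + (w - z) * ofR t - z) <= sigma.
Proof.
move=> /andP[t0 t1]; apply: le_trans; rewrite addrC addKr modulusM modulus_ofR ger0_norm //.
by rewrite ler_piMr // modulus_ge0.
Qed.

Lemma h'_le w : modulus (w - z) <= sigma -> modulus (h' w) <= (1 + eta) * modulus (h' z).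
Proof.
move=> /Hs[_ H]; have := modulusD (h' w - h' z) (h' z); rewrite subrK.
by move: (modulus (h' w)) (modulus (h' z)) (modulus (h' w - h' z)) H => p q r H; lra.
Qed.

Let id_derive (M x : R) : is_derive (x : R^o) (1 : R^o) ((fun t => M * t) : R^o -> R^o) M.
Proof.
have := is_deriveZ M (is_derive_id (x : R^o) (1 : R^o)).
by rewrite /GRing.scale /= mulr1.
Qed.

Let V1 w : z + (w - z) * ofR 1 = w.
Proof. by rewrite /ofR rmorph1 mulr1 addrC subrK. Qed.
Let V0 w : z + (w - z) * ofR 0 = z.
Proof. by rewrite /ofR rmorph0 mulr0 addr0. Qed.

Lemma f_step w : modulus (w - z) <= sigma ->
  modulus (f w - f z) <= 4 * modulus (h' z) * modulus (w - z).
Proof.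
move=> ws.
have dpt t : 0 <= t <= 1 -> disc (z + (w - z) * ofR t).
  by move=> tt; have [] := Hs (segment_ball tt ws).
have := @mean_value_ineq R (fun t => f (z + (w - z) * ofR t)) (f_velocity h' g' z (w - z))
  (fun t => 4 * modulus (h' z) * modulus (w - z) * t) (fun=> 4 * modulus (h' z) * modulus (w - z)) 0 1 ler01.
rewrite V1 V0 mulr1 mulr0 subr0; apply.
- by move=> t /dpt; exact: f_is_velocity.
- by move=> t _; exact: id_derive.
- move=> t tt; apply: le_trans (f_velocity_le k01 dil (dpt t tt)) _.
  have := h'_le (segment_ball tt ws); case/andP: eta1 => e0 e1 H.
  have X : modulus (h' (z + (w - z) * ofR t)) <= 2 * modulus (h' z).
    apply: le_trans H _; rewrite ler_wpM2r ?modulus_ge0 //; lra.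
  have := ler_wpM2r (modulus_ge0 (w - z)) X.
  by move: (modulus (h' _)) (modulus (h' z)) (modulus (w - z)) => p q r; lra.
Qed.

(** The analytic part of the increment differs from [h'(z) (w - z)] by at most
the proportion [eta], and the antianalytic part has at most [k (1 + eta)] times
its size. *)
Lemma f_expansion w : modulus (w - z) <= sigma ->
  (1 - k - 2 * eta) * modulus (h' z) * modulus (w - z) <= modulus (f w - f z).
Proof.
move=> ws; case/andP: k01 => k0 k1; case/andP: eta1 => e0 e1.
have dpt t : 0 <= t <= 1 -> disc (z + (w - z) * ofR t).
  by move=> tt; have [] := Hs (segment_ball tt ws).
have dz : disc z by rewrite -(V0 w); apply: dpt; rewrite lexx ler01.
have dw : disc w by rewrite -(V1 w); apply: dpt; rewrite lexx ler01.
have Hh : modulus (h w - h z - h' z * (w - z)) <= eta * modulus (h' z) * modulus (w - z).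
  pose U t : C := h (z + (w - z) * ofR t) + (- h' z * (w - z)) * ofR t.
  have U1 : U 1 - U 0 = h w - h z - h' z * (w - z).
    by rewrite /U V1 V0 /ofR rmorph0 rmorph1; ring.
  rewrite -U1.
  have -> : eta * modulus (h' z) * modulus (w - z) =
      eta * modulus (h' z) * modulus (w - z) * 1 - eta * modulus (h' z) * modulus (w - z) * 0.
    by rewrite mulr1 mulr0 subr0.
  apply: (@mean_value_ineq R U (fun t => h' (z + (w - z) * ofR t) * (w - z) + (- h' z * (w - z)) * 1)
    (fun t => eta * modulus (h' z) * modulus (w - z) * t) (fun=> eta * modulus (h' z) * modulus (w - z)) 0 1 ler01).
  - move=> t tt; apply: is_velocityD; first exact: velocity_along (dpt t tt) dh.
    exact: is_velocityZ (is_derive_ofR t).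
  - by move=> t _; exact: id_derive.
  - move=> t tt; rewrite mulr1 -mulrDl modulusM ler_wpM2r ?modulus_ge0 //.
    by have [] := Hs (segment_ball tt ws).
have Hg : modulus (g w - g z) <= k * ((1 + eta) * modulus (h' z)) * modulus (w - z).
  have := @mean_value_ineq R (fun t => g (z + (w - z) * ofR t)) (fun t => g' (z + (w - z) * ofR t) * (w - z))
    (fun t => k * ((1 + eta) * modulus (h' z)) * modulus (w - z) * t)
    (fun=> k * ((1 + eta) * modulus (h' z)) * modulus (w - z)) 0 1 ler01.
  rewrite V1 V0 mulr1 mulr0 subr0; apply.
  - by move=> t tt; exact: velocity_along (dpt t tt) dg.
  - by move=> t _; exact: id_derive.
  - move=> t tt; rewrite modulusM ler_wpM2r ?modulus_ge0 //.
    have [_ H] := dil (dpt t tt); apply: le_trans H _.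
    by rewrite ler_wpM2l //; exact: h'_le (segment_ball tt ws).
have E1 := modulus_lB (h' z * (w - z)) (- (h w - h z - h' z * (w - z))).
have xr : h' z * (w - z) - - (h w - h z - h' z * (w - z)) = h w - h z by ring.
rewrite xr modulusN modulusM in E1.
have E2 := modulus_lB (h w - h z) (- (g w - g z)^*%C).
rewrite modulusN opprK modulusJ in E2.

rewrite (fE dw) (fE dz).
have -> : h w + (g w)^*%C - (h z + (g z)^*%C) = h w - h z + (g w - g z)^*%C :> C.
  by rewrite rmorphB /=; ring.
have P0 : 0 <= modulus (h' z) * modulus (w - z) by rewrite mulr_ge0 ?modulus_ge0.
have ke : k * eta * (modulus (h' z) * modulus (w - z)) <= eta * (modulus (h' z) * modulus (w - z)).
  by rewrite ler_wpM2r // ler_piMl // ltW.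
move: Hh Hg E1 E2 P0 ke.
move: (modulus (h w - h z + _)) (modulus (h w - h z)) (modulus (g w - g z)) (modulus (h w - h z - _)) (modulus (h' z)) (modulus (w - z)) => a b c d p q.
by lra.
Qed.

(** A point close to [f z] but missed by [f] would give a nonzero minimum of
its distance to the values of [f] on a square around [z]: not on the boundary,
where [f] is far from [f z], and not inside, where the differential of [f] is
onto. *)
Lemma f_covering (s : R) (w0 : C) : 0 < s -> 2 * s <= sigma -> 2 * eta <= (1 - k) / 2 ->
  modulus (w0 - f z) < (1 - k) / 4 * modulus (h' z) * s ->
  exists2 w, modulus (w - z) <= 2 * s & f w = w0.
Proof.
move=> s0 s2 etak; case/andP: k01 => k0 k1.
case E : z => [u v].
have sq (x y : R) : u - s <= x <= u + s -> v - s <= y <= v + s ->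
    modulus (Complex x y - z) <= 2 * s.
  move=> xu yv; rewrite E; apply: le_trans (modulus_le_ReIm _) _.
  rewrite cReD cImD cReN cImN /= mulr2n mulrDl mul1r.
  by apply: lerD; rewrite ler_norml; apply/andP; split; lra.
rewrite -E => near0.
pose phi (p : R * R) : R := modulus (f (Complex p.1 p.2) - w0).
pose Q : set (R * R) := `[u - s, u + s] `*` `[v - s, v + s].
have Qsq p : Q p -> modulus (Complex p.1 p.2 - z) <= 2 * s.
  by case: p => x y [] /=; rewrite !in_itv /=; exact: sq.
have Qd p : Q p -> disc (Complex p.1 p.2 : C).
  by move=> /Qsq H; have [] := Hs (le_trans H s2).
have [|||c cQ cmin] := @compact_EVT_min (R * R)%type R phi Q.
- by exists (u, v); split; rewrite /= in_itv /=; apply/andP; split; lra.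
- by apply: compact_setX; exact: segment_compact.
- apply: continuous_in_subspaceT => p /set_mem pQ.
  apply/cvgrPdist_le => e e0.
  have [d d0 Hd] := f_ccont (Qd p pQ) e0.
  exists (ball p.1 (d / 2), ball p.2 (d / 2)).
    by split; apply: nbhsx_ballx; rewrite divr_gt0.
  case=> x y [/= b1 b2]; rewrite /ball /= in b1 b2.
  have close : modulus (Complex x y - Complex p.1 p.2 : C) < d.
    apply: le_lt_trans (modulus_le_ReIm _) _; rewrite cReD cImD cReN cImN /= [d]splitr.
    by apply: ltrD; rewrite distrC.
  have H := Hd _ close.
  rewrite /phi /=; apply/ltW; apply: le_lt_trans H.
  have t1 := modulus_lB (f (Complex x y) - w0) (f (Complex p.1 p.2) - w0).
  have t2 := modulus_lB (f (Complex p.1 p.2) - w0) (f (Complex x y) - w0).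
  have e1 : f (Complex x y) - w0 - (f (Complex p.1 p.2) - w0) = f (Complex x y) - f (Complex p.1 p.2) by ring.
  have e2 : f (Complex p.1 p.2) - w0 - (f (Complex x y) - w0) = - (f (Complex x y) - f (Complex p.1 p.2)) by ring.
  rewrite e1 in t1; rewrite e2 modulusN in t2.
  by rewrite ler_norml; apply/andP; split; lra.
have {}cQ : Q c := set_mem cQ.
set w : C := Complex c.1 c.2.
have dw : disc w := Qd c cQ.
have ws : modulus (w - z) <= sigma := le_trans (Qsq c cQ) s2.
exists w; first exact: Qsq.
have cmin' x y : u - s <= x <= u + s -> v - s <= y <= v + s ->
    modulus (f w - w0) <= modulus (f (Complex x y) - w0).
  by move=> xu yv; apply: (cmin (x, y)); apply: mem_set; split; rewrite /= in_itv.
have small : modulus (f w - w0) < (1 - k) / 4 * modulus (h' z) * s.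
  apply: le_lt_trans near0; rewrite [leRHS]modulus_distC.
  have := cmin' u v; rewrite -E; apply; apply/andP; split; lra.
have hz : 0 <= modulus (h' z) := modulus_ge0 _.
have inside : modulus (w - z) < s.
  rewrite ltNge; apply/negP => sw.
  have X := f_expansion ws.
  have tri : modulus (f w - f z) <= modulus (f w - w0) + modulus (w0 - f z).
    by apply: le_trans (modulusD _ _); rewrite addrA subrK.
  have : (1 - k) / 2 * modulus (h' z) * s <= (1 - k - 2 * eta) * modulus (h' z) * modulus (w - z).
    apply: ler_pM => //; [by rewrite mulr_ge0 //; lra|exact: ltW|].
    by apply: ler_wpM2r => //; lra.
  by move: small near0 tri X; move: (modulus (h' z)) => m; lra.
apply/eqP; rewrite -subr_eq0 -modulus_eq0; apply/negPn/negP => vn0.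
set vv := f w - w0 in vn0.
have v0 : 0 < modulus vv by rewrite lt_def vn0 modulus_ge0.
have [h'w g'w] := dil dw.
have h'wn0 : h' w != 0 by rewrite -modulus_gt0.
(* the direction in which the analytic part of the differential points at w0 *)
pose ze : C := - vv / h' w.
have wt0 : w + ze * ofR 0 = w by rewrite /ofR rmorph0 mulr0 addr0.
have dw0 : disc (w + ze * ofR 0) by rewrite wt0.
have e0 : 0 < (1 - k) * modulus vv / 2 by rewrite divr_gt0 // mulr_gt0 // subr_gt0.
have /is_velocityP /(_ _ e0) [d d0 Hd] := f_is_velocity dw0.
pose M := modulus ze + 1; have M0 : 0 < M by rewrite ltr_wpDl ?modulus_ge0.
pose t := Num.min (Num.min 1 (d / 2)) ((s - modulus (w - z)) / M).
have t0 : 0 < t by rewrite !lt_min ltr01 !divr_gt0 // subr_gt0.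
have : t <= t by []; rewrite {2}/t !le_min !ler_pdivlMr // => /andP[/andP[t1 td] ts].
have td' : t < d by lra.
have := Hd t; rewrite subr0 gtr0_norm // => /(_ td').
rewrite wt0 /f_velocity wt0.
set y := w + ze * ofR t => Hy.
have yz : modulus (y - z) <= s.
  rewrite /y addrAC; apply: le_trans (modulusD _ _) _.
  rewrite modulusM modulus_ofR gtr0_norm //.
  have : modulus ze * t <= t * M by rewrite mulrC ler_wpM2l ?ltW // /M ltrDl.
  by lra.
have My : modulus vv <= modulus (f y - w0).
  have yR := le_trans (Re_le_modulus _) yz; have yI := le_trans (Im_le_modulus _) yz.
  move: yR yI; rewrite E; case: (y) => p q; rewrite cReD cImD cReN cImN /= !ler_norml => yR yI.
  by apply: cmin'; lra.
have key : f y - w0 = (f y - f w - (h' w * ze + (g' w * ze)^*%C) * ofR t) +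
   (vv * ofR (1 - t) + (g' w * ze)^*%C * ofR t).
  rewrite (_ : h' w * ze = - vv); last by rewrite /ze mulrC divfK.
  by rewrite /vv /ofR rmorphB rmorph1; ring.
have : modulus (f y - w0) <= (1 - k) * modulus vv / 2 * t + (modulus vv * (1 - t) + k * modulus vv * t).
  rewrite key; apply: le_trans (modulusD _ _) _; apply: lerD; first exact: Hy.
  apply: le_trans (modulusD _ _) _; rewrite !modulusM !modulus_ofR modulusJ.
  rewrite (gtr0_norm t0) ger0_norm ?subr_ge0 // lerD2l ler_wpM2r ?(ltW t0) //.
  rewrite modulusM /ze modulus_div modulusN.
  have : modulus (g' w) * (modulus vv / modulus (h' w)) <= k * modulus (h' w) * (modulus vv / modulus (h' w)).
    by apply: ler_wpM2r g'w; rewrite divr_ge0 ?modulus_ge0.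
  move=> /le_trans; apply; rewrite le_eqVlt; apply/orP; left; apply/eqP.
  by field; rewrite gt_eqF.
move=> fin; have := le_trans My fin.
have kv : 0 < (1 - k) * modulus vv * t by rewrite !mulr_gt0 // subr_gt0.
by move: kv; move: (modulus vv) => m; lra.
Qed.

End Local.
End Covering.

(** * Packing of squares *)

Section Packing.
Variable R : realType.

Let mu2 : {measure set (measurableTypeR R * measurableTypeR R) -> \bar R} :=
  (@lebesgue_measure R \x @lebesgue_measure R)%E.

Definition square (x y s : R) : set (measurableTypeR R * measurableTypeR R) :=
  `[x - s, x + s]%classic `*` `[y - s, y + s]%classic.

Lemma measurable_square x y s : measurable (square x y s).
Proof. by apply: measurableX; exact: measurable_itv. Qed.

Lemma area_square x y s : 0 < s -> mu2 (square x y s) = ((2 * s) ^+ 2)%:E.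
Proof.
move=> s0; apply: etrans (product_measure1E _ _ _ _) _; [exact: measurable_itv|exact: measurable_itv|].
have len (z : R) : @lebesgue_measure R `[z - s, z + s]%classic = (2 * s)%:E.
  rewrite lebesgue_measure_itv /= lte_fin ifT; last by lra.
  by rewrite -EFinD; congr EFin; ring.
transitivity ((2 * s)%:E * (2 * s)%:E)%E; last by rewrite -EFinM expr2.
by congr (_ * _)%E; exact: len.
Qed.

(** The planar Lebesgue measure of the union of the squares is the sum of
their areas. *)
Lemma square_packing (I : finType) (P : pred I) (x y s : I -> R) (S : R) :
  0 < S -> (forall i, P i -> 0 < s i) ->
  (forall i, P i -> `|x i| + s i <= S /\ `|y i| + s i <= S) ->
  (forall i j, P i -> P j -> i != j -> forall u v : R,
     ~ ([/\ `|u - x i| <= s i, `|v - y i| <= s i, `|u - x j| <= s j & `|v - y j| <= s j])) ->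
  \sum_(i | P i) (2 * s i) ^+ 2 <= (2 * S) ^+ 2.
Proof.
move=> S0 s0 inS dis.
pose F i := square (x i) (y i) (s i).
have inF i u v : F i (u, v) -> `|u - x i| <= s i /\ `|v - y i| <= s i.
  move=> [] /=; rewrite !in_itv /= => /andP[u1 u2] /andP[v1 v2].
  by split; rewrite ler_norml; apply/andP; split; lra.
have add (r : seq I) : uniq r -> all P r ->
    [/\ measurable (\big[setU/set0]_(i <- r) F i) &
     mu2 (\big[setU/set0]_(i <- r) F i) = (\sum_(i <- r) (2 * s i) ^+ 2)%:E].
  elim: r => [|i r IH] /=; first by rewrite !big_nil; split; [exact: measurable0|rewrite measure0].
  move=> /andP[ir ur] /andP[Pi Pr]; have [mr E] := IH ur Pr; rewrite !big_cons.
  split; first by apply: measurableU => //; exact: measurable_square.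
  set B := \big[setU/set0]_(j <- r) F j.
  have -> : mu2 (F i `|` B) = (mu2 (F i) + mu2 B)%E.
    apply: measureU => //; first exact: measurable_square.
    rewrite -subset0 => -[u v] [/inF[u1 v1]].
    rewrite /B -bigcup_seq => -[j /= jr /inF[u2 v2]].
    apply: (dis i j Pi _ _ u v); [exact: (allP Pr)| |by split].
    by apply: contraNneq ir => ->.
  by rewrite E [X in (X + _)%E](area_square _ _ (s0 i Pi)) -EFinD.
rewrite -big_filter; set r := [seq i <- _ | P i].
have [||mr E] := add r.
- by rewrite filter_uniq // index_enum_uniq.
- exact: filter_all.
rewrite -lee_fin -E -(area_square 0 0 S0).
apply: le_measure; rewrite ?inE //; first exact: measurable_square.
rewrite -bigcup_seq => -[u v] [i /= ir /inF[u1 v1]].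
have Pi : P i by move: ir; rewrite mem_filter => /andP[].
have [X Y] := inS i Pi.
move: u1 v1 X Y; rewrite /square /= !ler_norml => /andP[? ?] /andP[? ?] X Y.
have := ler_norm (x i); have := ler_norm (- x i); have := ler_norm (y i); have := ler_norm (- y i).
rewrite !normrN => *; split; rewrite /= in_itv /=; apply/andP; split; lra.
Qed.

End Packing.

(** * Polar grids *)

Section Grid.
Variable R : realType.
Local Notation C := (R[i]^o).

Lemma modulus_circle_point (r th : R) : modulus (circle_point r th : C) = `|r|.
Proof. by rewrite /modulus /= !exprMn -mulrDr cos2Dsin2 mulr1 sqrtr_sqr. Qed.

Lemma circle_pointB (r r' th : R) :
  (circle_point r th : C) - (circle_point r' th : C) = circle_point (r - r') th.
Proof. by apply: complexP; rewrite ?cReD ?cImD ?cReN ?cImN /= mulrBl. Qed.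

Lemma natr_dist (N a b : nat) : (a < N)%N -> (b < N)%N -> a != b ->
  1 <= `|a%:R - b%:R : R| <= N%:R.
Proof.
wlog ab : a b / (a < b)%N => [H aN bN ab|aN bN _].
  have [ltab|ltba|E] := ltngtP a b; last by rewrite E eqxx in ab.
    exact: H.
  by rewrite distrC; apply: H => //; rewrite eq_sym.
rewrite distrC -natrB ?(ltnW ab) // normr_nat ler1n subn_gt0 ab ler_nat.
exact: leq_trans (leq_subr _ _) (ltnW bN).
Qed.

Lemma sin_le (x : R) : 0 <= x -> sin x <= x.
Proof.
move=> x0.
have [|y _] := @MVT_segment R sin cos 0 x x0.
  by apply: continuous_subspaceT => y; exact: continuous_sin.
by rewrite sin0 !subr0 => ->; rewrite ler_piMl // cos_le1.
Qed.

Lemma cos_ge_half (x : R) : 0 <= x <= 1 -> 1 / 2 <= cos x.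
Proof.
move=> /andP[x0 x1].
have -> : cos x = 1 - 2 * sin (x / 2) ^+ 2.
  by rewrite {1}[x]splitr -(mulr2n (x / 2)) cos_mulr2n cos2sin2; ring.
have h0 : 0 <= x / 2 by lra.
have s1 := sin_le h0.
have s2 : - (x / 2) <= sin (x / 2).
  have [|y _] := @MVT_segment R sin cos 0 (x / 2) h0.
    by apply: continuous_subspaceT => y; exact: continuous_sin.
  rewrite sin0 !subr0 => ->; have := cos_geN1 y; nra.
have : sin (x / 2) ^+ 2 <= (1 / 2) ^+ 2.
  have half0 : 0 <= 1 / 2 :> R by lra.
  rewrite -[leLHS]real_normK ?num_real // ler_pXn2r ?nnegrE ?normr_ge0 //.
  by rewrite ler_norml; apply/andP; split; lra.
rewrite (_ : (1 / 2) ^+ 2 = 1 / 4 :> R); last by field.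
by move: (sin (x / 2) ^+ 2) => q H; lra.
Qed.

Lemma sin_ge_half (x : R) : 0 <= x <= 1 -> x / 2 <= sin x.
Proof.
move=> /andP[x0 x1].
have [|y yx] := @MVT_segment R sin cos 0 x x0.
  by apply: continuous_subspaceT => y; exact: continuous_sin.
rewrite sin0 !subr0 => ->; rewrite mulrC ler_wpM2r //.
rewrite -[2^-1]mul1r; apply: cos_ge_half.
by move: yx; rewrite in_itv /= => /andP[y0 yx]; rewrite y0 (le_trans yx).
Qed.

(** After a rotation by [- th] the second point lies on the real axis and the
first one at height [r' * sin (th' - th)]. *)
Lemma circle_point_distance (r r' th th' : R) : 0 <= r' -> `|th' - th| <= 1 ->
  r' * (`|th' - th| / 2) <= modulus (circle_point r' th' - circle_point r th : C).
Proof.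
move=> r0 thth.
have sinabs : `|th' - th| / 2 <= `|sin (th' - th)|.
  move: (th' - th) thth => x.
  have [d0|d0] := leP 0 x.
    rewrite (ger0_norm d0) => d1; apply: le_trans (ler_norm _).
    by apply: sin_ge_half; rewrite d0.
  rewrite (ltr0_norm d0) => d1; rewrite -normrN -sinN; apply: le_trans (ler_norm _).
  by apply: sin_ge_half; rewrite d1 oppr_ge0 ltW.
apply: le_trans (ler_wpM2l r0 sinabs) _.
have -> : modulus (circle_point r' th' - circle_point r th : C) =
    modulus (circle_point 1 (- th) * (circle_point r' th' - circle_point r th) : C).
  by rewrite modulusM modulus_circle_point normr1 mul1r.
apply: le_trans (Im_le_modulus _); rewrite -{1}(ger0_norm r0) -normrM.
rewrite le_eqVlt; apply/orP; left; apply/eqP; congr (`|_|).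
rewrite cImM cReD cImD cReN cImN /= cosN sinN sinB; ring.
Qed.

(** The sequence truncated at [2 t] drops by at least [t].  As no step exceeds
[t], a step that starts above [3 t] does not move the truncated sequence. *)
Lemma crossing_sum (X d : nat -> R) (m : nat) (t : R) : 2 * t < X 0%N -> X m <= t ->
  (forall j, (j < m)%N -> `|X j.+1 - X j| <= d j /\ d j <= t) ->
  t <= \sum_(j < m | X j <= 3 * t) d j.
Proof.
move=> X0 Xm Hd; pose Y j := Num.min (X j) (2 * t).
have tele n : (n <= m)%N -> Y 0%N - Y n <= \sum_(j < n | X j <= 3 * t) d j.
  elim: n => [|n IH] nm; first by rewrite big_ord0 subrr.
  have := IH (ltnW nm); have [dn dt] := Hd n nm.
  rewrite [in X in _ -> X](big_mkcond) big_ord_recr -big_mkcond /= => IHn.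
  suff : Y n - Y n.+1 <= if X n <= 3 * t then d n else 0 by lra.
  move: dn; rewrite ler_norml => /andP[d1 d2]; rewrite /Y.
  have d0 : 0 <= d n by lra.
  by case: (leP (X n) (3 * t)); case: (ltP (X n) (2 * t)); case: (ltP (X n.+1) (2 * t)) => *; lra.
have := tele m (leqnn m); rewrite /Y min_r; last exact: ltW.
by case: (ltP (X m) (2 * t)); lra.
Qed.

(** The Cauchy-Schwarz inequality, by summing
[(t / m - d j)^2 * m / (2 t) >= 0]. *)
Lemma sum_sq_ge (m : nat) (P : pred 'I_m) (d : 'I_m -> R) (t : R) : 0 < t ->
  t <= \sum_(j | P j) d j -> t ^+ 2 <= m%:R * \sum_(j | P j) d j ^+ 2.
Proof.
move=> t0 H.
case: m P d H => [|m] P d H.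
  by move: H; rewrite big_ord0 => /(lt_le_trans t0); rewrite ltxx.
pose n : R := m.+1%:R; have n0 : 0 < n by rewrite ltr0n.
have : \sum_(j | P j) d j <= \sum_(j | P j) (t / (2 * n) + d j ^+ 2 * (n / (2 * t))).
  apply: ler_sum => j _.
  have E : (t / n - d j) ^+ 2 * (n / (2 * t)) = t / (2 * n) + d j ^+ 2 * (n / (2 * t)) - d j.
    by field; rewrite !gt_eqF.
  have : 0 <= (t / n - d j) ^+ 2 * (n / (2 * t)).
    by rewrite mulr_ge0 ?sqr_ge0 // divr_ge0 ?ltW // mulr_gt0.
  by rewrite E subr_ge0.
rewrite big_split /= -[X in _ <= _ + X]mulr_suml => H2.
have H3 : \sum_(j | P j) t / (2 * n) <= t / 2.
  rewrite sumr_const -[leRHS](_ : t / (2 * n) *+ m.+1 = _).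
    apply: ler_wpMn2l; first by rewrite divr_ge0 ?ltW // mulr_gt0.
    by rewrite -[X in (_ <= X)%N](card_ord m.+1) max_card.
  by rewrite -mulr_natr -/n; field; rewrite gt_eqF.
have H4 : t / 2 <= (\sum_(j | P j) d j ^+ 2) * (n / (2 * t)) by lra.
have := ler_wpM2r (ltW (mulr_gt0 (ltr0Sn R 1) t0)) H4.
rewrite (_ : t / 2 * (2 * t) = t ^+ 2); last by field.
rewrite (_ : _ * (n / (2 * t)) * (2 * t) = n * \sum_(j | P j) d j ^+ 2) //.
by field; rewrite gt_eqF.
Qed.

End Grid.

(** * The length-area argument *)

Section LengthArea.
Variable R : realType.
Local Notation C := (R[i]^o).
Implicit Types (z w : C) (r t tau th : R).
Variables (f h g h' g' h'' : C -> C) (k A : R).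
Hypothesis dh : forall z, disc z -> is_derive z (1 : C) h (h' z).
Hypothesis dg : forall z, disc z -> is_derive z (1 : C) g (g' z).
Hypothesis dh' : forall z, disc z -> is_derive z (1 : C) h' (h'' z).
Hypothesis fE : forall z, disc z -> f z = h z + (g z)^*%C.
Hypothesis k01 : 0 <= k < 1.
Hypothesis dil : forall z, disc z ->
  0 < modulus (h' z) /\ modulus (g' z) <= k * modulus (h' z).
Hypothesis A0 : 0 < A.
Hypothesis schwarz : forall z, disc z ->
  (1 - modulus z ^+ 2) * modulus (h'' z) <=
  (2 * A + 2 * modulus z) * modulus (h' z).
Hypothesis h'1 : h' 0 = 1.
Hypothesis finj : forall z w, disc z -> disc w -> f z = f w -> z = w.

(** How fine the grid must be depends on [r].  This is harmless, as the
constants of the estimates that follow do not. *)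
Lemma uniform_scale r : 0 <= r < 1 -> exists2 N0 : nat, (4 <= N0)%N &
  forall (N : nat), (N0 <= N)%N -> forall z, modulus z <= r ->
    4 * modulus (h' z) <= N%:R /\
    forall w, modulus (w - z) <= N%:R^-1 ->
      disc w /\ modulus (h' w - h' z) <= (1 - k) / 4 * modulus (h' z).
Proof.
move=> r01; case/andP: (r01) => r0 r1; case/andP: (k01) => k0 k1.
have [L L0 HL] := distortion dh' A0 schwarz r01.
have [E E0 HE] := h'_growth dh' A0 schwarz h'1.
pose M := E * expR (- (A + 1) * ln (1 - r)).
have M0 : 0 <= M by rewrite mulr_ge0 ?expR_ge0 // ltW.
have HM z : modulus z <= r -> modulus (h' z) <= M.
  move=> zr; have dz : disc z := le_lt_trans zr r1.
  apply: le_trans (HE z dz) _; rewrite /M ler_wpM2l ?(ltW E0) // ler_expR.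
  rewrite !mulNr lerN2 ler_wpM2l ?addr_ge0 ?ler01 ?(ltW A0) //.
  by rewrite ler_ln ?posrE ?subr_gt0 // lerD2l lerN2.
pose B := 16 * L / (1 - k) + L + 4 * M.
have k2 : 0 < 1 - k by rewrite subr_gt0.
have b1 : 0 <= 16 * L / (1 - k) by rewrite divr_ge0 ?ltW // mulr_gt0.
have B0 : 0 <= B by rewrite /B; lra.
exists (Num.bound B + 4)%N; first by rewrite leq_addl.
move=> N; set n := N%:R => NN z zr.
have Bn : B <= n.
  apply: le_trans (ltW (archi_boundP B0)) _; rewrite ler_nat.
  by apply: leq_trans NN; rewrite leq_addr.
have n0 : 0 < n by rewrite ltr0n; apply: leq_trans NN; rewrite addn4.
split.
  by have := HM z zr; move: Bn; rewrite /B; lra.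
move=> w wz.
have Lw : L * modulus (w - z) <= L / n by rewrite ler_wpM2l // ltW.
have Ln : L / n <= 1 by rewrite ler_pdivrMr // mul1r; move: Bn; rewrite /B; lra.
have [dw H] := HL z w zr (le_trans Lw Ln).
split=> //; apply: le_trans H _; rewrite ler_wpM2r ?modulus_ge0 //.
have : L / n <= (1 - k) / 16.
  rewrite ler_pdivrMr // -ler_pdivrMl; last by rewrite divr_gt0.
  rewrite (_ : ((1 - k) / 16)^-1 * L = 16 * L / (1 - k)).
    by move: Bn; rewrite /B; lra.
  by field; rewrite gt_eqF.
by lra.
Qed.

(** A discrete substitute for the area of the image of an injective map: small
discs around separated points are disjoint, so are their images, and these
contain squares of side proportional to [|h'| / n], all of them in the square
of half-side [4 S]. *)
Lemma derivative_square_sum : exists2 c : R, 0 < c &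
  forall (I : finType) (P : pred I) (Z : I -> C) (n S : R), 0 < n -> 1 <= S ->
  (forall i, P i -> [/\ 4 * modulus (h' (Z i)) <= n, modulus (f (Z i)) <= 3 * S &
     forall w, modulus (w - Z i) <= n^-1 ->
      disc w /\ modulus (h' w - h' (Z i)) <= (1 - k) / 4 * modulus (h' (Z i))]) ->
  (forall i j, P i -> P j -> i != j -> (4 * n)^-1 <= modulus (Z i - Z j)) ->
  \sum_(i | P i) modulus (h' (Z i)) ^+ 2 <= (c * n * S) ^+ 2.
Proof.
case/andP: (k01) => k0 k1.
have k2 : 0 < 1 - k by rewrite subr_gt0.
exists (8 * 16 * 10 / (1 - k)); first by rewrite divr_gt0 // !mulr_gt0 ?ltr0n.
move=> I P Z n S n0 S1 HP sep.
(* discs of radius 2 s = 1 / (10 n) around points at distance at least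
   1 / (4 n) are disjoint *)
pose s := (20 * n)^-1.
have s0 : 0 < s by rewrite invr_gt0 mulr_gt0.
have ninv : 0 < n^-1 by rewrite invr_gt0.
have sn : s = n^-1 / 20 by rewrite /s; field; rewrite gt_eqF.
have sn4 : (4 * n)^-1 = n^-1 / 4 by field; rewrite gt_eqF.
(* half-side of a square inscribed in the disc covered by the image *)
pose q i := (1 - k) / 16 * modulus (h' (Z i)) * s.
have zz i : P i -> modulus (Z i - Z i) <= n^-1 by move=> _; rewrite subrr modulus0 ltW.
have dZ i : P i -> disc (Z i).
  by move=> Pi; have [_ _ H] := HP i Pi; have [] := H _ (zz i Pi).
have q0 i : P i -> 0 < q i.
  by move=> /dZ /dil[h0 _]; rewrite /q !mulr_gt0 // invr_gt0.
have cov i u v : P i -> `|u - complex.Re (f (Z i))| <= q i ->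
    `|v - complex.Im (f (Z i))| <= q i ->
    exists2 w, modulus (w - Z i) <= 2 * s & f w = Complex u v.
  move=> Pi ui vi; have [_ _ Hi] := HP i Pi.
  apply: (f_covering dh dg fE k01 dil (sigma := n^-1) (eta := (1 - k) / 4)) => //.
  - by apply/andP; split; lra.
  - by rewrite sn; lra.
  - by lra.
  - apply: (@le_lt_trans _ _ (q i + q i)).
      apply: le_trans (modulus_le_ReIm _) _; rewrite cReD cImD cReN cImN /=.
      exact: lerD.
    rewrite (_ : (1 - k) / 4 * modulus (h' (Z i)) * s = 4 * q i); last first.
      by rewrite /q; field.
    by have := q0 i Pi; lra.
have := @square_packing R I P (fun i => complex.Re (f (Z i))) (fun i => complex.Im (f (Z i))) q (4 * S).
have S0 : 0 < 4 * S by lra.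
move=> /(_ S0 q0) H.
have {H} : \sum_(i | P i) (2 * q i) ^+ 2 <= (2 * (4 * S)) ^+ 2.
  apply: H.
  - move=> i Pi; have [h4 fS _] := HP i Pi.
    have qS : q i <= S.
      have : modulus (h' (Z i)) * n^-1 <= 1.
        by rewrite ler_pdivrMr // mul1r; have := modulus_ge0 (h' (Z i)); lra.
      have m0 := modulus_ge0 (h' (Z i)).
      have p0 : 0 <= modulus (h' (Z i)) * n^-1 by rewrite mulr_ge0 // ltW.
      rewrite /q sn; have -> : (1 - k) / 16 * modulus (h' (Z i)) * (n^-1 / 20) =
        (1 - k) * (modulus (h' (Z i)) * n^-1) / 320 by field; rewrite gt_eqF.
      move: p0; move: (modulus (h' (Z i)) * n^-1) => p p0 p1.
      have kp : (1 - k) * p <= p by rewrite ler_piMl //; lra.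
      by lra.
    have R1 := le_trans (Re_le_modulus _) fS; have I1 := le_trans (Im_le_modulus _) fS.
    by split; lra.
  - move=> i j Pi Pj ij u v [u1 v1 u2 v2].
    have [w w1 fw] := cov i u v Pi u1 v1; have [w' w'1 fw'] := cov j u v Pj u2 v2.
    have s2 : 2 * s <= n^-1 by rewrite sn; lra.
    have [_ _ Hi] := HP i Pi; have [_ _ Hj] := HP j Pj.
    have [dw _] := Hi w (le_trans w1 s2); have [dw' _] := Hj w' (le_trans w'1 s2).
    have ww : w = w' by apply: finj => //; rewrite fw fw'.
    have := sep i j Pi Pj ij; have := modulusD (Z i - w) (w - Z j).
    rewrite addrA subrK modulus_distC -ww in w'1 *.
    by rewrite sn4; move: w1 w'1; rewrite sn; lra.
rewrite (eq_bigr (fun i => ((1 - k) / (160 * n)) ^+ 2 * modulus (h' (Z i)) ^+ 2)); last first.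
  by move=> i _; rewrite /q /s; field; rewrite gt_eqF.
rewrite -mulr_sumr -ler_pdivlMl; last by rewrite exprn_gt0 // divr_gt0 // mulr_gt0.
move=> /le_trans; apply; rewrite le_eqVlt; apply/orP; left; apply/eqP.
by field; rewrite !gt_eqF.
Qed.

(** The length-area argument on a polar grid.  A ray on which |f| exceeds [2 t]
at radius [r] and is at most [t] at radius [1 - tau] has at most about
[N * tau] grid points in between.  By [crossing_sum] and the Cauchy-Schwarz
inequality the sum of [|h'|^2] over those of them with [|f| <= 3 t] is at least
a multiple of [N * t^2 / tau]; by [derivative_square_sum] the sum over all rays
is at most a multiple of [N^2 * t^2]. *)
Theorem count_large : exists2 c : R, 0 < c &
  forall r, 0 <= r < 1 -> exists2 N0 : nat, (4 <= N0)%N &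
  forall (N : nat), (N0 <= N)%N -> forall th tau t, 0 < tau <= 1 / 4 -> 1 <= t ->
    (forall z, modulus z <= 1 - tau -> modulus (f z) <= t) -> 1 <= N%:R * tau ->
    \sum_(i < N | 2 * t < modulus (f (circle_point r (th + i%:R / N%:R)))) 1 <=
      c * (N%:R * tau).
Proof.
have [c c0 DS] := derivative_square_sum.
exists (2 * (4 * c) ^+ 2); first by rewrite mulr_gt0 // exprn_gt0 // mulr_gt0.
move=> r r01; case/andP: (r01) => r0 r1; case/andP: (k01) => k0 k1.
have [N0 N04 HN] := uniform_scale r01.
exists N0 => // N NN th tau t /andP[tau0 tau4] t1 ft Ntau.
have := HN N NN; have N4 : 4 <= N%:R :> R by rewrite ler_nat (leq_trans N04).
move: Ntau N4; set n : R := N%:R => Ntau n4 Hn.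
have k2 : 0 < 1 - k by rewrite subr_gt0.
have t0 : 0 < t by lra.
have n0 : 0 < n by lra.
have n1 : 0 < n^-1 by rewrite invr_gt0.
have n14 : n^-1 <= 1 / 4 by rewrite -[n^-1]mul1r ler_pdivrMr //; lra.
have [rt|rt] := leP r (1 - tau).
  rewrite big_pred0; last first.
    move=> i; apply/negbTE; rewrite -leNgt; apply: le_trans (ft _ _) _.
      by rewrite modulus_circle_point ger0_norm.
    by lra.
  apply: mulr_ge0; last exact: le_trans ler01 Ntau.
  by apply: mulr_ge0 => //; exact: sqr_ge0.
(* m radial steps of length 1 / N lead from radius r to 1 - tau or below *)
pose T := n * (r - 1 + tau).
have T0 : 0 <= T by rewrite /T mulr_ge0 ?ltW //; lra.
pose m := (Num.truncn T).+1.
have mT : T < m%:R <= T + 1.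
  have /andP[a1 a2] := truncn_itv T0.
  by rewrite /m a2 -natr1 lerD2r.
have {mT} [Tm mT] : T < m%:R /\ m%:R <= T + 1 by apply/andP.
have m2 : m%:R <= 2 * (n * tau).
  have : n * (r - 1) <= 0 by rewrite mulr_ge0_le0 // ?ltW //; lra.
  by move: mT; rewrite /T; lra.
pose rho (j : nat) : R := r - j%:R / n.
have rho_le j : rho j <= r by rewrite /rho gerBl divr_ge0 // ltW.
have rho_m : rho m <= 1 - tau.
  rewrite /rho; have : T / n <= m%:R / n by rewrite ler_wpM2r ?ltW.
  by rewrite /T mulrAC divff ?gt_eqF // mul1r; lra.
have rho_ge j : (j <= m)%N -> 1 / 2 <= rho j.
  move=> jm; have : j%:R / n <= (T + 1) / n.
    by rewrite ler_wpM2r ?(ltW n1) // (le_trans _ mT) // ler_nat.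
  rewrite mulrDl mul1r {1}/T [n * _]mulrC mulfK ?gt_eqF // /rho; lra.
pose Z (i j : nat) : C := circle_point (rho j) (th + i%:R / n).
have Zmod i j : (j <= m)%N -> modulus (Z i j) = rho j.
  by move=> jm; rewrite modulus_circle_point ger0_norm //; have := rho_ge j jm; lra.
have Zr i j : (j <= m)%N -> modulus (Z i j) <= r by move=> jm; rewrite Zmod.
have ZB i j j' : modulus (Z i j - Z i j') = `|rho j - rho j'|.
  exact: etrans (congr1 (@modulus R) (circle_pointB _ _ _)) (modulus_circle_point _ _).
pose d (i j : nat) : R := 4 * modulus (h' (Z i j)) / n.
pose near i j := modulus (f (Z i j)) <= 3 * t.
have sep (p q : 'I_N * 'I_m) : p != q -> (4 * n)^-1 <= modulus (Z p.1 p.2 - Z q.1 q.2).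
  case: p q => [i j] [i' j'] pq.
  change ((4 * n)^-1 <= modulus (Z i j - Z i' j')).
  have sn4 : (4 * n)^-1 = n^-1 / 4 by field; rewrite gt_eqF.
  have [ii|ii] := eqVneq i i'.
    have jj : (j : nat) != j' by apply: contraNneq pq => /val_inj ->; rewrite ii.
    rewrite ii ZB /rho.
    rewrite (_ : _ - _ = - ((j%:R - j'%:R) * n^-1)); last by ring.
    rewrite normrN normrM (gtr0_norm n1).
    have /andP[H _] := natr_dist R (ltn_ord j) (ltn_ord j') jj.
    have := ler_wpM2r (ltW n1) H; rewrite sn4; lra.
  have /andP[H1 H2] := natr_dist R (ltn_ord i) (ltn_ord i') ii.
  have E : th + i%:R / n - (th + i'%:R / n) = (i%:R - i'%:R) * n^-1 by ring.
  have L1 : n^-1 <= `|th + i%:R / n - (th + i'%:R / n)|.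
    by rewrite E normrM (gtr0_norm n1); have := ler_wpM2r (ltW n1) H1; rewrite mul1r.
  have L2 : `|th + i%:R / n - (th + i'%:R / n)| <= 1.
    by rewrite E normrM (gtr0_norm n1) ler_pdivrMr // mul1r.
  have rj := rho_ge j (ltnW (ltn_ord j)).
  have rj0 : 0 <= rho j by lra.
  apply: le_trans (circle_point_distance (rho j') rj0 L2).
  have : 1 / 2 * (n^-1 / 2) <= rho j * (`|th + i%:R / n - (th + i'%:R / n)| / 2).
    by apply: ler_pM => //; [lra|rewrite ler_pM2r ?invr_gt0].
  by rewrite sn4; lra.
have area : \sum_(p : 'I_N * 'I_m | near p.1 p.2) modulus (h' (Z p.1 p.2)) ^+ 2 <=
    (c * n * t) ^+ 2.
  apply: DS => //.
    move=> [i j] /= nij; have [a b] := Hn (Z i j) (Zr i j (ltnW (ltn_ord j))).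
    by split.
  by move=> p q _ _; exact: sep.
have ray (i : 'I_N) : 2 * t < modulus (f (circle_point r (th + i%:R / n))) ->
    t ^+ 2 <= m%:R * \sum_(j < m | near i j) d i j ^+ 2.
  move=> big; apply: sum_sq_ge => //.
  apply: (@crossing_sum R (fun j => modulus (f (Z i j))) (d i) m t).
  - by rewrite /Z /rho mul0r subr0.
  - by apply: ft; rewrite Zmod.
  - move=> j jm; have jm' := ltnW jm.
    have [h4 loc] := Hn (Z i j) (Zr i j jm').
    split; last by apply: le_trans t1; rewrite /d ler_pdivrMr // mul1r.
    have e1 : 0 <= (1 - k) / 4 <= 1 by apply/andP; split; lra.
    have ZZ : modulus (Z i j.+1 - Z i j) = n^-1.
      rewrite ZB /rho.
      rewrite (_ : _ - _ = - n^-1); last by rewrite -natr1; ring.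
      by rewrite normrN gtr0_norm.
    have := f_step dh dg fE k01 dil e1 loc (w := Z i j.+1).
    rewrite ZZ => /(_ (lexx _)) st.
    apply: le_trans st; rewrite ler_norml lerNl opprB.
    by rewrite modulus_lB -modulus_distC modulus_lB.
have : \sum_(i < N | 2 * t < modulus (f (circle_point r (th + i%:R / n)))) t ^+ 2 <=
    m%:R * (16 / n ^+ 2 * (c * n * t) ^+ 2).
  apply: le_trans (ler_sum _ ray) _.
  apply: (@le_trans _ _ (\sum_(i < N) m%:R * \sum_(j < m | near i j) d i j ^+ 2)).
    rewrite [leRHS](bigID (fun i : 'I_N => 2 * t < modulus (f (circle_point r (th + i%:R / n))))) /=.
    rewrite lerDl sumr_ge0 // => i _; rewrite mulr_ge0 // sumr_ge0 // => j _.
    exact: sqr_ge0.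
  rewrite -mulr_sumr ler_wpM2l // pair_big_dep /=.
  rewrite (eq_bigr (fun p : 'I_N * 'I_m => 16 / n ^+ 2 * modulus (h' (Z p.1 p.2)) ^+ 2)); last first.
    by move=> p _; rewrite /d; field; rewrite gt_eqF.
  by rewrite -mulr_sumr ler_wpM2l // divr_ge0 // sqr_ge0.
rewrite -[X in \sum_(i < N | _) X]mulr1 -mulr_sumr.
have -> : m%:R * (16 / n ^+ 2 * (c * n * t) ^+ 2) =
    t ^+ 2 * ((4 * c) ^+ 2 * m%:R) by field; rewrite gt_eqF.
rewrite ler_pM2l ?exprn_gt0 // => /le_trans; apply.
have := ler_wpM2l (sqr_ge0 (4 * c)) m2.
move: ((4 * c) ^+ 2) (m%:R) (n * tau) => p q s; lra.
Qed.

End LengthArea.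

(** * Layers and Riemann sums *)

Section LayerCake.
Variable R : realType.
Implicit Types (p : R).

(** A value between two consecutive levels is paid for by the term of the lower
one; the factor 3 instead of 2 absorbs the summand 1. *)
Lemma layer_cake p (t : nat -> R) (M : nat) (X : R) : 0 <= p ->
  (forall n, 1 <= t n) -> 0 <= X -> X <= 2 * t M ->
  (X + 1) `^ p <= (3 * t 0%N) `^ p + \sum_(n < M | 2 * t n < X) (3 * t n.+1) `^ p.
Proof.
move=> p0 t1 X0; elim: M => [|M IH] XM.
  rewrite big_ord0 addr0 ge0_ler_powR ?nnegrE //; have := t1 0%N; lra.
rewrite [X in _ <= _ + X]big_mkcond big_ord_recr -big_mkcond /=.
have S0 : 0 <= \sum_(n < M | 2 * t n < X) (3 * t n.+1) `^ p.
  by apply: sumr_ge0 => n _; exact: powR_ge0.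
have P0 : 0 <= (3 * t 0%N) `^ p by exact: powR_ge0.
have [tX|Xt] := ltP (2 * t M) X; last by rewrite addr0; exact: IH.
have : (X + 1) `^ p <= (3 * t M.+1) `^ p.
  by rewrite ge0_ler_powR ?nnegrE //; have := t1 M.+1; lra.
by move: (powR _ _) => a; lra.
Qed.

Lemma geometric_sum_le (q : R) (M : nat) : 0 <= q < 1 -> \sum_(n < M) q ^+ n <= (1 - q)^-1.
Proof.
move=> /andP[q0 q1]; have q2 : 0 < 1 - q by rewrite subr_gt0.
have E : (1 - q) * \sum_(n < M) q ^+ n = 1 - q ^+ M.
  by elim: M => [|M IH]; rewrite ?big_ord0 ?expr0 ?mulr0 ?subrr // big_ord_recr /= mulrDr IH exprS; ring.
rewrite -(ler_pM2l q2) E divff ?gt_eqF //.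
by rewrite gerBl exprn_ge0.
Qed.

(** Summation of the layers: [b ^ n] is the size of the n-th level, [2 ^- n]
the proportion of the sample above it. *)
Lemma mean_power_le (b C c p : R) : 1 <= b -> 1 <= C -> 0 <= c -> 0 <= p -> b `^ p < 2 ->
  exists B : R, forall (M N : nat) (X : 'I_N -> R), (forall i, 0 <= X i <= 2 * (C * b ^+ M)) ->
  (forall n, (n < M)%N -> \sum_(i < N | 2 * (C * b ^+ n) < X i) 1 <= c * (N%:R * 2 ^- n)) ->
  \sum_(i < N) (X i + 1) `^ p <= B * N%:R.
Proof.
move=> b1 C1 c0 p0 bp; pose w := b `^ p; pose q := w / 2.
have w0 : 0 <= w := powR_ge0 _ _.
have q01 : 0 <= q < 1 by rewrite /q; apply/andP; split; [exact: divr_ge0|rewrite ltr_pdivrMr // mul1r].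
pose D := (3 * C) `^ p.
have D0 : 0 <= D := powR_ge0 _ _.
exists (D + D * w * c * (1 - q)^-1) => M N X HX Hc.
pose t n := C * b ^+ n.
have t1 n : 1 <= t n.
  by rewrite /t -[1]mul1r ler_pM // exprn_ege1.
have tp n : (3 * t n) `^ p = D * w ^+ n.
  have C0 : 0 <= 3 * C by lra.
  have b0 : 0 <= b by lra.
  rewrite /t mulrA powRM ?exprn_ge0 // -/D; congr (_ * _).
  rewrite -powR_mulrn // powRAC powR_mulrn //.
apply: (@le_trans _ _ (\sum_(i < N) (D + \sum_(n < M | 2 * t n < X i) D * w ^+ n.+1))).
  apply: ler_sum => i _; have /andP[X0 XM] := HX i.
  apply: le_trans (layer_cake p0 t1 X0 XM) _.
  by rewrite tp expr0 mulr1 lerD2l; apply: ler_sum => n _; rewrite tp.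
rewrite big_split /= sumr_const card_ord -[D *+ N]mulr_natr mulrDl lerD2l.
rewrite (exchange_big_dep xpredT) //=.
apply: (@le_trans _ _ (\sum_(n < M) (D * w * c * N%:R) * q ^+ n)).
  apply: ler_sum => n _.
  rewrite -[X in \sum_(_ < _ | _) X]mulr1 -mulr_sumr.
  have Dw : 0 <= D * w ^+ n.+1 by rewrite mulr_ge0 // exprn_ge0.
  apply: le_trans (ler_wpM2l Dw (Hc n (ltn_ord n))) _.
  rewrite le_eqVlt; apply/orP; left; apply/eqP.
  rewrite /q expr_div_n exprS; field.
  by rewrite expf_neq0.
rewrite -mulr_sumr [leRHS]mulrAC ler_wpM2l ?geometric_sum_le //.
by rewrite !mulr_ge0.
Qed.

Lemma sum_arcs (c : R -> R) (N J : nat) (B : R) : (0 < N)%N ->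
  (forall th, \sum_(i < N) c (th + i%:R / N%:R) <= B) ->
  \sum_(l < J * N) c (l%:R / N%:R) <= J%:R * B.
Proof.
move=> N0 HB; elim: J => [|J IH]; first by rewrite mul0n big_ord0 mul0r.
rewrite mulSnr big_split_ord /= -natr1 mulrDl mul1r lerD //.
rewrite (eq_bigr (fun i : 'I_N => c (J%:R + i%:R / N%:R))) // => i _.
congr c; rewrite natrD natrM; field.
by rewrite pnatr_eq0 -lt0n.
Qed.

(** Comparison with the step function equal to [c l] on the l-th cell. *)
Lemma integral_le_riemann (phi : R -> R) (c : nat -> R) (N J : nat) (b : R) : (0 < N)%N ->
  measurable_fun setT phi -> (forall x, 0 <= phi x) -> (forall l, 0 <= c l) ->
  0 <= b < J%:R ->
  (forall l x, l%:R / N%:R <= x <= l.+1%:R / N%:R -> phi x <= c l) ->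
  (\int[@lebesgue_measure R]_(x in `[0%R, b]) (phi x)%:E <= ((\sum_(l < J * N) c l) / N%:R)%:E)%E.
Proof.
move=> N0 mphi phi0 c0 /andP[b0 bJ] Hc.
have n0 : 0 < N%:R :> R by rewrite ltr0n.
pose cell (l : nat) : set R := `[l%:R / N%:R, l.+1%:R / N%:R]%classic.
have mcell l : measurable (cell l) by exact: measurable_itv.
have mD : measurable `[0, b]%classic by exact: measurable_itv.
pose G (l : 'I_(J * N)) (x : R) : \bar R := ((c l)%:E * (\1_(cell l) x)%:E)%E.
have mI l : measurable_fun `[0, b]%classic (fun x : R => (\1_(cell l) x)%:E : \bar R).
  by apply/measurable_EFinP; apply: measurable_funTS; exact: measurable_indic.
have mG l : measurable_fun `[0, b]%classic (G l).
  by apply: emeasurable_funM => //; exact: measurable_cst.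
have G0 l x : (0 <= G l x)%E by rewrite /G -EFinM lee_fin mulr_ge0.
apply: (@le_trans _ _ (\int[@lebesgue_measure R]_(x in `[0%R, b]) \sum_(l < J * N) G l x)%E).
  apply: ge0_le_integral => //.
  - by move=> x _; rewrite lee_fin.
  - by apply/measurable_EFinP; exact: measurable_funTS.
  - by apply: emeasurable_sum.
  - move=> x; rewrite /= in_itv /= => /andP[x0 xb].
    have xN0 : 0 <= x * N%:R by rewrite mulr_ge0 // ltW.
    have /andP[l1 l2] := truncn_itv xN0.
    set l := Num.truncn _ in l1 l2.
    have lJ : (l < J * N)%N.
      rewrite -(ltr_nat R) natrM; apply: le_lt_trans l1 _.
      by rewrite ltr_pM2r // (le_lt_trans xb).
    have xc : l%:R / N%:R <= x <= l.+1%:R / N%:R.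
      by rewrite ler_pdivrMr // ler_pdivlMr // l1 ltW.
    rewrite (bigD1 (Ordinal lJ)) //= -[leLHS]adde0; apply: leeD; last first.
      by apply: sume_ge0.
    rewrite /G indicE mem_set /=; last by rewrite /cell /= in_itv.
    by rewrite mule1 lee_fin; exact: Hc.
rewrite ge0_integral_sum //.
rewrite mulr_suml -sumEFin; apply: lee_sum => l _.
rewrite ge0_integralZl_EFin //; last exact: mI.
rewrite EFinM lee_wpmul2l ?lee_fin // integral_indic //; last exact: mcell.
apply: (@le_trans _ _ (@lebesgue_measure R (cell l))).
  by apply: le_measure; rewrite ?inE; [exact: (measurableI _ _ (mcell l) mD)|exact: mcell|exact: subIsetl].
rewrite /cell lebesgue_measure_itv /= lte_fin ifT; last by rewrite ltr_pM2r ?invr_gt0 // ltr_nat.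
by rewrite -EFinD lee_fin -natr1; lra.
Qed.

End LayerCake.

(** * Integral means *)

Section HardySpace.
Variable R : realType.
Local Notation C := (R[i]^o).

Lemma chord_le_arc (r a b : R) : 0 <= r -> a <= b ->
  modulus ((circle_point r b : C) - (circle_point r a : C)) <= r * (b - a).
Proof.
move=> r0 ab; rewrite mulrBr.
apply: (@mean_value_ineq R (circle_point r) (fun t => circle_point r (t + pi / 2))
  (fun t => r * t) (fun=> r) a b ab).
- move=> t _; split => /=.
    rewrite cosDpihalf.
    by have := is_deriveZ r (is_derive_cos t); rewrite /GRing.scale.
  rewrite sinDpihalf.
  by have := is_deriveZ r (is_derive_sin t); rewrite /GRing.scale.
- move=> t _; have := is_deriveZ r (is_derive_id (t : R^o) (1 : R^o)).
  by rewrite /GRing.scale /= mulr1.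
- by move=> t _; rewrite modulus_circle_point ger0_norm.
Qed.

Section Mean.
Variables (f h g h' g' h'' : C -> C) (k A p : R).
Hypothesis dh : forall z, disc z -> is_derive z (1 : C) h (h' z).
Hypothesis dg : forall z, disc z -> is_derive z (1 : C) g (g' z).
Hypothesis dh' : forall z, disc z -> is_derive z (1 : C) h' (h'' z).
Hypothesis fE : forall z, disc z -> f z = h z + (g z)^*%C.
Hypothesis k01 : 0 <= k < 1.
Hypothesis dil : forall z, disc z ->
  0 < modulus (h' z) /\ modulus (g' z) <= k * modulus (h' z).
Hypothesis A0 : 0 < A.
Hypothesis schwarz : forall z, disc z ->
  (1 - modulus z ^+ 2) * modulus (h'' z) <=
  (2 * A + 2 * modulus z) * modulus (h' z).
Hypothesis h'1 : h' 0 = 1.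
Hypothesis finj : forall z w, disc z -> disc w -> f z = f w -> z = w.
Hypothesis h0 : h 0 = 0.
Hypothesis g0 : g 0 = 0.
Hypothesis p0 : 0 < p.
Hypothesis pA : p * A < 1.

Let b := expR (A * ln 2).

(** Halving the distance to the unit circle multiplies the growth bound by
[b = 2 ^ A]. *)
Lemma level_growth : exists2 C1, 1 <= C1 & forall n z,
  modulus z <= 1 - 2 ^- n / 4 -> modulus (f z) <= C1 * b ^+ n.
Proof.
have [C0 C00 HC] := f_growth dh dg dh' fE k01 dil A0 schwarz h0 g0 h'1.
exists (Num.max 1 (C0 * b ^+ 2)); first by rewrite le_max lexx.
move=> n z zn; have t0 : 0 < 2 ^- n / 4 :> R by rewrite divr_gt0 // invr_gt0 exprn_gt0.
have dz : disc z by apply: le_lt_trans zn _; rewrite ltrBlDr ltrDl.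
apply: le_trans (HC z dz) _.
apply: (@le_trans _ _ (C0 * b ^+ 2 * b ^+ n)); last first.
  by rewrite ler_wpM2r ?exprn_ge0 ?expR_ge0 // le_max lexx orbT.
rewrite -mulrA ler_wpM2l ?(ltW C00) // -exprD /b -expRM_natl ler_expR.
rewrite mulNr -mulrN mulrCA ler_wpM2l ?(ltW A0) //.
have e : (2 + n)%:R * ln 2 = - ln (2 ^- n / 4) :> R.
  rewrite -lnV ?posrE // invf_div invrK (_ : 4 * 2 ^+ n = 2 ^+ (2 + n)).
    by rewrite lnXn // mulr_natl.
  by rewrite exprD expr2; ring.
by rewrite e lerN2 ler_ln ?posrE ?subr_gt0 //; lra.
Qed.

(** The hypothesis [p * A < 1] in the form in which it makes the sum over the
layers converge: the p-th powers of the levels grow more slowly than the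
proportions of the sample above them decay. *)
Lemma b_powR_lt2 : b `^ p < 2.
Proof.
have l2 : 0 < ln 2 :> R by rewrite ln_gt0 // ltr1n.
rewrite /b /powR gt_eqF ?expR_gt0 // expRK -[ltRHS](@lnK _ 2) ?posrE // ltr_expR.
by rewrite mulrA -[ltRHS]mul1r ltr_pM2r.
Qed.

Lemma f_circle_measurable r : 0 <= r < 1 ->
  measurable_fun setT (fun th : R => modulus (f (circle_point r th)) `^ p).
Proof.
move=> /andP[r0 r1].
apply: (measurableT_comp (measurable_powR p)); apply: continuous_measurable_fun => th.
have dz x : disc (circle_point r x : C).
  by change (modulus (circle_point r x : C) < 1); rewrite modulus_circle_point ger0_norm.
apply/cvgrPdist_le => e e0.
have [d d0 Hd] := f_ccont dh dg fE (dz th) e0.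
exists d => // x /=; rewrite /ball /= => thx.
have close : modulus ((circle_point r x : C) - (circle_point r th : C)) < d.
  apply: le_lt_trans thx.
  have r1' := ltW r1.
  have [xt|tx] := leP x th.
    rewrite modulus_distC ger0_norm ?subr_ge0 //; apply: le_trans (chord_le_arc r0 xt) _.
    by rewrite ler_piMl // subr_ge0.
  rewrite distrC gtr0_norm ?subr_gt0 //; apply: le_trans (chord_le_arc r0 (ltW tx)) _.
  by rewrite ler_piMl // subr_ge0 ltW.
have H := ltW (Hd _ close); apply: le_trans H.
rewrite ler_norml lerNl opprB modulus_lB /= modulus_distC.
exact: modulus_lB.
Qed.

(** The grid estimates hold on arcs of length 1, on which distinct grid points
are well separated; the circle is covered by eight of them, as [2 * pi < 8].
On a cell of the grid |f| varies by at most 1. *)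
Theorem circle_integral_bounded : exists B : R, forall r, 0 <= r < 1 ->
  (\int[@lebesgue_measure R]_(th in `[0%R, (2 * pi)%R])
     (modulus (f (circle_point r th)) `^ p)%:E <= B%:E)%E.
Proof.
have [c c0 HL] := count_large dh dg dh' fE k01 dil A0 schwarz h'1 finj.
have [C1 C11 lev] := level_growth.
have ln2 : 0 <= ln 2 :> R by rewrite ln_ge0 // ler1n.
have b1 : 1 <= b by rewrite /b -[leLHS]expR0 ler_expR mulr_ge0 // ltW.
have c40 : 0 <= c / 4 by rewrite divr_ge0 // ltW.
have [B HB] := mean_power_le b1 C11 c40 (ltW p0) b_powR_lt2.
exists (8 * B) => r r01; case/andP: (r01) => r0 r1.
have [N0 N04 HN0] := HL r r01.
have [N1 N14 HN1] := uniform_scale dh' k01 A0 schwarz h'1 r01.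
have [M HM] : exists M, 1 / 2 ^+ M < 1 - r by apply: exp2_lt_eps; rewrite subr_gt0.
pose N := (N0 + N1 + 4 * 2 ^ M)%N.
have NN0 : (N0 <= N)%N by rewrite /N -addnA leq_addr.
have NN1 : (N1 <= N)%N by rewrite /N -addnA addnCA leq_addr.
have Npos : (0 < N)%N by apply: leq_trans NN0; exact: leq_trans N04.
have n0 : 0 < N%:R :> R by rewrite ltr0n.
have Nn n : (n <= M)%N -> 1 <= N%:R * (2 ^- n / 4) :> R.
  move=> nM; rewrite mulrA ler_pdivlMr // mul1r ler_pdivlMr ?exprn_gt0 //.
  rewrite -natrX -natrM ler_nat; apply: (@leq_trans (4 * 2 ^ M)); last exact: leq_addl.
  by rewrite leq_mul2l /= leq_exp2l.
have dz x : disc (circle_point r x : C).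
  by change (modulus (circle_point r x : C) < 1); rewrite modulus_circle_point ger0_norm.
have rM : r <= 1 - 2 ^- M / 4.
  have : 0 < 2 ^- M :> R by rewrite invr_gt0 exprn_gt0.
  by move: HM; rewrite mul1r; lra.
pose X (x : R) : R := modulus (f (circle_point r x)).
have mean th : \sum_(i < N) (X (th + i%:R / N%:R) + 1) `^ p <= B * N%:R.
  apply: (HB M N (fun i => X (th + i%:R / N%:R))).
    move=> i; rewrite modulus_ge0 /=.
    apply: (@le_trans _ _ (C1 * b ^+ M)).
      by apply: lev; rewrite modulus_circle_point ger0_norm.
    by rewrite ler_peMl ?ler1n // mulr_ge0 ?exprn_ge0 ?(le_trans ler01).
  move=> n nM.
  have -> : c / 4 * (N%:R * 2 ^- n) = c * (N%:R * (2 ^- n / 4)) by ring.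
  apply: HN0 => //; last exact: Nn (ltnW nM).
  - rewrite divr_gt0 ?invr_gt0 ?exprn_gt0 //=.
    rewrite ler_pdivrMr // (_ : 1 / 4 * 4 = 1); last by field.
    by rewrite invf_le1 ?exprn_gt0 // exprn_ege1 // ler1n.
  - by rewrite -[1]mul1r ler_pM // exprn_ege1.
  - by move=> z; exact: lev.
have pi4 : pi < 4 :> R by have := pihalf_lt2 R; lra.
have pi0 : 0 <= pi :> R := pi_ge0 R.
apply: le_trans (@integral_le_riemann R (fun x => X x `^ p) (fun l => (X (l%:R / N%:R) + 1) `^ p)
  N 8 (2 * pi) Npos _ _ _ _ _) _.
- exact: f_circle_measurable.
- by move=> x; exact: powR_ge0.
- by move=> l; exact: powR_ge0.
- by apply/andP; split; [rewrite mulr_ge0|lra].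
- move=> l x /andP[lx xl].
  rewrite ge0_ler_powR ?(ltW p0) ?nnegrE ?addr_ge0 ?modulus_ge0 //.
  set y := l%:R / N%:R in lx *.
  have yr : modulus (circle_point r y : C) <= r by rewrite modulus_circle_point ger0_norm.
  have [h4 loc] := HN1 N NN1 (circle_point r y) yr.
  have xy : modulus ((circle_point r x : C) - (circle_point r y : C)) <= N%:R^-1.
    apply: le_trans (chord_le_arc r0 lx) _.
    have : x - y <= N%:R^-1 by rewrite /y; move: xl; rewrite -natr1 mulrDl mul1r; lra.
    apply: le_trans; rewrite ler_piMl ?subr_ge0 //; exact: ltW.
  have e1 : 0 <= (1 - k) / 4 <= 1 by case/andP: (k01) => k0 k1; apply/andP; split; lra.
  have st := f_step dh dg fE k01 dil e1 loc xy.
  rewrite /X -[modulus (f (circle_point r x))](subrK (modulus (f (circle_point r y)))).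
  rewrite addrC lerD2l; apply: le_trans (modulus_lB _ _) _; apply: le_trans st _.
  apply: (@le_trans _ _ (N%:R * N%:R^-1)); last by rewrite divff // gt_eqF.
  by apply: ler_pM; [rewrite mulr_ge0 // modulus_ge0|exact: modulus_ge0|exact: h4|exact: xy].
- rewrite lee_fin ler_pdivrMr //.
  have := @sum_arcs R (fun x => (X x + 1) `^ p) N 8 (B * N%:R) Npos mean.
  by rewrite mulrA.
Qed.

End Mean.
End HardySpace.

Unset Implicit Arguments.
Set Strict Implicit.
Set Printing Implicit Defensive.
Local Close Scope classical_set_scope.

Theorem theorem1 (R : realType) (K : R) (hK : 1 <= K)
    (f h g : R[i]^o -> R[i]^o) (hf : class_SHK K f h g)
    (p : R) (hp0 : 0 < p) (hp : (p%:E < (alpha K)^-1)%E) :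
  hardy_h p f.
Proof.
have [A [A0 pA HA]] : exists A, [/\ 0 < A, p * A < 1 &
    forall f h g : R[i]^o -> R[i]^o, class_SHK K f h g ->
      modulus (derive1 (derive1 h) 0 / 2) <= A].
  by apply: alpha_lt hp0 hp _; exists f, h, g.
have schwarz := pre_schwarzian hK HA hf.
have [k k01 dil] := class_SHK_dilatation hK hf.
case: (hf) => [[[[ah ag] fE [h0 g0] h1] _ inj] _].
have fH : harmonic_on_disc f by exact: (@class_H_harmonic R f h g).
split=> //.
have dh z (dz : disc z) := derivable1_is_derive (ah z dz).
have dg z (dz : disc z) := derivable1_is_derive (ag z dz).
have dh' z (dz : disc z) := derivable1_is_derive (analytic_derive1 ah dz).
have finj z w : disc z -> disc w -> f z = f w -> z = w.
  by move=> dz dw E; apply: inj => //; exact: mem_set.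
have [B HB] := circle_integral_bounded dh dg dh' fE k01 dil A0 schwarz h1 finj h0 g0 hp0 pA.
have pi0 : 0 <= (2 * pi)^-1 :> R by rewrite invr_ge0 mulr_ge0 // pi_ge0.
apply: (@le_lt_trans _ _ ((((2 * pi)^-1 * B)%:E `^ p^-1)%E)); last by rewrite poweR_EFin ltry.
apply: ge_ereal_sup => _ [r /= rI <-].
have {rI} r01 : 0 <= r < 1 by move: rI; rewrite in_itv /= => /andP[/ltW -> ->].
have I0 : (0 <= \int[@lebesgue_measure R]_(th in `[0%R, (2 * pi)%R])
     (modulus (f (circle_point r th)) `^ p)%:E)%E.
  by apply: integral_ge0 => x _; rewrite lee_fin powR_ge0.
have pi1 : (0 <= ((2 * pi)^-1)%:E :> \bar R)%E by rewrite lee_fin.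
have le1 := lee_wpmul2l pi1 (HB r r01).
have pV : 0 <= p^-1 by rewrite invr_ge0 ltW.
rewrite -poweR_EFin /integral_mean; apply: (gt0_ler_poweR pV).
- by rewrite in_itv /= leey andbT mule_ge0.
- by rewrite in_itv /= leey andbT EFinM; apply: le_trans le1; exact: mule_ge0.
- by rewrite EFinM; exact: le1.
Qed.
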